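(* There is an algorithm that solves the single-target change-making problem in $O(u\log^3 u)$ time, where $u=\max_{1\le i\le n} v_i$ is the largest coin value.
   Context: Single-target change-making: given a set $V=\{v_1,\dots,v_n\}$ of $n$ distinct positive integers (coin values) and a positive integer target $t$, compute the minimum of $\sum_{i=1}^n m_i$ over all $m_1,\dots,m_n\in\mathbb{N}=\{0,1,2,\dots\}$ with $\sum_{i=1}^n m_i v_i=t$ (the minimum number of coins, each value usable arbitrarily many times, summing to exactly $t$), or report that no such representation exists. *)

(* Defs.v *)
From mathcomp Require Import all_boot.
Set Implicit Arguments.
Unset Strict Implicit.
Unset Printing Implicit Defensive.

Definition max_coin (n : nat) (v : n.-tuple nat) : nat := \max_(i < n) tnth v i.

Definition represents (n : nat) (v : n.-tuple nat) (t : nat) (m : 'I_n -> nat) : Prop :=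
  \sum_(i < n) m i * tnth v i = t.

Definition num_coins (n : nat) (m : 'I_n -> nat) : nat := \sum_(i < n) m i.

(* [None] reports that the target has no representation. *)
Definition is_solution (n : nat) (v : n.-tuple nat) (t : nat) (a : option nat) : Prop :=
  match a with
  | Some k =>
      (exists2 m : 'I_n -> nat, represents v t m & num_coins m = k) /\
      (forall m : 'I_n -> nat, represents v t m -> k <= num_coins m)
  | None => forall m : 'I_n -> nat, ~ represents v t m
  end.

(* The unit-cost word RAM with w-bit words, with structured control flow
   instead of jumps.  A program mentions finitely many registers, and has
   random access to a memory of 2 ^ w words. *)

Inductive binop : Type := OpAdd | OpSub | OpMul | OpDiv | OpMod | OpLt | OpEq.

Inductive expr : Type :=
| Const of nat
| Reg of nat
| Read of expr
| Bin of binop & expr & expr.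

Inductive cmd : Type :=
| Skip
| Assign of nat & expr
| Write of expr & expr
| Seq of cmd & cmd
| If of expr & cmd & cmd
| While of expr & cmd.

Record state : Type := State { regs : nat -> nat; mem : nat -> nat }.

Definition update (f : nat -> nat) (a x : nat) : nat -> nat :=
  fun b => if b == a then x else f b.

(* Words are the naturals below 2 ^ w; [OpAdd], [OpSub] and [OpMul] wrap around,
   and division by 0 has the value given by [%/] and [%%]. *)
Definition eval_binop (w : nat) (o : binop) (x y : nat) : nat :=
  match o with
  | OpAdd => (x + y) %% 2 ^ w
  | OpSub => (x + (2 ^ w - y)) %% 2 ^ w
  | OpMul => (x * y) %% 2 ^ w
  | OpDiv => x %/ y
  | OpMod => x %% y
  | OpLt => nat_of_bool (x < y) %% 2 ^ w
  | OpEq => nat_of_bool (x == y) %% 2 ^ w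
  end.

Fixpoint eval (w : nat) (s : state) (e : expr) : nat :=
  match e with
  | Const k => k %% 2 ^ w
  | Reg r => regs s r
  | Read e1 => mem s (eval w s e1)
  | Bin o e1 e2 => eval_binop w o (eval w s e1) (eval w s e2)
  end.

(* Every operand access, memory access and arithmetic operation costs 1. *)
Fixpoint cost (e : expr) : nat :=
  match e with
  | Const _ | Reg _ => 1
  | Read e1 => (cost e1).+1
  | Bin _ e1 e2 => (cost e1 + cost e2).+1
  end.

(* [exec w c s k s']: with word size w, the program c started in state s
   terminates in state s' after k time units.  A test succeeds iff its value
   is nonzero. *)
Inductive exec (w : nat) : cmd -> state -> nat -> state -> Prop :=
| ExecSkip s : exec w Skip s 1 s
| ExecAssign s r e :
    exec w (Assign r e) s (cost e).+1
      (State (update (regs s) r (eval w s e)) (mem s))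
| ExecWrite s a e :
    exec w (Write a e) s (cost a + cost e).+1
      (State (regs s) (update (mem s) (eval w s a) (eval w s e)))
| ExecSeq c1 c2 s s1 s2 k1 k2 :
    exec w c1 s k1 s1 -> exec w c2 s1 k2 s2 ->
    exec w (Seq c1 c2) s (k1 + k2) s2
| ExecIfTrue e c1 c2 s s' k :
    eval w s e != 0 -> exec w c1 s k s' ->
    exec w (If e c1 c2) s (cost e + k).+1 s'
| ExecIfFalse e c1 c2 s s' k :
    eval w s e = 0 -> exec w c2 s k s' ->
    exec w (If e c1 c2) s (cost e + k).+1 s'
| ExecWhileTrue e c s s1 s2 k1 k2 :
    eval w s e != 0 -> exec w c s k1 s1 -> exec w (While e c) s1 k2 s2 ->
    exec w (While e c) s (cost e + k1 + k2).+1 s2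
| ExecWhileFalse e c s :
    eval w s e = 0 -> exec w (While e c) s (cost e).+1 s.

(* The input occupies the memory cells 0, ..., n + 1 as n, t, v_1, ..., v_n;
   everything else is 0. *)
Definition input (n : nat) (v : n.-tuple nat) (t : nat) : state :=
  State (fun=> 0) (nth 0 [:: n, t & v]).

(* Register 0 tells whether a representation exists; if so, register 1
   contains the number of coins. *)
Definition output (s : state) : option nat :=
  if regs s 0 == 0 then None else Some (regs s 1).

Definition bit_length (x : nat) : nat := (trunc_log 2 x).+1.

(* Base-2 logarithm rounded down, and replaced by 1 at x = 1 so that a bound
   O(u log^3 u) still allows constant time for u = 1. *)
Definition log2 (x : nat) : nat := maxn 1 (trunc_log 2 x).

(* Main.v *)
(* Adding the value 0 to the coins makes the targets reachable with exactly k
   values monotone in k.  If t >= u^2, some optimal solution uses a coin u (any u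
   other coins contain a block whose sum is a multiple of u), so t is first
   reduced below u^2 + u.  The least k is then found bit by bit with O(log u)
   decisions "is t a sum of k values?".  A sum of 2 k values splits into two sums
   of k values that differ by at most u, so it is enough to know, for k / 2^i,
   the sums in a window of width O(u) around t / 2^i; going from one level to the
   next takes two convolutions of 0-1 sequences of length O(u).

   The convolutions use a complex FFT in fixed point.  With 2^e points it is
   organised as successive reductions modulo X^(2 h) - c^2 into X^h - c and
   X^h + c, so that the twiddle factor depends only on the block, and the inverse
   just undoes the stages.  All errors are bounded by powers of 2^e, against a
   scale of 2^(20 e), and the roots of unity come from half-angle formulas and
   integer square roots. *)
Require Import Defs.
From mathcomp Require Import all_boot.
From mathcomp Require Import all_order all_algebra complex realalg zify ring lra.
Set Implicit Arguments.
Unset Strict Implicit.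
Unset Printing Implicit Defensive.
Import Order.TTheory GRing.Theory Num.Theory.

(** * Sums of a given number of coins *)

(** The window has half-width [2 * u] because that value reproduces itself: setting aside one coin
    loses [u], splitting into nearly equal halves loses another [u], and halving the target sends
    [2 * u + u + u] back to [2 * u]. Each word of the transforms is compared with an exact element
    of a real closed field. Write [N = 2 ^ e]. The table of roots is accurate to [N ^ 7] units; over
    [e] stages magnitudes grow by at most [N ^ 2] and errors by [N ^ 4], so a convolution ends with
    an error of at most [8 * N ^ 17] units. The inverse transform leaves out the division by [N],
    hence a count of at least 1 shows up as at least [N * D] units, where [D = N ^ 20], and
    comparing with [N * D / 2] recovers the exact 0-1 answer. Intermediate products stay below
    [N ^ 48], which is why words of [64 * e] bits suffice. The cost is that of [2 * e] search bits,
    times [2 * e] levels, times two convolutions in [O (N * e)], with [N <= 16 * u]. Reading the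
    input is affordable because distinct positive values force [n <= u]. *)

Definition ksum (V : seq nat) (k x : nat) : Prop :=
  exists s : seq nat, [/\ size s = k, {subset s <= 0 :: V} & sumn s = x].

Section KSum.
Variables (V : seq nat) (u : nat).
Hypothesis V_le : {in V, forall x, x <= u}.

Lemma ksum0 x : ksum V 0 x <-> x = 0.
Proof.
split=> [[s [/size0nil -> _ <-]]//|->].
by exists [::].
Qed.

Lemma ksumD k l x y : ksum V k x -> ksum V l y -> ksum V (k + l) (x + y).
Proof.
move=> [s [<- sV <-]] [r [<- rV <-]]; exists (s ++ r); split.
- by rewrite size_cat.
- by move=> z; rewrite mem_cat => /orP[/sV|/rV].
- by rewrite sumn_cat.
Qed.

Lemma ksum1 x : x \in 0 :: V -> ksum V 1 x.
Proof.
move=> xV; exists [:: x]; split=> //=; last by rewrite addn0.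
by move=> y; rewrite inE => /eqP->.
Qed.

Lemma ksum_zeros k : ksum V k 0.
Proof.
exists (nseq k 0); split; first by rewrite size_nseq.
  by move=> x; rewrite mem_nseq inE => /andP[_ ->].
by rewrite sumn_nseq mul0n.
Qed.

Lemma ksum_mono k l x : k <= l -> ksum V k x -> ksum V l x.
Proof.
move=> kl kx; rewrite -(subnKC kl) -(addn0 x).
exact: ksumD kx (ksum_zeros _).
Qed.

Lemma ksumS k x : ksum V k.+1 x ->
  exists y c, [/\ ksum V k y, c \in 0 :: V & x = y + c].
Proof.
move=> [] [|c s] [] // [sz] sV <-; exists (sumn s), c; split=> //.
- by exists s; split=> // z zs; apply: sV; rewrite inE zs orbT.
- by apply: sV; rewrite inE eqxx.
- exact: addnC.
Qed.

Lemma mem_le c : c \in 0 :: V -> c <= u.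
Proof. by rewrite inE => /orP[/eqP->|/V_le]. Qed.

(* A list of even length is paired up greedily, the larger element of each pair
   going to the half with the smaller sum, so the two sums stay within [u]. *)
Lemma ksum_halve a x : ksum V (a + a) x ->
  exists y z, [/\ ksum V a y, ksum V a z, x = y + z, y <= z & z <= y + u].
Proof.
elim: a x => [|a IH] x.
  by move=> /ksum0->; exists 0, 0; split=> //; apply: ksum_zeros.
rewrite addSn addnS => /ksumS [x1 [c1 [/ksumS [x2 [c2 [kx c2V ->]]] c1V ->]]].
have [y [z [ky kz -> yz zy]]] := IH _ kx.
have c1u := mem_le c1V; have c2u := mem_le c2V.
have kp b c : ksum V a b -> c \in 0 :: V -> ksum V a.+1 (b + c).
  by move=> kb cV; rewrite -addn1; apply: ksumD kb (ksum1 cV).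
have fin b c d e : ksum V a b -> ksum V a c -> d \in 0 :: V -> e \in 0 :: V ->
    b <= c -> c <= b + u -> d <= u -> e <= d -> 
    exists y z, [/\ ksum V a.+1 y, ksum V a.+1 z,
      b + c + e + d = y + z, y <= z & z <= y + u].
  move=> kb kc dV eV bc cb du ed.
  case: (leqP (b + d) (c + e)) => h.
    by exists (b + d), (c + e); split; [apply: kp|apply: kp|lia|lia|lia].
  by exists (c + e), (b + d); split; [apply: kp|apply: kp|lia|lia|lia].
case: (leqP c1 c2) => h.
  have [y' [z' [A B C D E]]] := fin _ _ _ _ ky kz c2V c1V yz zy c2u h.
  by exists y', z'; split=> //; lia.
have [y' [z' [A B C D E]]] := fin _ _ _ _ ky kz c1V c2V yz zy c1u (ltnW h).
by exists y', z'; split=> //; lia.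
Qed.

(** Index [2 * u] stands for the target, and [j] encodes the sum [j + t - 2 * u]. The relation is
    written with additions since truncated subtraction would confuse small sums when [t < 2 * u]. *)
Definition window (k t : nat) (A : nat -> Prop) : Prop :=
  (forall j, A j -> j <= 4 * u /\ exists2 x, ksum V k x & x + 2 * u = j + t) /\
  (forall x, ksum V k x -> t <= x + 2 * u -> x <= t + 2 * u ->
     A (x + 2 * u - t)).

(** Removing an odd coin from a sum in the window leaves at least [t - 3 * u], and at most
    [t + 2 * u]. Its two halves differ by at most [u], so they lie between [(t - 4 * u) / 2] and
    [(t + 3 * u) / 2], inside the window around [t./2]. [B] holds the sums of two halves, with
    offset [3 * u]; the term [odd t] repairs the rounding in [t./2]. *)
Lemma window_step k t (A B C : nat -> Prop) :
  0 < u -> window k./2 t./2 A ->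
  (forall j, B j <-> j <= 5 * u /\
     exists j1 j2, [/\ A j1, A j2 & j1 + j2 = j + u + odd t]) ->
  (forall j, C j <-> j <= 4 * u /\
     exists j1 j2 : nat, [/\ B j1, j2 \in (if odd k then 0 :: V else [:: 0])
                        & j1 + j2 = j + u]) ->
  window k t C.
Proof.
move=> u_gt0 [As Ac] BE CE.
have kE := odd_double_half k; have tE := odd_double_half t.
have twice : k./2 + k./2 = k./2.*2 by rewrite addnn.
have Bs j : B j -> j <= 5 * u /\
    exists2 x, ksum V (k./2 + k./2) x & x + 3 * u = j + t.
  move=> /BE [jle [j1 [j2 [/As [l1 [x1 k1 e1]] /As [l2 [x2 k2 e2]] e]]]].
  split=> //; exists (x1 + x2); first exact: ksumD.
  by lia.
have Bc x : ksum V (k./2 + k./2) x -> t <= x + 3 * u -> x <= t + 2 * u ->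
    B (x + 3 * u - t).
  move=> /ksum_halve [y [z [ky kz xE yz zy]]] lo hi.
  apply/BE; split; first by lia.
  exists (y + 2 * u - t./2), (z + 2 * u - t./2); split; try (apply: Ac => //; lia).
  by lia.
split=> [j /CE [jle [j1 [j2 [/Bs [l1 [x1 k1 e1]] Hj2 e]]]]|x kx lo hi].
  split=> //; exists (x1 + j2); last by lia.
  suff: ksum V (odd k + (k./2 + k./2)) (x1 + j2) by rewrite twice kE.
  move: Hj2; case: (odd k) => Hj2.
    by rewrite addnC; apply: ksumD k1 (ksum1 Hj2).
  by move: Hj2; rewrite inE => /eqP->; rewrite addn0.
apply/CE; split; first by lia.
move: kx; rewrite -{1}kE; case: (odd k) => /=; rewrite ?add0n -twice.
  rewrite add1n => /ksumS [y [c [ky cV xE]]]; have cu := mem_le cV.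
  exists (y + 3 * u - t), c; split=> //; last by lia.
  by apply: Bc => //; lia.
move=> ky; exists (x + 3 * u - t), 0; split=> //; last by lia.
by apply: Bc => //; lia.
Qed.

Lemma window0 : window 0 0 (fun j => j = 2 * u).
Proof.
split=> [j ->|x /ksum0 ->]; last by lia.
by split; [lia|exists 0; [exact/ksum0|lia]].
Qed.

Lemma window_target k t A : window k t A -> A (2 * u) <-> ksum V k t.
Proof.
move=> [As Ac]; split.
  by move=> /As [_ [x kx e]]; have -> : t = x by lia.
move=> kt; have := Ac _ kt; rewrite addKn; apply; lia.
Qed.

(* Among u coins some consecutive block has a sum q * u with q at most the
   length of the block, and may be replaced by q coins of value u. *)
Lemma block_sum (s : seq nat) : 0 < u -> u <= size s -> {in s, forall x, 0 < x} ->
  exists s1 s2 s3 q, [/\ s = s1 ++ s2 ++ s3, sumn s2 = q * u & 0 < q].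
Proof.
move=> u_gt0 us s_gt0.
(* Pigeonhole: the prefixes of lengths 0 to [u] have [u + 1] sums but only [u] residues. *)
pose f (i : 'I_u.+1) : 'I_u := Ordinal (ltn_pmod (sumn (take i s)) u_gt0).
have /injectivePn [i [j ij fij]] : ~~ injectiveb f.
  by apply/negP => /injectiveP /leq_card; rewrite !card_ord ltnn.
wlog lt_ij : i j ij fij / i < j.
  move=> IH; case: (ltngtP i j) => h; first exact: (IH i j).
    by apply: (IH j i) => //; rewrite eq_sym.
  by case/negP: ij; apply/eqP/val_inj.
have jle : j <= size s by apply: leq_trans us; rewrite -ltnS.
have := congr1 val fij => /= /eqP fE.
set s2 := take (j - i) (drop i s).
have tE : take j s = take i s ++ s2 by rewrite -takeD subnKC // ltnW.
have : u %| sumn s2.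
  move: fE; rewrite tE sumn_cat -{1}[sumn (take i s)]addn0 eqn_modDl mod0n.
  by rewrite eq_sym.
move=> /dvdnP [q qE]; exists (take i s), s2, (drop (j - i) (drop i s)), q.
split=> //; first by rewrite cat_take_drop cat_take_drop.
(* With [q = 0] the nonempty block from [i] to [j] would have sum 0, against the positivity of its
   first element. *)
rewrite lt0n; apply/eqP => q0; move: qE; rewrite q0 mul0n /s2.
have idrop : i < size s by apply: leq_trans lt_ij _.
rewrite (drop_nth 0) //.
have -> : j - i = (j - i.+1).+1 by lia.
move=> /= sE; have := s_gt0 (nth 0 s i); rewrite mem_nth //; lia.
Qed.

Lemma sumn_le (s : seq nat) m : {in s, forall x, x <= m} -> sumn s <= size s * m.
Proof.
elim: s => //= a s IH h; rewrite mulSn leq_add //; first by apply: h; rewrite inE eqxx.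
by apply: IH => x xs; apply: h; rewrite inE xs orbT.
Qed.

Lemma sumn_filter0 (s : seq nat) : sumn [seq x <- s | 0 < x] = sumn s.
Proof. by elim: s => //= -[|a] s IH /=; rewrite IH. Qed.

Lemma sumn_rem (s : seq nat) x : x \in s -> sumn s = x + sumn (rem x s).
Proof. by move=> /perm_to_rem /perm_sumn ->. Qed.

(** If [u] does not occur, all coins are at most [u - 1], so a sum of at least [u * u] takes at
    least [u] nonzero coins. A block of sum [q * u] has at least [q] of them, and exchanging it for
    [q] coins [u] does not lengthen the list. *)
Lemma ksum_remove_max k t : 0 < u -> u \in V -> u * u <= t -> ksum V k t ->
  exists2 l, k = l.+1 & ksum V l (t - u).
Proof.
move=> u_gt0 uV tge [s0 [sz s0V sumE]].
pose s := [seq x <- s0 | 0 < x].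
have s_gt0 : {in s, forall x, 0 < x} by move=> x; rewrite mem_filter => /andP[].
have sV : {subset s <= 0 :: V} by move=> x; rewrite mem_filter => /andP[_ /s0V].
have sle : size s <= k by rewrite -sz size_filter count_size.
have sE : sumn s = t by rewrite sumn_filter0.
suff [r [rle rV ur rE]] : exists r, [/\ size r <= k, {subset r <= 0 :: V}, u \in r & sumn r = t].
  exists k.-1; first by move: rle ur; case: r {rV rE} => //= a r; case: k {sz sle}.
  apply: (@ksum_mono (size r).-1); first by lia.
  exists (rem u r); split; first by rewrite size_rem.
    by move=> x /mem_rem /rV.
  by rewrite -rE (sumn_rem ur) addKn.
case: (boolP (u \in s)) => us; first by exists s.
have {}sV : {in s, forall x, x <= u.-1}.
  move=> x xs; have /mem_le := sV _ xs.
  rewrite leq_eqVlt => /orP[/eqP xu|]; last by lia.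
  by rewrite -xu xs in us.
case: (leqP u (size s)) => usz; last first.
  by have := sumn_le sV; rewrite sE; nia.
have [s1 [s2 [s3 [q [sC qE q_gt0]]]]] := block_sum u_gt0 usz s_gt0.
exists (s1 ++ nseq q u ++ s3).
have inV x : x \in s -> x \in 0 :: V by rewrite mem_filter => /andP[_ /s0V].
split.
- apply: leq_trans sle; rewrite sC !size_cat size_nseq leq_add2l leq_add2r.
  have : sumn s2 <= size s2 * u.
    apply: sumn_le => x xs; have := sV x; rewrite sC !mem_cat xs orbT => /(_ isT); lia.
  by rewrite qE leq_pmul2r.
- move=> x; rewrite !mem_cat mem_nseq => /or3P[h|/andP[_ /eqP->]|h].
  + by apply: inV; rewrite sC !mem_cat h.
  + by rewrite inE uV orbT.
  + by apply: inV; rewrite sC !mem_cat h !orbT.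
- by rewrite !mem_cat mem_nseq q_gt0 eqxx orbT.
- by rewrite -sE sC !sumn_cat sumn_nseq qE mulnC.
Qed.

(** The coins [u] are peeled off one at a time; before each removal the sum is still at least
    [u * u]. As this holds for every [k], the minimum shifts by exactly [q]. *)
Lemma ksum_reduce q k t : 0 < u -> u \in V -> u * u <= t ->
  ksum V k (t + q * u) <-> q <= k /\ ksum V (k - q) t.
Proof.
move=> u_gt0 uV tge; split.
  elim: q k => [|q IH] k; first by rewrite mul0n addn0 subn0.
  move=> h; have [|l -> kl] := ksum_remove_max u_gt0 uV _ h; first by lia.
  have [] := IH l; last by move=> ? ?; rewrite subSS ltnS.
  by move: kl; rewrite mulSn [u + _]addnC addnA addnK.
move=> [qk kt]; rewrite -(subnK qk); apply: ksumD => //.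
elim: q {qk kt} => [|q IH]; first exact/ksum0.
by rewrite mulSn -add1n; apply: ksumD IH; apply: ksum1; rewrite inE uV orbT.
Qed.

(** Positive coins number at most their sum. This bounds the search: if [t] coins do not suffice, no
    number does. *)
Lemma ksum_self t k : {in V, forall x, 0 < x} -> ksum V k t -> ksum V t t.
Proof.
move=> V_gt0 [s0 [sz s0V sumE]].
pose s := [seq x <- s0 | 0 < x].
have sE : sumn s = t by rewrite sumn_filter0.
have s_gt0 : {in s, forall x, 0 < x} by move=> x; rewrite mem_filter => /andP[].
apply: (@ksum_mono (size s)).
  rewrite -sE; elim: (s) s_gt0 => //= a r IH h.
  have := h a; rewrite inE eqxx => /(_ isT) a0.
  by rewrite -add1n leq_add // IH // => x xr; apply: h; rewrite inE xr orbT.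
by exists s; split=> // x; rewrite mem_filter => /andP[_ /s0V].
Qed.

End KSum.

(** * Lists of values against multiplicities of coins *)

Section Solution.
Variables (n : nat) (v : n.-tuple nat).

Lemma represents_ksum t m : represents v t m -> ksum v (num_coins m) t.
Proof.
move=> <-; exists (flatten [seq nseq (m i) (tnth v i) | i <- enum 'I_n]); split.
- rewrite size_flatten /shape -map_comp sumnE big_map enumT /num_coins.
  by apply: eq_bigr => i _; rewrite /= size_nseq.
- move=> x /flattenP [s /mapP [i _ ->]]; rewrite mem_nseq inE => /andP[_ /eqP->].
  by rewrite mem_tnth orbT.
- rewrite sumn_flatten -map_comp sumnE big_map enumT.
  by apply: eq_bigr => i _; rewrite /= sumn_nseq mulnC.
Qed.

(** Only an inequality is available, since the padding zeros of the list vanish from the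
    multiplicities. Minimality of [k] turns it into an equality afterwards. *)
Lemma ksum_represents t k : ksum v k t ->
  exists2 m, represents v t m & num_coins m <= k.
Proof.
move=> [s [<- sv <-]] {k t}; elim: s sv => [|x s IH] sv.
  exists (fun=> 0); rewrite /represents /num_coins; first by rewrite big1.
  by rewrite big1.
have [|m mr mc] := IH; first by move=> y ys; apply: sv; rewrite inE ys orbT.
have := sv x; rewrite inE eqxx => /(_ isT); rewrite inE => /orP[/eqP->|/tnthP [i xi]].
  by exists m => //=; apply: leqW.
exists (fun j => (j == i) + m j).
  rewrite /represents /= -[sumn s]mr (eq_bigr (fun j => (j == i) * tnth v j + m j * tnth v j)).
    rewrite big_split /= (bigD1 i) //= eqxx mul1n xi big1 ?addn0 //.
    by move=> j /negbTE->.
  by move=> j _; rewrite mulnDl.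
rewrite /num_coins big_split /= (bigD1 i) //= eqxx big1 ?addn0 ?add1n //.
by move=> j /negbTE->.
Qed.

Lemma ksum_solution t k : ksum v k t -> (forall l, l < k -> ~ ksum v l t) ->
  is_solution v t (Some k).
Proof.
move=> kt kmin; split; last first.
  move=> m /represents_ksum mt; rewrite leqNgt; apply/negP => lt.
  exact: (kmin _ lt mt).
have [m mr mk] := ksum_represents kt; exists m => //.
apply/eqP; rewrite eqn_leq mk leqNgt; apply/negP => lt.
exact: (kmin _ lt (represents_ksum mr)).
Qed.

Lemma ksum_no_solution t : (forall k, ~ ksum v k t) -> is_solution v t None.
Proof. by move=> h m /represents_ksum /h. Qed.

End Solution.

(** * The fast Fourier transform *)

(** Adding [2 ^ s] sets a clear bit of [i] without a carry. *)
Lemma partner_lt e s i : s < e -> i < 2 ^ e -> ~~ odd (i %/ 2 ^ s) ->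
  i + 2 ^ s < 2 ^ e.
Proof.
move=> se ie ev.
have s0 : 0 < 2 ^ s by rewrite expn_gt0.
have -> : 2 ^ e = (2 ^ (e - s.+1)).*2 * 2 ^ s.
  by rewrite -mul2n -expnS -expnD; congr (2 ^ _); lia.
rewrite -ltn_divLR // divnDr // divnn s0 addn1.
have : i %/ 2 ^ s < (2 ^ (e - s.+1)).*2.
  rewrite ltn_divLR // -mul2n -expnS -expnD; apply: leq_trans ie _.
  by rewrite leq_exp2l //; lia.
move: ev; rewrite -{2 3}[_ %/ _]odd_double_half => /negbTE ->; lia.
Qed.

Section FFT.
Local Open Scope ring_scope.
Variables (F : comPzRingType) (ii : F) (T Tc : nat -> F).
Hypotheses (ii2 : ii * ii = -1) (T0 : T 0%N = 1)
  (T_even : forall r, T r.*2 * T r.*2 = T r)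
  (T_odd : forall r, T r.*2.+1 = ii * T r.*2)
  (TcT : forall r, Tc r * T r = 1).

(** Blocks [2 q] and [2 q + 1] of length [h] receive the remainders of one block of length [2 h]
    modulo [X ^ h - T q] and [X ^ h + T q]. The laws of [T] say that its values are listed in
    bit-reversed order: [T (2 q)] is a square root of [T q], and [T (2 q + 1)] one of [- T q]. *)
Definition fstage (h : nat) (z : nat -> F) (i : nat) : F :=
  if odd (i %/ h)%N then z (i - h)%N - T (i %/ h)./2%N * z i
  else z i + T (i %/ h)./2%N * z (i + h)%N.

Definition istage (h : nat) (z : nat -> F) (i : nat) : F :=
  if odd (i %/ h)%N then Tc (i %/ h)./2%N * (z (i - h)%N - z i)
  else z i + z (i + h)%N.

Fixpoint fwd (e s : nat) (z : nat -> F) : nat -> F :=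
  if s is s'.+1 then fstage (2 ^ (e - s)) (fwd e s' z) else z.

Fixpoint bwd (s : nat) (z : nat -> F) : nat -> F :=
  if s is s'.+1 then istage (2 ^ s') (bwd s' z) else z.

(** Sum and difference give back twice each entry. The factor 2 is never divided out, so undoing [e]
    stages multiplies by [2 ^ e]. *)
Lemma fstageK h z i : (0 < h)%N -> istage h (fstage h z) i = z i *+ 2.
Proof.
move=> h0; rewrite /istage /fstage.
have dD : ((i + h) %/ h = (i %/ h).+1)%N.
  by rewrite divnDr // divnn h0 addn1.
case: ifP => [od|ev]; last first.
  rewrite dD /= ev /= addnK uphalf_half ev add0n; ring.
have hi : (h <= i)%N.
  by rewrite leqNgt; apply/negP => lt; rewrite divn_small in od.
have dB : ((i - h) %/ h = (i %/ h).-1)%N.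
  by rewrite -{2}(subnK hi) divnDr // divnn h0 addn1.
have od' : odd (i %/ h).-1%N = false by case: (i %/ h)%N od => //= m /negbTE.
have hf : ((i %/ h).-1./2 = (i %/ h)./2)%N.
  case: (i %/ h)%N od => //= m /negbTE om; by rewrite uphalf_half om.
rewrite dB od' od hf subnK //.
transitivity ((Tc (i %/ h)./2%N * T (i %/ h)./2%N) * z i *+ 2); first ring.
by rewrite TcT mul1r.
Qed.

Lemma istage_eq e s (y z : nat -> F) : (s < e)%N ->
  (forall i, (i < 2 ^ e)%N -> y i = z i) ->
  forall i, (i < 2 ^ e)%N -> istage (2 ^ s) y i = istage (2 ^ s) z i.
Proof.
move=> se yz i ie; rewrite /istage; case: ifP => od; rewrite !yz //.
  exact: leq_ltn_trans (leq_subr _ _) ie.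
by apply: partner_lt => //; rewrite od.
Qed.

Lemma bwd_eq e s (y z : nat -> F) : (s <= e)%N ->
  (forall i, (i < 2 ^ e)%N -> y i = z i) ->
  forall i, (i < 2 ^ e)%N -> bwd s y i = bwd s z i.
Proof.
elim: s => [|s IH] //= se yz i ie.
by apply: (istage_eq se) => // j je; apply: IH => //; apply: ltnW.
Qed.

Lemma bwd_fwd e s z i : (s <= e)%N -> bwd s (fwd e e z) i = fwd e (e - s) z i *+ 2 ^ s.
Proof.
elim: s i => [|s IH] i se /=; first by rewrite subn0 expn0.
have es : (e - s = (e - s.+1).+1)%N by lia.
rewrite (_ : istage _ _ _ = istage (2 ^ s) (fwd e (e - s) z) i *+ 2 ^ s); last first.
  by rewrite /istage !IH ?(ltnW se) //; case: ifP => _; rewrite ?mulrnDl // -mulrnBl mulrnAr.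
rewrite es /= (_ : (e - (e - s.+1).+1 = s)%N); last by lia.
by rewrite fstageK ?expn_gt0 // -mulrnA expnS.
Qed.

(** After [s] stages, block [r] is the remainder modulo [X ^ (2 ^ (e - s)) - node s r]; the parity
    of [r] selects one of the two square roots of the parent's node. *)
Definition node (s r : nat) : F :=
  if s is 0 then 1 else (-1) ^+ odd r * T r./2.

Lemma node_sqr s r : (r < 2 ^ s.+1)%N -> node s.+1 r * node s.+1 r = node s r./2.
Proof.
move=> rs; transitivity (T r./2 * T r./2).
  by rewrite /node; case: (odd r); rewrite ?expr0 ?expr1; ring.
case: s rs => [|s] rs.
  have -> : r./2 = 0%N by case: r rs => [|[|]].
  by rewrite T0 mulr1.
rewrite /= -{1 2}[r./2]odd_double_half; case: (odd r./2) => /=.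
  transitivity ((ii * ii) * (T r./2./2.*2 * T r./2./2.*2)).
    by rewrite !add1n T_odd; ring.
  by rewrite ii2 T_even.
by rewrite add0n T_even expr0 mul1r.
Qed.

Lemma node_root s r : (r < 2 ^ s)%N -> node s r ^+ (2 ^ s) = 1.
Proof.
elim: s r => [|s IH] r rs; first by rewrite expn0 expr1.
rewrite expnS exprM expr2 node_sqr // IH //.
by move: rs; rewrite expnS -[r in (r < _)%N]odd_double_half; lia.
Qed.

Lemma fwdE e s z r j : (s <= e)%N -> (r < 2 ^ s)%N -> (j < 2 ^ (e - s))%N ->
  fwd e s z (r * 2 ^ (e - s) + j)%N =
  \sum_(m < 2 ^ s) z (j + m * 2 ^ (e - s))%N * node s r ^+ m.
Proof.
elim: s r j => [|s IH] r j se rs js.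
  move: rs; rewrite expn0 ltnS leqn0 => /eqP->.
  by rewrite big_ord1 /= !mul0n add0n addn0 expr0 mulr1.
set h := (2 ^ (e - s.+1))%N in js *.
have h2 : (2 ^ (e - s) = h.*2)%N.
  by rewrite /h -mul2n -expnS; congr (2 ^ _)%N; lia.
have h0 : (0 < h)%N by rewrite expn_gt0.
have dE : ((r * h + j) %/ h = r)%N by rewrite divnMDl // divn_small // addn0.
have r2 : (r./2 < 2 ^ s)%N.
  by move: rs; rewrite expnS -[r in (r < _)%N]odd_double_half; lia.
have lo : fwd e s z (r./2 * h.*2 + j)%N =
    \sum_(m < 2 ^ s) z (j + m * h.*2)%N * node s r./2 ^+ m.
  by rewrite -h2 IH //; [lia|rewrite h2; lia].
have hi : fwd e s z (r./2 * h.*2 + j + h)%N =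
    \sum_(m < 2 ^ s) z (j + h + m * h.*2)%N * node s r./2 ^+ m.
  by rewrite -h2 -addnA IH //; [lia|rewrite h2; lia].
(* The sum for block [r] splits by the parity of [m]: even terms give the lower half of the parent
   block, odd terms the upper half, with [node s.+1 r] factored out. *)
transitivity (fwd e s z (r./2 * h.*2 + j)%N +
    node s.+1 r * fwd e s z (r./2 * h.*2 + j + h)%N).
  rewrite [LHS]/= -/h /fstage dE /=; move: (odd_double_half r).
  case: (odd r) => /= rE.
    have e1 : (r * h + j - h = r./2 * h.*2 + j)%N.
      by rewrite -{1}rE add1n mulSn -addnA addKn -doubleMl -doubleMr.
    have e2 : (r * h + j = r./2 * h.*2 + j + h)%N.
      by rewrite -{1}rE add1n mulSn -doubleMl -doubleMr; lia.
    by rewrite e1 -e2 expr1; ring.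
  have e1 : (r * h + j = r./2 * h.*2 + j)%N.
    by rewrite -{1}rE add0n -doubleMl -doubleMr.
  by rewrite e1 expr0 mul1r.
rewrite lo hi.
have -> : (2 ^ s.+1 = 2 ^ s + 2 ^ s)%N by rewrite expnS mul2n addnn.
move: (2 ^ s)%N (node s.+1 r) (node_sqr rs) => n x xE.
under [in LHS]eq_bigr do rewrite -xE.
under [X in _ + _ * X]eq_bigr do rewrite -xE.
rewrite mulr_sumr -big_split /=; elim: n => [|n IHn]; first by rewrite !big_ord0.
rewrite addSn addnS !big_ord_recr /= IHn -!addrA; congr (_ + _).
have -> : (j + (n + n) * h = j + n * h.*2)%N by rewrite addnn -doubleMl -doubleMr.
have -> : (j + (n + n).+1 * h = j + h + n * h.*2)%N.
  by rewrite mulSn addnn -doubleMl -doubleMr addnA.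
rewrite exprS exprD exprMn; ring.
Qed.

Lemma fwd_eval e z r : (r < 2 ^ e)%N ->
  fwd e e z r = \sum_(m < 2 ^ e) z m * node e r ^+ m.
Proof.
move=> re; have ee : (2 ^ (e - e) = 1)%N by rewrite subnn.
have := @fwdE e e z r 0; rewrite !ee muln1 addn0 => -> //.
by apply: eq_bigr => m _; rewrite muln1.
Qed.

Definition cconv (n : nat) (z : nat -> F) (k : nat) : F :=
  \sum_(i < n) \sum_(j < n | ((i + j) %% n)%N == k) z i * z j.

(** At a [2 ^ e]-th root of unity exponents may be reduced modulo [2 ^ e], so the pointwise square
    of the values is the transform of the cyclic convolution. The values stay in bit-reversed order
    throughout, since squaring does not care and [bwd] expects that order. *)
Lemma fft_conv e z k : (k < 2 ^ e)%N ->
  bwd e (fun i => fwd e e z i * fwd e e z i) k = cconv (2 ^ e) z k *+ 2 ^ e.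
Proof.
move=> ke; transitivity (bwd e (fwd e e (cconv (2 ^ e) z)) k); last first.
  by rewrite bwd_fwd // subnn.
apply: (@bwd_eq e) => // r re; rewrite !fwd_eval //.
have n0 : (0 < 2 ^ e)%N by rewrite expn_gt0.
move: (node e r) (node_root re) => x xn; move: (2 ^ e)%N n0 xn => n n0 xn.
rewrite big_distrlr /=.
transitivity (\sum_(m < n) \sum_(i < n) \sum_(j < n | ((i + j) %% n)%N == m)
   z i * x ^+ i * (z j * x ^+ j)).
  rewrite [RHS]exchange_big; apply: eq_bigr => i _ /=.
  rewrite (exchange_big_dep xpredT) //=; apply: eq_bigr => j _.
  by rewrite (big_pred1 (Ordinal (ltn_pmod (i + j) n0))) // => m; rewrite -val_eqE eq_sym.
apply: eq_bigr => m _; rewrite /cconv big_distrl /=; apply: eq_bigr => i _.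
rewrite big_distrl /=; apply: eq_bigr => j /eqP ijm.
have -> : x ^+ m = x ^+ i * x ^+ j.
  by rewrite -ijm -exprD {2}(divn_eq (i + j) n) exprD mulnC exprM xn expr1n mul1r.
ring.
Qed.

End FFT.

(** * Roots of unity *)

Section Roots.
Local Open Scope ring_scope.
Variable R : rcfType.

(* [root_re j + i root_im j] is a primitive [2 ^ (j + 2)]-th root of unity,
   obtained from [i] by the half-angle formulas. *)
Fixpoint root_re (j : nat) : R :=
  if j is j'.+1 then Num.sqrt ((1 + root_re j') / 2) else 0.

Fixpoint root_im (j : nat) : R :=
  if j is j'.+1 then root_im j' / (2 * root_re j) else 1.

Lemma root_reS j : root_re j.+1 = Num.sqrt ((1 + root_re j) / 2).
Proof. by []. Qed.

Lemma root_imS j : root_im j.+1 = root_im j / (2 * root_re j.+1).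
Proof. by []. Qed.

Lemma root_re_bound j : 0 <= root_re j <= 1.
Proof.
elim: j => [|j /andP[h0 h1]]; first by rewrite /= lexx ler01.
rewrite root_reS sqrtr_ge0 -[X in _ <= X]sqrtr1 ler_wsqrtr //; lra.
Qed.

Lemma root_reS_sqr j : root_re j.+1 ^+ 2 = (1 + root_re j) / 2.
Proof. by rewrite root_reS sqr_sqrtr //; have /andP[h0 h1] := root_re_bound j; lra. Qed.

(** This lower bound keeps the half-angle recursion well conditioned: it controls both the square
    root and the division by [2 * root_re j.+1]. *)
Lemma root_reS_ge j : 1 / 2 <= root_re j.+1.
Proof.
have /andP[c0 _] := root_re_bound j.
rewrite -(@ler_pXn2r _ 2) ?nnegrE ?sqrtr_ge0 // ?root_reS_sqr; lra.
Qed.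

Lemma root_norm j : root_re j ^+ 2 + root_im j ^+ 2 = 1.
Proof.
elim: j => [|j IH]; first by rewrite /=; ring.
rewrite root_imS; have := root_reS_sqr j; have := root_reS_ge j.
have /andP[] := root_re_bound j; move: (root_re j.+1) => y x0 x1 hy yE.
have y0 : y != 0 by apply: lt0r_neq0; lra.
have imE : root_im j ^+ 2 = (1 - root_re j) * (1 + root_re j) by rewrite -[1 in RHS]IH; nra.
rewrite expr_div_n exprMn yE imE; field.
by apply: lt0r_neq0; lra.
Qed.

Lemma root_im_bound j : 0 <= root_im j <= 1.
Proof.
have ge0 : 0 <= root_im j.
  elim: j => [|j IH]; first exact: ler01.
  by rewrite root_imS divr_ge0 //; have ge := root_reS_ge j; lra.
have := root_norm j; have /andP[] := root_re_bound j.
by rewrite ge0 /=; move: (root_re j) (root_im j) ge0 => x y *; nra.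
Qed.

Definition root2 (j : nat) : R[i] := (root_re j +i* root_im j)%C.

Lemma root2_sqr j : root2 j.+1 * root2 j.+1 = root2 j.
Proof.
have n := root_norm j.+1; have sq := root_reS_sqr j; have ge := root_reS_ge j.
have e : root_im j = 2 * root_re j.+1 * root_im j.+1.
  rewrite root_imS; field; apply: lt0r_neq0; lra.
apply/eqP; rewrite eq_complex /root2 [root_im j]e; move: n sq.
rewrite -/root_re.
move: (root_re j.+1) (root_im j.+1) (root_re j) => x y x' n sq.
by apply/andP; split; apply/eqP => /=; nra.
Qed.

(** Bit [j] of [r] contributes a root of order [2 ^ (j + 2)]. Doubling [r] replaces each factor by
    its square root, and the lowest bit contributes [root2 0], which is the imaginary unit. The
    bound [j < r] exceeds the position of every set bit. *)
Definition twiddle (r : nat) : R[i] :=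
  \prod_(j < r) (if odd (r %/ 2 ^ j) then root2 j else 1).

Lemma twiddleE n r : (r < 2 ^ n)%N ->
  twiddle r = \prod_(j < n) (if odd (r %/ 2 ^ j) then root2 j else 1).
Proof.
have ext m k : (r < 2 ^ m)%N -> (m <= k)%N ->
    \prod_(j < m) (if odd (r %/ 2 ^ j) then root2 j else 1) =
    \prod_(j < k) (if odd (r %/ 2 ^ j) then root2 j else 1).
  move=> rm mk; rewrite -(subnKC mk); elim: (k - m)%N => [|d IH]; first by rewrite addn0.
  rewrite addnS big_ord_recr /= -IH divn_small ?mulr1 //.
  by apply: leq_trans rm _; rewrite leq_exp2l // leq_addr.
move=> rn; transitivity (\prod_(j < maxn r n) (if odd (r %/ 2 ^ j) then root2 j else 1)).
  by apply: ext; rewrite ?leq_maxl // ltn_expl.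
by symmetry; apply: ext; rewrite ?leq_maxr.
Qed.

Lemma twiddle0 : twiddle 0 = 1. Proof. by rewrite /twiddle big_ord0. Qed.

Lemma twiddle_double r : twiddle r.*2 =
  \prod_(j < r) (if odd (r %/ 2 ^ j) then root2 j.+1 else 1).
Proof.
rewrite (@twiddleE r.+1).
  rewrite big_ord_recl /= divn1 odd_double mul1r; apply: eq_bigr => j _.
  by rewrite expnS -muln2 [(r * 2)%N]mulnC divnMl.
by rewrite expnS mul2n ltn_double ltn_expl.
Qed.

Lemma twiddle_even r : twiddle r.*2 * twiddle r.*2 = twiddle r.
Proof.
rewrite twiddle_double -big_split /=; apply: eq_bigr => j _.
by case: ifP => _; rewrite ?root2_sqr ?mulr1.
Qed.

Lemma twiddle_odd r : twiddle r.*2.+1 = 'i%C * twiddle r.*2.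
Proof.
have h : (r < 2 ^ r)%N by rewrite ltn_expl.
rewrite (@twiddleE r.+1); last by rewrite expnS mul2n; lia.
rewrite big_ord_recl /= divn1 /= odd_double /= twiddle_double; congr (_ * _).
apply: eq_bigr => j _; rewrite expnS divnMA.
by rewrite (_ : r.*2.+1 %/ 2 = r)%N //; lia.
Qed.

(** This is the recurrence by which the table is filled, its length doubling at each round. *)
Lemma twiddle_top j r : (r < 2 ^ j)%N ->
  twiddle (2 ^ j + r)%N = twiddle r * root2 j.
Proof.
move=> rj; rewrite (@twiddleE j.+1); last by rewrite expnS; lia.
rewrite (@twiddleE j r) // big_ord_recr /=; congr (_ * _).
  apply: eq_bigr => i _.
  have -> : (2 ^ j = 2 ^ (j - i.+1) * 2 * 2 ^ i)%N.
    by rewrite -expnSr -expnD; congr (2 ^ _)%N; have := ltn_ord i; lia.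
  by rewrite divnMDl ?expn_gt0 // oddD oddM andbF.
by rewrite divnDl // divnn expn_gt0 divn_small.
Qed.

(** Inverse twiddles are conjugates, so one table serves both transforms. *)
Lemma twiddle_conj r : ((twiddle r)^*)%C * twiddle r = 1.
Proof.
rewrite /twiddle; elim/big_rec: _ => [|j x _].
  by apply/eqP; rewrite eq_complex /=; apply/andP; split; apply/eqP; ring.
case: ifP => _; last by rewrite mul1r.
case: x => a b; rewrite /root2; have := root_norm j.
move: (root_re j) (root_im j) => c d n [h1 h2].
apply/eqP; rewrite eq_complex /=; apply/andP; split; apply/eqP; last ring.
by transitivity ((c ^+ 2 + d ^+ 2) * (a * a - (- b * b))); [ring|rewrite n h1 mul1r].
Qed.

Lemma twiddle_bound r : `|complex.Re (twiddle r)| <= 1 /\ `|complex.Im (twiddle r)| <= 1.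
Proof.
have := twiddle_conj r; case: (twiddle r) => a b [h _] /=.
by rewrite !ler_norml; split; apply/andP; split; nra.
Qed.

End Roots.

(** * Fixed-point arithmetic on words *)

Section Words.
Local Open Scope ring_scope.
Variable w : nat.
Local Notation W := (2 ^ w)%N.

(* Two's complement. *)
Definition enc (x : int) : nat := `|(x %% W%:Z)%Z|%N.

Lemma W_gt0 : (0 < W)%N. Proof. by rewrite expn_gt0. Qed.

Lemma encE x : (enc x)%:Z = (x %% W%:Z)%Z.
Proof. by rewrite /enc abszE ger0_norm // modz_ge0 // -lt0n W_gt0. Qed.

Lemma enc_lt x : (enc x < W)%N.
Proof. by rewrite -ltz_nat encE ltz_pmod // ltz_nat W_gt0. Qed.

Lemma enc_nat (n : nat) : (n < W)%N -> enc n = n.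
Proof. by move=> h; apply/eqP; rewrite -eqz_nat encE modz_nat modn_small. Qed.

Lemma enc_mod (n : nat) (x : int) : (n%:Z = x %[mod W])%Z -> (n %% W)%N = enc x.
Proof. by move=> h; apply/eqP; rewrite -eqz_nat encE -modz_nat h. Qed.

Lemma encD x y : ((enc x + enc y) %% W)%N = enc (x + y).
Proof. by apply: enc_mod; rewrite PoszD !encE modzDm. Qed.

Lemma encM x y : ((enc x * enc y) %% W)%N = enc (x * y).
Proof. by apply: enc_mod; rewrite PoszM !encE modzMm. Qed.

Lemma encB x y : ((enc x + (W - enc y)) %% W)%N = enc (x - y).
Proof.
apply: enc_mod; rewrite PoszD -subzn; last exact/ltnW/enc_lt.
by rewrite !encE addrCA modzDl modzDml -modzDmr modzNm modzDmr.
Qed.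

Definition fixmul (D H x y : nat) : nat :=
  (((((x * y) %% W + H) %% W) %/ D) + (W - H %/ D)) %% W.

(** Adding the bias [D * HD], a multiple of [D] at least as large as the product, turns a two's
    complement number into an ordinary nonnegative one. The unsigned quotient is then the floor
    quotient plus [HD]. *)
Lemma fixmul_enc D HD (x y : int) : (0 < D)%N -> `|x * y| <= (D * HD)%N%:Z ->
  (2 * (D * HD) < W)%N ->
  fixmul D (D * HD) (enc x) (enc y) = enc ((x * y) %/ D)%Z.
Proof.
move=> D0 xyH HW; rewrite /fixmul encM mulKn //.
have HW' : (D * HD < W)%N by lia.
rewrite -{1}(enc_nat HW') encD.
have HDW : (HD < W)%N by apply: leq_ltn_trans HW'; exact: leq_pmull.
have [n nE] : exists n : nat, x * y + (D * HD)%N = n%:Z.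
  exists `|(x * y + (D * HD)%N%:Z)%R|%N; rewrite abszE ger0_norm //.
  by move: xyH; rewrite ler_norml => /andP[h _]; rewrite -lerBlDr sub0r.
have nW : (n < W)%N.
  by move: xyH; rewrite ler_norml => /andP[_ h]; rewrite -ltz_nat -nE; lia.
rewrite nE enc_nat //.
rewrite -{1}(enc_nat (_ : (n %/ D < W)%N)); last exact: leq_ltn_trans (leq_div _ _) nW.
rewrite -{1}(enc_nat HDW) encB; congr enc.
have -> : x * y = n%:Z - (HD * D)%N%:Z by rewrite -nE mulnC addrK.
by rewrite PoszM -mulNr divzDr ?dvdz_mull // mulzK ?divz_nat //; lia.
Qed.

End Words.

(** * Error bounds for fixed-point operations *)

Section Approx.
Local Open Scope ring_scope.
Variables (R : realFieldType) (w D HD : nat).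
Hypotheses (D_gt0 : (0 < D)%N) (HW : (2 * (D * HD) < 2 ^ w)%N).

(* The word [x] is the fixed-point representation, with scale [D], of a number
   close to [z]. *)
Definition appr (E M : R) (x : nat) (z : R) : Prop :=
  exists X : int, [/\ x = enc w X, `|X%:~R - D%:R * z| <= E & `|z| <= M].

Lemma appr_le E M E' M' x z : E <= E' -> M <= M' -> appr E M x z -> appr E' M' x z.
Proof.
move=> EE MM [X [xE Xz zM]]; exists X; split=> //.
  exact: le_trans EE.
exact: le_trans MM.
Qed.

Lemma appr_norm E M M' x z : appr E M x z -> `|z| <= M' -> appr E M' x z.
Proof. by move=> [X [xE Xz _]] zM; exists X. Qed.

Lemma appr_nat (n : nat) z : (n < 2 ^ w)%N -> D%:R * z = n%:R -> appr 0 `|z| n z.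
Proof.
move=> nw zE; exists n%:Z; split=> //; first by rewrite enc_nat.
by rewrite zE subrr normr0.
Qed.

Lemma apprD E M E' M' x y a b : appr E M x a -> appr E' M' y b ->
  appr (E + E') (M + M') ((x + y) %% 2 ^ w)%N (a + b).
Proof.
move=> [X [-> Xa aM]] [Y [-> Yb bM]]; exists (X + Y); split.
- by rewrite encD.
- rewrite rmorphD /= mulrDr; apply: le_trans (lerD Xa Yb).
  by apply: le_trans (ler_normD _ _); rewrite opprD addrACA.
- exact: le_trans (ler_normD _ _) (lerD aM bM).
Qed.

Lemma apprB E M E' M' x y a b : appr E M x a -> appr E' M' y b ->
  appr (E + E') (M + M') ((x + (2 ^ w - y)) %% 2 ^ w)%N (a - b).
Proof.
move=> [X [-> Xa aM]] [Y [-> Yb bM]]; exists (X - Y); split.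
- by rewrite encB.
- rewrite rmorphB /= mulrBr; apply: le_trans (lerD Xa Yb).
  apply: le_trans (ler_normB _ _); rewrite le_eqVlt; apply/orP; left.
  by apply/eqP; congr Num.norm; ring.
- exact: le_trans (ler_normB _ _) (lerD aM bM).
Qed.

Lemma divz_bound (X : int) : D%:R * ((X %/ D)%Z)%:~R <= X%:~R :> R /\
  X%:~R <= D%:R * ((X %/ D)%Z)%:~R + D%:R :> R.
Proof.
have := divz_eq X D; have := modz_ge0 X (_ : D%:Z != 0); have := ltz_pmod X (_ : 0 < D%:Z).
move: (X %/ D)%Z (X %% D)%Z => q r; rewrite !ltz_nat D_gt0 -lt0n D_gt0.
move=> /(_ isT) r1 /(_ isT) r0 ->; rewrite rmorphD rmorphM /= mulrC !pmulrn.
have r0' : 0 <= r%:~R :> R by rewrite ler0z.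
have r1' : r%:~R <= D%:R :> R by rewrite pmulrn ler_int ltW.
by split; lra.
Qed.

(** The floor costs 1, the error of [y] is weighted by [X / D], and that of [x] by [b]. As
    [E <= D * M], the first weight is at most [2 * M], which absorbs the term [E * E']. The last
    hypothesis keeps the product within the bias. *)
Lemma apprM E M E' M' x y a b :
  appr E M x a -> appr E' M' y b -> E <= D%:R * M ->
  (D%:R * M + E) * (D%:R * M' + E') <= (D * HD)%:R ->
  appr (1 + 2 * M * E' + M' * E) (M * M') (fixmul w D (D * HD) x y) (a * b).
Proof.
move=> [X [-> Xa aM]] [Y [-> Yb bM]] EM big.
have D0 : 0 < D%:R :> R by rewrite ltr0n.
have XM : `|X%:~R| <= D%:R * M + E :> R.
  rewrite -[X%:~R](subrK (D%:R * a)) addrC; apply: le_trans (ler_normD _ _) (lerD _ Xa).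
  by rewrite normrM (ger0_norm (ltW D0)) ler_pM2l.
have YM : `|Y%:~R| <= D%:R * M' + E' :> R.
  rewrite -[Y%:~R](subrK (D%:R * b)) addrC; apply: le_trans (ler_normD _ _) (lerD _ Yb).
  by rewrite normrM (ger0_norm (ltW D0)) ler_pM2l.
have XYM : `|X * Y| <= (D * HD)%N%:Z.
  rewrite -(ler_int R) intr_norm rmorphM /= normrM; apply: le_trans big.
  exact: ler_pM.
exists ((X * Y) %/ D)%Z; split.
- by rewrite fixmul_enc.
- have [lo hi] := divz_bound (X * Y).
  have key : `|(X * Y)%:~R - D%:R * D%:R * (a * b)| <= D%:R * (2 * M * E' + M' * E).
    have -> : (X * Y)%:~R - D%:R * D%:R * (a * b) =
      X%:~R * (Y%:~R - D%:R * b) + D%:R * b * (X%:~R - D%:R * a) by rewrite rmorphM /=; ring.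
    apply: le_trans (ler_normD _ _) _; rewrite !normrM (ger0_norm (ltW D0)).
    have h1 : `|X%:~R| * `|Y%:~R - D%:R * b| <= (D%:R * M + E) * E' by apply: ler_pM.
    have h2 : `|b| * `|X%:~R - D%:R * a| <= M' * E by apply: ler_pM.
    have h3 : D%:R * (`|b| * `|X%:~R - D%:R * a|) <= D%:R * (M' * E) by rewrite ler_pM2l.
    have E'0 : 0 <= E' by apply: le_trans Yb.
    have h4 : (D%:R * M + E) * E' <= (D%:R * M + D%:R * M) * E'.
      by apply: ler_wpM2r => //; lra.
    by rewrite mulrA in h3; lra.
  rewrite -(ler_pM2l D0) -[X in X * `|_|](ger0_norm (ltW D0)) -normrM.
  move: key lo hi; rewrite !ler_norml => /andP[k1 k2] lo hi; apply/andP.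
  by split; lra.
- by rewrite normrM; apply: ler_pM.
Qed.

End Approx.

(** With scale [D = 2 d], the half-angle formula for the cosine becomes the square root of
    [D * (D + C) / 2]. The scale is even, so this half is exact, and it lies between [2 d ^ 2] and
    [4 d ^ 2]. *)
Lemma isqrt_bound d C C' : (0 < d)%N -> (C <= d.*2)%N ->
  (C' * C' <= d.*2 * (d.*2 + C) %/ 2 < C'.+1 * C'.+1)%N ->
  (d <= C' <= d.*2)%N.
Proof.
move=> d0 Cd.
have -> : (d.*2 * (d.*2 + C) %/ 2 = d * (d.*2 + C))%N.
  by rewrite -doubleMl -muln2 mulnK.
by nia.
Qed.

(** * Errors of the half-angle recursion *)

Section RootStep.
Local Open Scope ring_scope.
Variable R : rcfType.

(** The squares differ by at most [d * E] up to rounding, and the two roots add up to at least [d]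
    because [root_re j.+1] is at least 1/2. Dividing, [E] is not amplified. *)
Lemma root_step_re j d C C' (E : R) : (0 < d)%N -> (C <= d.*2)%N ->
  (C' * C' <= d.*2 * (d.*2 + C) %/ 2 < C'.+1 * C'.+1)%N ->
  `|C%:R - d.*2%:R * root_re R j| <= E ->
  `|C'%:R - d.*2%:R * root_re R j.+1| <= E + 3.
Proof.
move=> d0 Cd; have -> : (d.*2 * (d.*2 + C) %/ 2 = d * (d.*2 + C))%N.
  by rewrite -doubleMl -muln2 mulnK.
move=> /andP[lo hi].
have d1 : 1 <= d%:R :> R by rewrite ler1n.
have C'0 : 0 <= C'%:R :> R by rewrite ler0n.
have lo' : C'%:R * C'%:R <= d%:R * (2 * d%:R + C%:R) :> R.
  have : (C' * C' <= d * (2 * d + C))%N by lia.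
  by rewrite -(ler_nat R) !(natrM, natrD).
have hi' : d%:R * (2 * d%:R + C%:R) + 1 <= (C'%:R + 1) * (C'%:R + 1) :> R.
  have : (d * (2 * d + C) + 1 <= (C' + 1) * (C' + 1))%N by lia.
  by rewrite -(ler_nat R) !(natrM, natrD).
have sq := root_reS_sqr R j; have ge := root_reS_ge R j.
have dE : d.*2%:R = 2 * d%:R :> R by rewrite -mul2n natrM.
rewrite !dE => h; have E0 : 0 <= E by apply: le_trans h.
move: h; rewrite !ler_norml.
move: (root_re R j.+1) (root_re R j) (d%:R) (C%:R) (C'%:R) sq ge d1 C'0 lo' hi' => y c D x z.
move=> sq ge d1 z0 lo' hi' /andP[h1 h2]; apply/andP; split; rewrite leNgt; apply/negP => lt.
  have p1 : 0 < (2 * D * y - z - 1 - (E + 2)) * (2 * D * y + z + 1) by apply: mulr_gt0; nra.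
  have p2 : 0 <= (E + 2) * (2 * D * y + z + 1 - D) by apply: mulr_ge0; nra.
  by nra.
have p1 : 0 < (z - 2 * D * y - E) * (z + 2 * D * y) by apply: mulr_gt0; nra.
have p2 : 0 <= E * (z + 2 * D * y - D) by apply: mulr_ge0; nra.
by nra.
Qed.

(** The divisor [2 * C'] is at least [D], so the numerator contributes at most [E]. The divisor's
    error [2 * (E + 3)] is weighted by [root_im j.+1 <= 1], and the floor adds 1. *)
Lemma root_step_im j D S C' S' (E : R) : (0 < D)%N -> (D <= 2 * C')%N ->
  S' = (S * D %/ (2 * C'))%N ->
  `|C'%:R - D%:R * root_re R j.+1| <= E + 3 ->
  `|S%:R - D%:R * root_im R j| <= E ->
  `|S'%:R - D%:R * root_im R j.+1| <= 3 * E + 7.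
Proof.
move=> D0 DC SE hC hS.
have C0 : (0 < 2 * C')%N by lia.
have lo : S'%:R * (2 * C'%:R) <= S%:R * D%:R :> R.
  by rewrite -!natrM ler_nat SE leq_trunc_div.
have hi : S%:R * D%:R <= (S'%:R + 1) * (2 * C'%:R) :> R.
  by rewrite natr1 -!natrM ler_nat SE ltnW // ltn_ceil.
have D1 : 0 < D%:R :> R by rewrite ltr0n.
have DC' : D%:R <= 2 * C'%:R :> R by rewrite -natrM ler_nat.
have E0 : 0 <= E by apply: le_trans hS.
have ge := root_reS_ge R j; have /andP[i0 i1] := root_im_bound R j.+1.
have imE : root_im R j = 2 * root_re R j.+1 * root_im R j.+1.
  by rewrite [in RHS]root_imS; field; apply: lt0r_neq0; lra.
move: hC hS; rewrite imE !ler_norml.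
move: (root_re R j.+1) (root_im R j.+1) (D%:R) (S%:R) (C'%:R) (S'%:R) i0 i1 ge D1 DC' lo hi.
move=> y s' d s c z i0 i1 ge d0 dc lo hi /andP[a1 a2] /andP[b1 b2].
have k1 : s' * (d * y - c) <= E + 3.
  by apply: le_trans (_ : s' * (E + 3) <= _); [apply: ler_wpM2l; lra|apply: ler_piMl; lra].
have k2 : s' * (c - d * y) <= E + 3.
  by apply: le_trans (_ : s' * (E + 3) <= _); [apply: ler_wpM2l; lra|apply: ler_piMl; lra].
have k3 : d * (s - d * (2 * y * s') + 2 * (s' * (d * y - c))) <= d * (3 * E + 6).
  by apply: ler_wpM2l; lra.
have k4 : d * - (s - d * (2 * y * s') + 2 * (s' * (d * y - c))) <= d * (3 * E + 6).
  by apply: ler_wpM2l; lra.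
have k5 : d * (3 * E + 6) <= 2 * c * (3 * E + 6) by apply: ler_wpM2r; lra.
have c0 : 0 < 2 * c by lra.
apply/andP; split; rewrite -(ler_pM2l c0); nra.
Qed.

End RootStep.

(** * Program logic *)

Local Notation memory := Defs.mem.
Local Notation "a ;; b" := (Seq a b) (at level 70, right associativity).
Local Notation "r <- x" := (Assign r x) (at level 65).
Local Notation "a [+] b" := (Bin OpAdd a b) (at level 50).
Local Notation "a [-] b" := (Bin OpSub a b) (at level 50).
Local Notation "a [*] b" := (Bin OpMul a b) (at level 40).
Local Notation "a [/] b" := (Bin OpDiv a b) (at level 40).
Local Notation "a [%] b" := (Bin OpMod a b) (at level 40).
Local Notation "a [<] b" := (Bin OpLt a b) (at level 60).
Local Notation Re := complex.Re.
Local Notation Im := complex.Im.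

Fixpoint assigned (c : cmd) : seq nat :=
  match c with
  | Assign r _ => [:: r]
  | Seq a b => assigned a ++ assigned b
  | If _ a b => assigned a ++ assigned b
  | While _ a => assigned a
  | _ => [::]
  end.

Lemma exec_frame w c s k s' : exec w c s k s' ->
  forall r, r \notin assigned c -> regs s' r = regs s r.
Proof.
elim=> //= {c s k s'}.
- by move=> s q e r; rewrite inE /update => /negbTE->.
- by move=> c1 c2 s s1 s2 k1 k2 _ IH1 _ IH2 r; rewrite mem_cat negb_or
    => /andP[h1 h2]; rewrite IH2 // IH1.
- by move=> e c1 c2 s s' k _ _ IH r; rewrite mem_cat negb_or => /andP[h1 h2]; apply: IH.
- by move=> e c1 c2 s s' k _ _ IH r; rewrite mem_cat negb_or => /andP[h1 h2]; apply: IH.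
- by move=> e c s s1 s2 k1 k2 _ _ IH1 _ IH2 r h; rewrite IH2 // IH1.
Qed.

Definition setr (s : state) (r x : nat) : state := State (update (regs s) r x) (memory s).

Definition runs (w : nat) (c : cmd) (s : state) (K : nat) (Q : state -> Prop) : Prop :=
  exists k s', [/\ exec w c s k s', k <= K & Q s'].

Section Logic.
Variable w : nat.

(** The consequence rule also supplies the registers that the command does not assign, so the
    specifications need not list them. *)
Lemma runs_weaken c s K K' (Q Q' : state -> Prop) : runs w c s K Q -> K <= K' ->
  (forall s', (forall r, r \notin assigned c -> regs s' r = regs s r) -> Q s' -> Q' s') ->
  runs w c s K' Q'.
Proof.
move=> [k [s' [ex kK q]]] KK' QQ'; exists k, s'; split=> //.
  exact: leq_trans KK'.
by apply: QQ' => //; apply: exec_frame ex.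
Qed.

Lemma runs_seq c1 c2 s K1 K2 Q :
  runs w c1 s K1 (fun s' => runs w c2 s' K2 Q) -> runs w (Seq c1 c2) s (K1 + K2) Q.
Proof.
move=> [k1 [s1 [ex1 le1 [k2 [s2 [ex2 le2 q]]]]]].
exists (k1 + k2), s2; split=> //; last exact: leq_add.
exact: ExecSeq ex1 ex2.
Qed.

Lemma runs_while n K cK (I : nat -> state -> Prop) e c s :
  cost e <= cK -> I 0 s ->
  (forall j s', j < n -> I j s' -> eval w s' e != 0 /\ runs w c s' K (I j.+1)) ->
  (forall s', I n s' -> eval w s' e = 0) ->
  runs w (While e c) s (n * (K + cK.+1) + cK.+1) (I n).
Proof.
move=> ce I0 Istep Iend; rewrite -[n in n * _]subn0.
move: 0 (leq0n n) I0 => j jn Ij.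
elim: {j jn}(n - j) {-2}j (erefl (n - j)) jn s Ij => [|m IH] j nj jn s Ij.
  have jE : j = n by lia.
  exists (cost e).+1, s; split; last by rewrite -jE.
    by apply: ExecWhileFalse; apply: Iend; rewrite -jE.
  by lia.
have jn' : j < n by lia.
have [e0 [k1 [s1 [ex1 le1 I1]]]] := Istep _ _ jn' Ij.
have [|k2 [s2 [ex2 le2 I2]]] := IH j.+1 _ jn' _ I1; first by lia.
exists (cost e + k1 + k2).+1, s2; split=> //.
  exact: ExecWhileTrue ex1 ex2.
by rewrite (_ : n - j = (n - j.+1).+1) ?mulSn; lia.
Qed.

Definition For (r : nat) (e : expr) (c : cmd) : cmd :=
  Seq (Assign r (Const 0))
    (While (Bin OpLt (Reg r) e) (Seq c (Assign r (Bin OpAdd (Reg r) (Const 1))))).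

(** The bound [e] is evaluated again at every test, so the invariant has to fix its value. Each
    round pays 4 for the increment and [(cost e).+3] for the test; the body has to leave the counter
    unchanged. *)
Lemma runs_for n K (I : nat -> state -> Prop) r e c s : 0 < w -> n < 2 ^ w ->
  I 0 (setr s r 0) ->
  (forall j s', j <= n -> I j s' -> regs s' r = j /\ eval w s' e = n) ->
  (forall j s', j < n -> I j s' ->
     runs w c s' K (fun s'' => regs s'' r = j /\ I j.+1 (setr s'' r j.+1))) ->
  runs w (For r e c) s (n * (K + 4 + (cost e).+3) + (cost e + 5)) (I n).
Proof.
move=> w0 nw I0 Ie Istep.
have W1 : 1 < 2 ^ w by rewrite -{1}(expn0 2) ltn_exp2l.
have le2 : 2 + (n * (K + 4 + (cost e).+3) + (cost e).+3) <=
  n * (K + 4 + (cost e).+3) + (cost e + 5) by lia.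
apply: (@runs_weaken _ _ (2 + (n * (K + 4 + (cost e).+3) + (cost e).+3)) _ (I n)) => //.
apply: runs_seq; exists 2, (setr s r 0); split=> //.
  by have := ExecAssign w s r (Const 0); rewrite /= mod0n.
apply: (@runs_while n (K + 4) (cost e).+2 I) => //=.
- move=> j s' jn Ij; have [rj en] := Ie _ _ (ltnW jn) Ij.
  rewrite rj en jn modn_small //; split=> //.
  apply: runs_seq; have [k1 [s1 [ex1 le1 [r1 I1]]]] := Istep _ _ jn Ij.
  exists k1, s1; split=> //; exists 4, (setr s1 r j.+1); split=> //.
  have := ExecAssign w s1 r (Bin OpAdd (Reg r) (Const 1)).
  have -> : eval w s1 (Bin OpAdd (Reg r) (Const 1)) = j.+1; last by [].
  by rewrite /= r1 (modn_small W1) addn1 modn_small //; apply: leq_ltn_trans nw.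
- move=> s' In; have [rj en] := Ie _ _ (leqnn _) In.
  by rewrite rj en ltnn mod0n.
Qed.

Fixpoint loopfree (c : cmd) : bool :=
  match c with
  | Seq a b | If _ a b => loopfree a && loopfree b
  | While _ _ => false
  | _ => true
  end.

(** The two branches of a test are added, which bounds the dearer one. Loops are treated separately
    by [runs_while]. *)
Fixpoint static_cost (c : cmd) : nat :=
  match c with
  | Skip => 1
  | Assign _ e => (cost e).+1
  | Write a e => (cost a + cost e).+1
  | Seq a b => static_cost a + static_cost b
  | If e a b => (cost e + (static_cost a + static_cost b)).+1
  | While _ _ => 0
  end.

Fixpoint wp (c : cmd) (Q : state -> Prop) (s : state) : Prop :=
  match c with
  | Skip => Q s
  | Assign r e => Q (setr s r (eval w s e))
  | Write a e => Q (State (regs s) (update (memory s) (eval w s a) (eval w s e)))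
  | Seq a b => wp a (wp b Q) s
  | If e a b => if eval w s e != 0 then wp a Q s else wp b Q s
  | While _ _ => False
  end.

Lemma wp_runs c Q s : wp c Q s -> runs w c s (static_cost c) Q.
Proof.
elim: c Q s => //=.
- by move=> Q s q; exists 1, s; split=> //; apply: ExecSkip.
- by move=> r e Q s q; eexists _, _; split; [apply: ExecAssign| |exact: q].
- by move=> a e Q s q; eexists _, _; split; [apply: ExecWrite| |exact: q].
- move=> a IHa b IHb Q s /IHa h; apply: runs_seq.
  by apply: (runs_weaken h) => // s' _ /IHb.
- move=> e a IHa b IHb Q s; case: ifP => e0.
    move=> /IHa [k [s' [ex le q]]]; exists (cost e + k).+1, s'; split=> //; last lia.
    exact: ExecIfTrue.
  move=> /IHb [k [s' [ex le q]]]; exists (cost e + k).+1, s'; split=> //; last lia.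
  by apply: ExecIfFalse => //; apply/eqP/negbFE.
Qed.

Lemma wp_assign v r e c Q s : eval w s e = v -> wp c Q (setr s r v) ->
  wp (Seq (Assign r e) c) Q s.
Proof. by move=> /= ->. Qed.

Lemma wp_if (b : bool) x c1 c2 Q s : eval w s x = b ->
  (b -> wp c1 Q s) -> (~~ b -> wp c2 Q s) -> wp (If x c1 c2) Q s.
Proof. by move=> /= ->; case: b => /= h1 h2; [exact: h1|exact: h2]. Qed.

Lemma wp_set v r x (Q : state -> Prop) s : eval w s x = v -> Q (setr s r v) ->
  wp (Assign r x) Q s.
Proof. by move=> /= ->. Qed.

End Logic.

(** * Arrays in the memory *)

Section Arrays.
Variables (w N : nat).

(* The arrays are interleaved, and start above the input. *)
Definition cell (a i : nat) : nat := 16 * (N + i) + a.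

Definition arr (s : state) (a i : nat) : nat := memory s (cell a i).

Definition seta (s : state) (a i x : nat) : state :=
  State (regs s) (update (memory s) (cell a i) x).

Lemma arr_seta s a i x b j : a < 16 -> b < 16 ->
  arr (seta s a i x) b j = if (b == a) && (j == i) then x else arr s b j.
Proof.
move=> a16 b16; rewrite /arr /= /update; congr (if _ then _ else _).
apply/eqP/andP => [|[/eqP-> /eqP->]] //; rewrite /cell => h.
by split; apply/eqP; lia.
Qed.

Definition addrE (a i : expr) : expr :=
  Bin OpAdd (Bin OpMul (Const 16) (Bin OpAdd (Reg 5) i)) a.

Definition rdA (a i : expr) : expr := Read (addrE a i).

Definition wrA (a : nat) (i x : expr) : cmd := Write (addrE (Const a) i) x.

Lemma eval_addr s a i k b : 16 * (N + k) + 16 < 2 ^ w -> b < 16 -> regs s 5 = N ->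
  eval w s i = k -> eval w s a = b -> eval w s (addrE a i) = cell b k.
Proof.
by move=> h b16 sN /= -> ->; rewrite sN !modn_small //; lia.
Qed.

Lemma eval_rdA s a i k b : 16 * (N + k) + 16 < 2 ^ w -> b < 16 -> regs s 5 = N ->
  eval w s i = k -> eval w s a = b -> eval w s (rdA a i) = arr s b k.
Proof. by move=> *; congr (memory s _); apply: eval_addr. Qed.

Lemma eval_rdAc s a i k : 16 * (N + k) + 16 < 2 ^ w -> a < 16 -> regs s 5 = N ->
  eval w s i = k -> eval w s (rdA (Const a) i) = arr s a k.
Proof. by move=> *; apply: eval_rdA => //=; rewrite modn_small //; lia. Qed.

Lemma wp_write v k a i x c Q s : 16 * (N + k) + 16 < 2 ^ w -> a < 16 ->
  regs s 5 = N -> eval w s i = k -> eval w s x = v ->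
  wp w c Q (seta s a k v) -> wp w (Seq (wrA a i x) c) Q s.
Proof.
move=> h a16 sN ik <- q.
have aE : eval w s (addrE (Const a) i) = cell a k.
  by apply: eval_addr => //=; rewrite modn_small //; lia.
change (wp w c Q (State (regs s) (update (memory s) (eval w s (addrE (Const a) i)) (eval w s x)))).
by rewrite aE.
Qed.

Lemma wp_write_last v k a i x (Q : state -> Prop) s : 16 * (N + k) + 16 < 2 ^ w -> a < 16 ->
  regs s 5 = N -> eval w s i = k -> eval w s x = v ->
  Q (seta s a k v) -> wp w (wrA a i x) Q s.
Proof. by move=> h a16 sN ik xv q; apply: (@wp_write v k a i x Skip). Qed.

End Arrays.

(* [pair_low h m] and [pair_low h m + h] are the two positions of the m-th
   butterfly of a stage with half-length [h]. *)
Definition pair_low (h m : nat) : nat := m + m %/ h * h.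

(** The number of the butterfly that contains position [i], a left inverse to both positions of a
    butterfly. *)
Definition pair_index (h i : nat) : nat := i %/ h.*2 * h + i %% h.

Section Pairs.
Variables (h n : nat).
Hypothesis h_gt0 : 0 < h.

Lemma pair_lowE m : pair_low h m = (m %/ h) * h.*2 + m %% h.
Proof. by rewrite /pair_low {1}(divn_eq m h) -muln2 mulnA; lia. Qed.

Lemma pair_low_lt m : m < n * h -> pair_low h m + h < n * h.*2.
Proof.
move=> mn; rewrite pair_lowE; have : m %/ h < n by rewrite ltn_divLR.
have := ltn_pmod m h_gt0; rewrite -muln2; move: (m %/ h) (m %% h) => q j; nia.
Qed.

Lemma divn_pair q j : j < h -> (q * h.*2 + j) %/ h.*2 = q /\ (q * h.*2 + j + h) %/ h.*2 = q.
Proof.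
move=> jh; rewrite -addnA !divnMDl ?double_gt0 // !divn_small ?addn0 //; lia.
Qed.

Lemma modn_pair q j : j < h -> (q * h.*2 + j) %% h = j /\ (q * h.*2 + j + h) %% h = j.
Proof.
by move=> jh; rewrite modnDr -muln2 mulnA mulnAC modnMDl modn_small.
Qed.

Lemma pair_indexE m :
  pair_index h (pair_low h m) = m /\ pair_index h (pair_low h m + h) = m.
Proof.
have jh := ltn_pmod m h_gt0; rewrite pair_lowE /pair_index.
have [-> ->] := divn_pair (m %/ h) jh; have [-> ->] := modn_pair (m %/ h) jh.
by rewrite -divn_eq.
Qed.

Lemma pair_index_inv m i : pair_index h i = m -> i = pair_low h m \/ i = pair_low h m + h.
Proof.
rewrite /pair_index => iE; have jh := ltn_pmod i h_gt0.
have d : m %/ h = i %/ h.*2 by rewrite -iE divnMDl // (divn_small jh) addn0.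
have r : m %% h = i %% h by rewrite -iE modnMDl modn_mod.
rewrite pair_lowE d r.
have := divn_eq i h.*2; have : i %% h.*2 < h.*2 by rewrite ltn_pmod // double_gt0.
have -> : i %% h = i %% h.*2 %% h.
  by rewrite modn_dvdm // -muln2 dvdn_mulr.
move: (i %% h.*2) (i %/ h.*2) => b a bh iab; case: (ltnP b h) => bh'.
  by left; rewrite modn_small.
have [c cE] : exists c, b = c + h by exists (b - h); lia.
by right; rewrite cE modnDr modn_small; lia.
Qed.

Lemma pair_index_lt i : i < n * h.*2 -> pair_index h i < n * h.
Proof.
move=> ilt; have : i %/ h.*2 < n by rewrite ltn_divLR ?double_gt0.
have := ltn_pmod i h_gt0; rewrite /pair_index.
move: (i %/ h.*2) (i %% h) => a b; nia.
Qed.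

Lemma pair_low_div m : pair_low h m %/ h = (m %/ h).*2 /\
  (pair_low h m + h) %/ h = (m %/ h).*2.+1.
Proof.
have lo : pair_low h m %/ h = (m %/ h).*2.
  by rewrite pair_lowE -muln2 mulnA mulnAC divnMDl // (divn_small (ltn_pmod m h_gt0)) addn0 muln2.
by rewrite lo divnDr // divnn h_gt0 lo addn1.
Qed.

End Pairs.

(** * Parameter registers and the loop over butterflies *)

Section Env.
Variables (w e : nat) (g : nat -> nat).
Local Notation N := (2 ^ e).

(** Registers below 16 hold the parameters computed by the preamble; working registers start at 16,
    so every intermediate assignment preserves [env] by [env_setr]. *)
Definition env (s : state) : Prop := forall r, r < 16 -> regs s r = g r.

Lemma env_setr s r x : 16 <= r -> env s -> env (setr s r x).
Proof.
move=> r16 es q q16 /=; rewrite /update; case: eqP => [qr|_]; last exact: es.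
by move: q16; rewrite qr; lia.
Qed.

Hypothesis e_ge : 4 <= e.

Lemma size_ge : 16 <= N.
Proof. by rewrite (_ : 16 = 2 ^ 4) // leq_exp2l. Qed.

Hypothesis w_ge : 64 * e <= w.

Lemma size_pow_lt k : k < 64 -> N ^ k < 2 ^ w.
Proof.
move=> k64; apply: leq_trans (_ : 2 ^ (64 * e) <= _); last by rewrite leq_exp2l.
by rewrite -expnM ltn_exp2l // mulnC ltn_mul2r k64; lia.
Qed.

Lemma size_sqr_lt : 16 * N * N < 2 ^ w.
Proof.
apply: leq_ltn_trans (_ : N ^ 3 < _); last exact: size_pow_lt.
by rewrite expnSr !leq_mul2r; apply/orP; right; apply/orP; right; exact: size_ge.
Qed.

(** The range is twice the array length because the store loop evaluates a read at a shifted index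
    before masking the result. *)
Lemma addr_ok k : k < 2 * N -> 16 * (N + k) + 16 < 2 ^ w.
Proof. have := size_sqr_lt; have := size_ge; nia. Qed.

Lemma w_gt0 : 0 < w. Proof. lia. Qed.

Hypothesis gN : g 5 = N.

Definition frame34 (s s' : state) : Prop :=
  forall a i, a < 16 -> a != 3 -> a != 4 -> arr N s' a i = arr N s a i.

(** The stages work in place: a position satisfies [Q] once its butterfly has been treated and [P]
    before. This is sound because the butterflies partition the positions and each touches only its
    own two. *)
Lemma pair_loop body K k (P Q : nat -> nat -> nat -> Prop) s0 :
  k < e -> env s0 -> regs s0 21 = 2 ^ k ->
  (forall i, i < N -> P i (arr N s0 3 i) (arr N s0 4 i)) ->
  (forall s m, m < 2 ^ e.-1 -> env s -> regs s 20 = m -> regs s 21 = 2 ^ k ->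
     frame34 s0 s ->
     forall i j, i = pair_low (2 ^ k) m -> j = i + 2 ^ k -> i < N -> j < N ->
     P i (arr N s 3 i) (arr N s 4 i) -> P j (arr N s 3 j) (arr N s 4 j) ->
     runs w body s K (fun s' => [/\ env s', regs s' 20 = m, regs s' 21 = 2 ^ k,
       Q i (arr N s' 3 i) (arr N s' 4 i) /\ Q j (arr N s' 3 j) (arr N s' 4 j) &
       frame34 s s' /\
       forall a l, a < 16 -> l != i -> l != j -> arr N s' a l = arr N s a l])) ->
  runs w (For 20 (Bin OpDiv (Reg 5) (Const 2)) body) s0
    (2 ^ e.-1 * (K + 10) + 8)
    (fun s' => [/\ env s', regs s' 21 = 2 ^ k, frame34 s0 s' &
       forall i, i < N -> Q i (arr N s' 3 i) (arr N s' 4 i)]).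
Proof.
move=> ke es0 h0 P0 Hbody.
set h := 2 ^ k in h0 Hbody *.
have hp : 0 < h by rewrite expn_gt0.
have N2 : 2 ^ e.-1 = 2 ^ (e.-1 - k) * h by rewrite -expnD; congr (2 ^ _); lia.
have NE : N = 2 ^ (e.-1 - k) * h.*2.
  by rewrite -mul2n -expnS -expnD; congr (2 ^ _); lia.
pose I m s := [/\ env s, regs s 20 = m, regs s 21 = h, frame34 s0 s &
  forall i, i < N -> if pair_index h i < m then Q i (arr N s 3 i) (arr N s 4 i)
                     else P i (arr N s 3 i) (arr N s 4 i)].
have N2lt : 2 ^ e.-1 < 2 ^ w by rewrite ltn_exp2l //; lia.
apply: (@runs_weaken _ _ _ (2 ^ e.-1 * (K + 10) + 8) _ (I (2 ^ e.-1))) => //; last first.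
  move=> s' _ [es' _ hs' fr Qs]; split=> // i iN; have := Qs i iN.
  by rewrite {1}N2 pair_index_lt // -NE.
have -> : K + 10 = K + 4 + (cost (Bin OpDiv (Reg 5) (Const 2))).+3 by rewrite /= -addnA.
apply: (@runs_for w _ K I) => //.
- exact: w_gt0.
- by split=> //; apply: env_setr.
- move=> m s _ [es ms _ _ _]; split=> //=; rewrite es // gN modn_small.
    by rewrite -[e in LHS](@prednK e) 1?expnS ?mulKn //; lia.
  by have := size_ge; have := size_sqr_lt; nia.
- move=> m s mlt [es ms hs fr Ps].
  have [iE jE] := pair_indexE hp m.
  have jN : pair_low h m + h < N by rewrite NE; apply: pair_low_lt => //; rewrite -N2.
  have iN : pair_low h m < N by apply: leq_ltn_trans jN; exact: leq_addr.
  have Pi := Ps _ iN; have Pj := Ps _ jN; rewrite iE ltnn in Pi; rewrite jE ltnn in Pj.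
  apply: (runs_weaken (Hbody s m mlt es ms hs fr _ _ erefl erefl iN jN Pi Pj)) => // s' _.
  move=> [es' ms' hs' [Qi Qj] [fr' out]]; split=> //; split=> //; first exact: env_setr.
    by move=> a i a16 a3 a4; rewrite -[LHS]/(arr N s' a i) fr' ?fr.
  move=> i lt_iN; rewrite -[arr N (setr _ _ _) 3 i]/(arr N s' 3 i) -[arr N (setr _ _ _) 4 i]/(arr N s' 4 i).
  case: (eqVneq i (pair_low h m)) => [->|ni]; first by rewrite iE ltnSn.
  case: (eqVneq i (pair_low h m + h)) => [->|nj]; first by rewrite jE ltnSn.
  rewrite !out // ltnS leq_eqVlt.
  case: eqP => [/(pair_index_inv hp) []|_] /=; try by move/eqP; rewrite ?(negbTE ni) ?(negbTE nj).
  exact: Ps.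
Qed.

End Env.

(** * Transforms on the RAM *)

Local Notation rd a i := (rdA (Const a) i).

(* Conventions.  Registers 2 to 9: largest coin u, reduced target, number of coins
   u removed, N = 2 ^ e, e, scale, bias, and the threshold N * scale / 2.
   Arrays: 0 is the window, 1 and 2 are the indicators of [0] and of [0 :: V],
   3 and 4 (5 and 6) are the real and imaginary parts of the data (of the table
   of roots of unity). *)

(* Fixed-point product; the bias in register 8 makes the dividend nonnegative. *)
Definition fixE (x y : expr) : expr :=
  (x [*] y [+] Reg 8) [/] Reg 7 [-] (Reg 8 [/] Reg 7).

Definition pair_setup : cmd :=
  22 <- Reg 20 [/] Reg 21 ;;
  23 <- Reg 20 [+] (Reg 22 [*] Reg 21) ;;
  24 <- Reg 23 [+] Reg 21 ;;
  25 <- rd 3 (Reg 23) ;;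
  26 <- rd 4 (Reg 23) ;;
  27 <- rd 3 (Reg 24) ;;
  28 <- rd 4 (Reg 24) ;;
  29 <- rd 5 (Reg 22) ;;
  30 <- rd 6 (Reg 22).

Definition fwd_body : cmd :=
  pair_setup ;;
  31 <- fixE (Reg 29) (Reg 27) [-] fixE (Reg 30) (Reg 28) ;;
  32 <- fixE (Reg 29) (Reg 28) [+] fixE (Reg 30) (Reg 27) ;;
  wrA 3 (Reg 23) (Reg 25 [+] Reg 31) ;;
  wrA 4 (Reg 23) (Reg 26 [+] Reg 32) ;;
  wrA 3 (Reg 24) (Reg 25 [-] Reg 31) ;;
  wrA 4 (Reg 24) (Reg 26 [-] Reg 32).

Definition bwd_body : cmd :=
  pair_setup ;;
  31 <- Reg 25 [-] Reg 27 ;;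
  32 <- Reg 26 [-] Reg 28 ;;
  wrA 3 (Reg 23) (Reg 25 [+] Reg 27) ;;
  wrA 4 (Reg 23) (Reg 26 [+] Reg 28) ;;
  wrA 3 (Reg 24) (fixE (Reg 29) (Reg 31) [+] fixE (Reg 30) (Reg 32)) ;;
  wrA 4 (Reg 24) (fixE (Reg 29) (Reg 32) [-] fixE (Reg 30) (Reg 31)).

Definition fwd_prog : cmd :=
  21 <- Reg 5 ;;
  For 19 (Reg 6) (21 <- Reg 21 [/] Const 2 ;; For 20 (Reg 5 [/] Const 2) fwd_body).

Definition bwd_prog : cmd :=
  21 <- Const 1 ;;
  For 19 (Reg 6) (For 20 (Reg 5 [/] Const 2) bwd_body ;; 21 <- Reg 21 [*] Const 2).

Definition square_body : cmd :=
  25 <- rd 3 (Reg 20) ;;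
  26 <- rd 4 (Reg 20) ;;
  wrA 3 (Reg 20) (fixE (Reg 25) (Reg 25) [-] fixE (Reg 26) (Reg 26)) ;;
  wrA 4 (Reg 20) (fixE (Reg 25) (Reg 26) [+] fixE (Reg 25) (Reg 26)).

Definition square_prog : cmd := For 20 (Reg 5) square_body.

Lemma fwd_budget a b c : 0 < a -> 0 < c -> c <= b ->
  5 * (a * b) + 2 * c * a + 2 <= a * (16 * b).
Proof. by move=> a0 c0 cb; nia. Qed.

Lemma bwd_budget a b c : 0 < a -> 0 < c -> c <= b ->
  8 * (8 * (a * b)) + 4 * (2 * (c * a)) + 2 <= 8 * (a * (16 * b)).
Proof. by move=> a0 c0 cb; nia. Qed.

Section ComplexParts.
Variable R : rcfType.
Implicit Types x y : R[i].
Local Open Scope ring_scope.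
Lemma complex_ReD x y : Re (x + y) = Re x + Re y. Proof. by case: x y => [? ?] [? ?]. Qed.
Lemma complex_ImD x y : Im (x + y) = Im x + Im y. Proof. by case: x y => [? ?] [? ?]. Qed.
Lemma complex_ReB x y : Re (x - y) = Re x - Re y. Proof. by case: x y => [? ?] [? ?]. Qed.
Lemma complex_ImB x y : Im (x - y) = Im x - Im y. Proof. by case: x y => [? ?] [? ?]. Qed.
Lemma complex_ReM x y : Re (x * y) = Re x * Re y - Im x * Im y.
Proof. by case: x y => [? ?] [? ?]. Qed.
Lemma complex_ImM x y : Im (x * y) = Re x * Im y + Im x * Re y.
Proof. by case: x y => [? ?] [? ?]. Qed.
Lemma complex_ReM_conj x y : Re (conjc x * y) = Re x * Re y + Im x * Im y.
Proof. by case: x y => [? ?] [? ?] /=; ring. Qed.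
Lemma complex_ImM_conj x y : Im (conjc x * y) = Re x * Im y - Im x * Re y.
Proof. by case: x y => [? ?] [? ?] /=; ring. Qed.
End ComplexParts.

(** * Transforms in fixed point and their errors *)

Section Stages.
Variables (R : rcfType) (w e : nat) (g : nat -> nat).
Local Notation N := (2 ^ e)%N.
Local Notation D := (N ^ 20)%N.
Local Notation HD := (N ^ 28)%N.
Local Notation delta := ((N ^ 7)%N%:R : R)%R.
Hypotheses (e_ge : (4 <= e)%N) (w_ge : (64 * e <= w)%N).

Local Notation ap := (@appr R w D).
Local Notation T := (twiddle R).
Local Notation Tc := (fun r => conjc (twiddle R r)).

Lemma scale_gt0 : (0 < D)%N. Proof. by rewrite !expn_gt0. Qed.

Lemma bias_lt : (2 * (D * HD) < 2 ^ w)%N.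
Proof.
apply: leq_ltn_trans _ (size_pow_lt e_ge w_ge (_ : 49 < 64)%N) => //.
by rewrite -expnD (expnS _ 48) leq_mul2r; apply/orP; right; have := size_ge e_ge; lia.
Qed.

Hypotheses (gN : g 5%N = N) (ge : g 6%N = e) (gD : g 7%N = D) (gH : g 8%N = (D * HD)%N).

Lemma eval_fix s x y : env g s ->
  eval w s (fixE x y) = fixmul w D (D * HD) (eval w s x) (eval w s y).
Proof. by move=> es; rewrite /= !es // gD gH. Qed.

Local Open Scope ring_scope.

Lemma evalB s x y : eval w s (x [-] y) = ((eval w s x + (2 ^ w - eval w s y)) %% 2 ^ w)%N.
Proof. by []. Qed.

Lemma evalD s x y : eval w s (x [+] y) = ((eval w s x + eval w s y) %% 2 ^ w)%N.
Proof. by []. Qed.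

Definition appr_complex (E M : R) (z : R[i]) (x y : nat) : Prop :=
  ap E M x (Re z) /\ ap E M y (Im z).

Definition has_twiddles (s : state) : Prop :=
  forall r, (r < N)%N -> appr_complex delta 1 (T r) (arr N s 5 r) (arr N s 6 r).

Lemma has_twiddles_frame s s' : frame34 e s s' -> has_twiddles s -> has_twiddles s'.
Proof. by move=> fr hs r rN; rewrite !fr //; apply: hs. Qed.

Lemma wp_pair_setup s m k i j (c : cmd) (Q : state -> Prop) :
  (k < e)%N -> (m < 2 ^ e.-1)%N -> env g s -> regs s 20 = m -> regs s 21 = (2 ^ k)%N ->
  i = pair_low (2 ^ k) m -> j = (i + 2 ^ k)%N -> (i < N)%N -> (j < N)%N ->
  (forall s', env g s' -> regs s' 20 = m -> regs s' 21 = (2 ^ k)%N ->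
    regs s' 23 = i -> regs s' 24 = j -> regs s' 25 = arr N s 3 i ->
    regs s' 26 = arr N s 4 i -> regs s' 27 = arr N s 3 j -> regs s' 28 = arr N s 4 j ->
    regs s' 29 = arr N s 5 (m %/ 2 ^ k)%N -> regs s' 30 = arr N s 6 (m %/ 2 ^ k)%N ->
    memory s' = memory s -> wp w c Q s') ->
  wp w (pair_setup ;; c) Q s.
Proof.
move=> ke mN es s20 s21 iE' jE iN jN H.
have NW : (N < 2 ^ w)%N by have := size_pow_lt e_ge w_ge (_ : 1 < 64)%N; rewrite expn1; apply.
have aok l : (l < N)%N -> (16 * (N + l) + 16 < 2 ^ w)%N.
  by move=> lN; apply: (addr_ok e_ge w_ge); lia.
have rN : (m %/ 2 ^ k < N)%N.
  apply: leq_ltn_trans (leq_div _ _) _; apply: leq_trans mN _.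
  by rewrite leq_exp2l //; exact: leq_pred.
have iE : (m + m %/ 2 ^ k * 2 ^ k = i)%N by rewrite iE'.
rewrite /pair_setup.
change (wp w (22 <- Reg 20 [/] Reg 21 ;;
  23 <- Reg 20 [+] (Reg 22 [*] Reg 21) ;;
  24 <- Reg 23 [+] Reg 21 ;;
  25 <- rd 3 (Reg 23) ;;
  26 <- rd 4 (Reg 23) ;;
  27 <- rd 3 (Reg 24) ;;
  28 <- rd 4 (Reg 24) ;;
  29 <- rd 5 (Reg 22) ;;
  30 <- rd 6 (Reg 22) ;; c) Q s).
apply: (@wp_assign w (m %/ 2 ^ k)%N); first by rewrite /= s20 s21.
apply: (@wp_assign w i).
  rewrite /= /update /= s20 s21 [(_ * _ %% _)%N]modn_small ?iE ?modn_small //.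
    exact: ltn_trans NW.
  by apply: leq_ltn_trans NW; apply: leq_trans (ltnW iN); rewrite -iE leq_addl.
apply: (@wp_assign w j); first by rewrite /= /update /= s21 -jE modn_small //; exact: ltn_trans NW.
have s5 : regs s 5 = N by rewrite es.
do 6 (apply: wp_assign; first by apply: (@eval_rdAc w N) => //; apply: aok).
by apply: H => //=; do !apply: env_setr => //.
Qed.

Lemma appr_fix E M E' M' x y a b : ap E M x a -> ap E' M' y b ->
  E <= D%:R * M -> (D%:R * M + E) * (D%:R * M' + E') <= (D * HD)%:R ->
  ap (1 + 2 * M * E' + M' * E) (M * M') (fixmul w D (D * HD) x y) (a * b).
Proof. exact: apprM scale_gt0 bias_lt _ _ _ _ _ _ _ _. Qed.

(** Each real product of a twiddle and a datum is off by at most [1 + 2 * E + M * delta]. Two of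
    them make a part of the complex product, and the other datum adds [E]; the magnitudes add up to
    [M + 2 * M]. *)
Lemma fwd_body_spec s m k i j E M z :
  (k < e)%N -> (m < 2 ^ e.-1)%N -> env g s -> regs s 20 = m -> regs s 21 = (2 ^ k)%N ->
  has_twiddles s ->
  i = pair_low (2 ^ k) m -> j = (i + 2 ^ k)%N -> (i < N)%N -> (j < N)%N ->
  appr_complex E M (z i) (arr N s 3 i) (arr N s 4 i) -> appr_complex E M (z j) (arr N s 3 j) (arr N s 4 j) ->
  delta <= D%:R -> (D%:R + delta) * (D%:R * M + E) <= (D * HD)%:R ->
  runs w fwd_body s (static_cost fwd_body) (fun s' =>
    [/\ env g s', regs s' 20 = m, regs s' 21 = (2 ^ k)%N,
       appr_complex (5 * E + 2 * M * delta + 2) (3 * M) (fstage T (2 ^ k) z i) (arr N s' 3 i) (arr N s' 4 i) /\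
       appr_complex (5 * E + 2 * M * delta + 2) (3 * M) (fstage T (2 ^ k) z j) (arr N s' 3 j) (arr N s' 4 j) &
       frame34 e s s' /\
       forall a l, (a < 16)%N -> l != i -> l != j -> arr N s' a l = arr N s a l]).
Proof.
move=> ke mN es s20 s21 tw iE jE iN jN [pr pi] [qr qi] dD big.
have aok l : (l < N)%N -> (16 * (N + l) + 16 < 2 ^ w)%N.
  by move=> lN; apply: (addr_ok e_ge w_ge); lia.
apply: wp_runs.
rewrite /fwd_body.
refine (wp_pair_setup ke mN es s20 s21 iE jE iN jN _).
move=> s1 es1 h20 h21 h23 h24 h25 h26 h27 h28 h29 h30 hm.
have s5 : regs s1 5 = N by rewrite es1.
have rN : (m %/ 2 ^ k < N)%N.
  apply: leq_ltn_trans (leq_div _ _) _; apply: leq_trans mN _.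
  by rewrite leq_exp2l //; exact: leq_pred.
have [tr ti] := tw _ rN; set r := (m %/ 2 ^ k)%N in h29 h30 tr ti.
have [di dj] := @pair_low_div (2 ^ k) (expn_gt0 2 k : (0 < 2 ^ k)%N) m.
rewrite -iE -jE -/r in di dj.
have fi : fstage T (2 ^ k) z i = z i + T r * z j.
  by rewrite /fstage di odd_double doubleK -jE.
have fj : fstage T (2 ^ k) z j = z i - T r * z j.
  by rewrite /fstage dj /= odd_double uphalf_double jE addnK.
have [xr xrE] : exists x, x = ((fixmul w D (D * HD) (arr N s 5 r) (arr N s 3 j) +
  (2 ^ w - fixmul w D (D * HD) (arr N s 6 r) (arr N s 4 j))) %% 2 ^ w)%N by eexists.
have [xi xiE] : exists x, x = ((fixmul w D (D * HD) (arr N s 5 r) (arr N s 4 j) +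
  fixmul w D (D * HD) (arr N s 6 r) (arr N s 3 j)) %% 2 ^ w)%N by eexists.
apply: (@wp_assign w xr).
  by rewrite xrE evalB !eval_fix //= h27 h28 h29 h30.
apply: (@wp_assign w xi).
  have es2 : env g (setr s1 31 xr) by apply: env_setr.
  by rewrite xiE evalD !eval_fix // -h27 -h28 -h29 -h30.
apply: (@wp_write w N ((arr N s 3 i + xr) %% 2 ^ w)%N i) => //; try exact: aok.
  by rewrite evalD -h25.
apply: (@wp_write w N ((arr N s 4 i + xi) %% 2 ^ w)%N i) => //; try exact: aok.
  by rewrite evalD -h26.
apply: (@wp_write w N ((arr N s 3 i + (2 ^ w - xr)) %% 2 ^ w)%N j) => //; try exact: aok.
  by rewrite evalB -h25.
apply: (@wp_write_last w N ((arr N s 4 i + (2 ^ w - xi)) %% 2 ^ w)%N j) => //; try exact: aok.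
  by rewrite evalB -h26.
have dD' : delta <= D%:R * 1 by rewrite mulr1.
have big' : (D%:R * 1 + delta) * (D%:R * M + E) <= (D * HD)%N%:R by rewrite mulr1.
have xrA : ap (4 * E + 2 * M * delta + 2) (2 * M) xr (Re (T r * z j)).
  rewrite xrE complex_ReM; apply: appr_le (apprB (appr_fix tr qr dD' big') (appr_fix ti qi dD' big')); lra.
have xiA : ap (4 * E + 2 * M * delta + 2) (2 * M) xi (Im (T r * z j)).
  rewrite xiE complex_ImM; apply: appr_le (apprD (appr_fix tr qi dD' big') (appr_fix ti qr dD' big')); lra.
have ij : (i == j) = false.
  by apply/negbTE; rewrite jE neq_ltn -{1}(addn0 i) ltn_add2l expn_gt0.
have ji : (j == i) = false by rewrite eq_sym.
have es3 : env g (setr (setr s1 31 xr) 32 xi) by do 2 apply: env_setr => //.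
split=> //.
- rewrite !arr_seta //= ?eqxx ?ij ?ji /= fi fj; split; split.
  + by rewrite complex_ReD; apply: appr_le (apprD pr xrA); lra.
  + by rewrite complex_ImD; apply: appr_le (apprD pi xiA); lra.
  + by rewrite complex_ReB; apply: appr_le (apprB pr xrA); lra.
  + by rewrite complex_ImB; apply: appr_le (apprB pi xiA); lra.
- have mA a l : arr N s1 a l = arr N s a l by rewrite /arr hm.
  split.
    by move=> a l a16 /negbTE a3 /negbTE a4; rewrite !arr_seta // a3 a4 /=; exact: mA.
  by move=> a l a16 /negbTE li /negbTE lj; rewrite !arr_seta // li lj !andbF; exact: mA.
Qed.

(** The subtraction comes first and doubles error and magnitude; the two products with the twiddle
    then give [2 * (1 + 2 * (2 * E) + 2 * M * delta)]. *)
Lemma bwd_body_spec s m k i j E M z :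
  (k < e)%N -> (m < 2 ^ e.-1)%N -> env g s -> regs s 20 = m -> regs s 21 = (2 ^ k)%N ->
  has_twiddles s ->
  i = pair_low (2 ^ k) m -> j = (i + 2 ^ k)%N -> (i < N)%N -> (j < N)%N ->
  appr_complex E M (z i) (arr N s 3 i) (arr N s 4 i) -> appr_complex E M (z j) (arr N s 3 j) (arr N s 4 j) ->
  delta <= D%:R -> (D%:R + delta) * (D%:R * (2 * M) + 2 * E) <= (D * HD)%:R ->
  runs w bwd_body s (static_cost bwd_body) (fun s' =>
    [/\ env g s', regs s' 20 = m, regs s' 21 = (2 ^ k)%N,
       appr_complex (8 * E + 4 * M * delta + 2) (4 * M) (istage Tc (2 ^ k) z i) (arr N s' 3 i) (arr N s' 4 i) /\
       appr_complex (8 * E + 4 * M * delta + 2) (4 * M) (istage Tc (2 ^ k) z j) (arr N s' 3 j) (arr N s' 4 j) &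
       frame34 e s s' /\
       forall a l, (a < 16)%N -> l != i -> l != j -> arr N s' a l = arr N s a l]).
Proof.
move=> ke mN es s20 s21 tw iE jE iN jN [pr pi] [qr qi] dD big.
have aok l : (l < N)%N -> (16 * (N + l) + 16 < 2 ^ w)%N.
  by move=> lN; apply: (addr_ok e_ge w_ge); lia.
apply: wp_runs.
rewrite /bwd_body.
refine (wp_pair_setup ke mN es s20 s21 iE jE iN jN _).
move=> s1 es1 h20 h21 h23 h24 h25 h26 h27 h28 h29 h30 hm.
have s5 : regs s1 5 = N by rewrite es1.
have rN : (m %/ 2 ^ k < N)%N.
  apply: leq_ltn_trans (leq_div _ _) _; apply: leq_trans mN _.
  by rewrite leq_exp2l //; exact: leq_pred.
have [tr ti] := tw _ rN; set r := (m %/ 2 ^ k)%N in h29 h30 tr ti.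
have [di dj] := @pair_low_div (2 ^ k) (expn_gt0 2 k : (0 < 2 ^ k)%N) m.
rewrite -iE -jE -/r in di dj.
have fi : istage Tc (2 ^ k) z i = z i + z j.
  by rewrite /istage di odd_double -jE.
have fj : istage Tc (2 ^ k) z j = Tc r * (z i - z j).
  by rewrite /istage dj /= odd_double uphalf_double jE addnK.
have [sr srE] : exists x, x = ((arr N s 3 i + (2 ^ w - arr N s 3 j)) %% 2 ^ w)%N by eexists.
have [si siE] : exists x, x = ((arr N s 4 i + (2 ^ w - arr N s 4 j)) %% 2 ^ w)%N by eexists.
have [xr xrE] : exists x, x = ((fixmul w D (D * HD) (arr N s 5 r) sr +
  fixmul w D (D * HD) (arr N s 6 r) si) %% 2 ^ w)%N by eexists.
have [xi xiE] : exists x, x = ((fixmul w D (D * HD) (arr N s 5 r) si +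
  (2 ^ w - fixmul w D (D * HD) (arr N s 6 r) sr)) %% 2 ^ w)%N by eexists.
apply: (@wp_assign w sr); first by rewrite srE evalB -h25 -h27.
apply: (@wp_assign w si); first by rewrite siE evalB -h26 -h28.
have es3 : env g (setr (setr s1 31 sr) 32 si) by do 2 apply: env_setr => //.
apply: (@wp_write w N ((arr N s 3 i + arr N s 3 j) %% 2 ^ w)%N i) => //; try exact: aok.
  by rewrite evalD -h25 -h27.
apply: (@wp_write w N ((arr N s 4 i + arr N s 4 j) %% 2 ^ w)%N i) => //; try exact: aok.
  by rewrite evalD -h26 -h28.
apply: (@wp_write w N xr j) => //; try exact: aok.
  by rewrite xrE evalD !eval_fix // -h29 -h30.
apply: (@wp_write_last w N xi j) => //; try exact: aok.
  by rewrite xiE evalB !eval_fix // -h29 -h30.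
have dD' : delta <= D%:R * 1 by rewrite mulr1.
have big' : (D%:R * 1 + delta) * (D%:R * (2 * M) + 2 * E) <= (D * HD)%N%:R by rewrite mulr1.
have srA : ap (2 * E) (2 * M) sr (Re (z i - z j)).
  by rewrite srE complex_ReB; apply: appr_le (apprB pr qr); lra.
have siA : ap (2 * E) (2 * M) si (Im (z i - z j)).
  by rewrite siE complex_ImB; apply: appr_le (apprB pi qi); lra.
have xrA : ap (8 * E + 4 * M * delta + 2) (4 * M) xr (Re (Tc r * (z i - z j))).
  rewrite xrE complex_ReM_conj; apply: appr_le (apprD (appr_fix tr srA dD' big') (appr_fix ti siA dD' big')); lra.
have xiA : ap (8 * E + 4 * M * delta + 2) (4 * M) xi (Im (Tc r * (z i - z j))).
  rewrite xiE complex_ImM_conj; apply: appr_le (apprB (appr_fix tr siA dD' big') (appr_fix ti srA dD' big')); lra.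
have ij : (i == j) = false.
  by apply/negbTE; rewrite jE neq_ltn -{1}(addn0 i) ltn_add2l expn_gt0.
have ji : (j == i) = false by rewrite eq_sym.
have [E0 M0] : 0 <= E /\ 0 <= M.
  by case: pr => [X [_ h1 h2]]; split; [apply: le_trans h1|apply: le_trans h2].
have Md : 0 <= M * delta by rewrite mulr_ge0 // ler0n.
split=> //.
- rewrite !arr_seta //= ?eqxx ?ij ?ji /= fi fj; split; split=> //.
  + by rewrite complex_ReD; apply: appr_le (apprD pr qr); lra.
  + by rewrite complex_ImD; apply: appr_le (apprD pi qi); lra.
- have mA a l : arr N s1 a l = arr N s a l by rewrite /arr hm.
  split.
    by move=> a l a16 /negbTE a3 /negbTE a4; rewrite !arr_seta // a3 a4 /=; exact: mA.
  by move=> a l a16 /negbTE li /negbTE lj; rewrite !arr_seta // li lj !andbF; exact: mA.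
Qed.

(** Each factor is at most twice its main term, so the product is at most [4 * D * D * a * b]. With
    [4 <= N] and [a * b <= N ^ 7] this explains [HD = N ^ 20 * N * N ^ 7]. The largest case is the
    inverse transform, where [b] is at most [4 * N ^ 6]. *)
Lemma range_bound (a b x y : nat) : (x <= N ^ 20 * a)%N -> (y <= N ^ 20 * b)%N -> (a * b <= N ^ 7)%N ->
  (D%:R * a%:R + x%:R) * (D%:R * b%:R + y%:R) <= (D * HD)%N%:R :> R.
Proof.
move=> xa yb ab; rewrite -!natrM -!natrD -natrM ler_nat.
apply: (@leq_trans ((2 * (N ^ 20 * a)) * (2 * (N ^ 20 * b)))%N).
  by apply: leq_mul; rewrite mul2n -addnn leq_add2l.
have -> : (2 * (N ^ 20 * a) * (2 * (N ^ 20 * b)) = N ^ 20 * N ^ 20 * (4 * (a * b)))%N by ring.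
have -> : (N ^ 28 = N ^ 20 * (N * N ^ 7))%N by rewrite -expnS -expnD.
rewrite [leqRHS]mulnA leq_mul2l; apply/orP; right; apply: leq_mul => //.
by apply: leq_trans (size_ge e_ge).
Qed.

Lemma square_spec s E M z : env g s ->
  (forall i, (i < N)%N -> appr_complex E M (z i) (arr N s 3 i) (arr N s 4 i)) ->
  E <= D%:R * M -> (D%:R * M + E) * (D%:R * M + E) <= (D * HD)%:R ->
  runs w square_prog s (N * (static_cost square_body + 8) + 6) (fun s' =>
    [/\ env g s', frame34 e s s' & forall i, (i < N)%N ->
       appr_complex (6 * (M * E) + 2) (2 * (M * M)) (z i * z i) (arr N s' 3 i) (arr N s' 4 i)]).
Proof.
move=> es za EM big.
have aok l : (l < N)%N -> (16 * (N + l) + 16 < 2 ^ w)%N.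
  by move=> lN; apply: (addr_ok e_ge w_ge); lia.
have NW : (N < 2 ^ w)%N by have := size_pow_lt e_ge w_ge (_ : 1 < 64)%N; rewrite expn1; apply.
pose I m s' := [/\ env g s', regs s' 20 = m, frame34 e s s' & forall i, (i < N)%N ->
  if (i < m)%N then appr_complex (6 * (M * E) + 2) (2 * (M * M)) (z i * z i) (arr N s' 3 i) (arr N s' 4 i)
  else appr_complex E M (z i) (arr N s' 3 i) (arr N s' 4 i)].
apply: (@runs_weaken _ _ _ (N * (static_cost square_body + 4 + 4) + 6) _ (I N)); first last.
- by move=> s' _ [es' _ fr h]; split=> // i iN; have := h i iN; rewrite iN.
- by rewrite -addnA.
apply: (@runs_for w N _ I) => //.
- exact: (w_gt0 e_ge w_ge).
- by split=> //; apply: env_setr.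
- by move=> m s' _ [es' rm _ _]; split=> //=; rewrite es'.
move=> m s' mN [es' rm fr h].
have [zr zi] : appr_complex E M (z m) (arr N s' 3 m) (arr N s' 4 m) by have := h m mN; rewrite ltnn.
apply: wp_runs; rewrite /square_body.
have s5 : regs s' 5 = N by rewrite es'.
apply: wp_assign; first by apply: (@eval_rdAc w N _ _ _ m) => //; apply: aok.
apply: wp_assign; first by apply: (@eval_rdAc w N _ _ _ m) => //; apply: aok.
set s1 := setr _ 26 _.
have es1 : env g s1 by do 2 apply: env_setr => //.
have [xr xrE] : exists x, x = ((fixmul w D (D * HD) (arr N s' 3 m) (arr N s' 3 m) +
  (2 ^ w - fixmul w D (D * HD) (arr N s' 4 m) (arr N s' 4 m))) %% 2 ^ w)%N by eexists.
have [xi xiE] : exists x, x = ((fixmul w D (D * HD) (arr N s' 3 m) (arr N s' 4 m) +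
  fixmul w D (D * HD) (arr N s' 3 m) (arr N s' 4 m)) %% 2 ^ w)%N by eexists.
apply: (@wp_write w N xr m) => //; try exact: aok.
  by rewrite xrE evalB !eval_fix.
apply: (@wp_write_last w N xi m) => //; try exact: aok.
  by rewrite xiE evalD !eval_fix.
have xrA : ap (6 * (M * E) + 2) (2 * (M * M)) xr (Re (z m * z m)).
  by rewrite xrE complex_ReM; apply: appr_le (apprB (appr_fix zr zr EM big) (appr_fix zi zi EM big)); lra.
have xiA : ap (6 * (M * E) + 2) (2 * (M * M)) xi (Im (z m * z m)).
  rewrite xiE complex_ImM [Im _ * _]mulrC.
  by apply: appr_le (apprD (appr_fix zr zi EM big) (appr_fix zr zi EM big)); lra.
have mA a l : arr N s1 a l = arr N s' a l by [].
split=> //; split; rewrite -?[env _ _]/(env g (setr s1 20 m.+1)) //.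
- exact: env_setr.
- move=> a i a16 /negbTE a3 /negbTE a4.
  rewrite -[LHS]/(arr N (seta N (seta N s1 3 m xr) 4 m xi) a i) !arr_seta // a3 a4.
  by apply: fr; rewrite ?a3 ?a4.
move=> i iN.
rewrite -[arr N (setr _ _ _) 3 i]/(arr N (seta N (seta N s1 3 m xr) 4 m xi) 3 i).
rewrite -[arr N (setr _ _ _) 4 i]/(arr N (seta N (seta N s1 3 m xr) 4 m xi) 4 i).
rewrite !arr_seta //= ltnS leq_eqVlt; case: (eqVneq i m) => [->|im] //=.
exact: h.
Qed.

Lemma size7_pow16_le k : (k <= e)%N -> (N ^ 7 * 16 ^ k <= N ^ 11)%N.
Proof.
move=> ke; rewrite (expnD N 7 4) leq_mul2l; apply/orP; right.
by rewrite (_ : 16 = 2 ^ 4)%N // -!expnM mulnC leq_exp2l // leq_mul2r ke orbT.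
Qed.

Lemma pow4_le k : (k <= e)%N -> (4 ^ k <= N ^ 2)%N.
Proof.
by move=> ke; rewrite (_ : 4 = 2 ^ 2)%N // -!expnM mulnC leq_exp2l // leq_mul2r ke orbT.
Qed.

(** After [k] stages the magnitude is at most [4 ^ k] and the error at most [E = N ^ 7 * 16 ^ k].
    The product of magnitude and [delta] is at most [E], so [5 * E + 2 * M * delta + 2] is at most
    [16 * E]. The exact input is simply assigned the error [N ^ 7] at [k = 0]. *)
Lemma fwd_prog_spec s z : env g s -> has_twiddles s ->
  (forall i, (i < N)%N -> appr_complex 0 1 (z i) (arr N s 3 i) (arr N s 4 i)) ->
  runs w fwd_prog s (e * (N * (static_cost fwd_body + 30)) + 20) (fun s' =>
    [/\ env g s', frame34 e s s' & forall i, (i < N)%N ->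
       appr_complex (N ^ 11)%N%:R (N ^ 2)%N%:R (fwd T e e z i) (arr N s' 3 i) (arr N s' 4 i)]).
Proof.
move=> es tw z0.
have N2 : (2 ^ e.-1 * 2 = N)%N by rewrite -expnSr prednK //; lia.
have eW : (e < 2 ^ w)%N.
  by apply: leq_trans (ltn_expl e (isT : 1 < 2)%N) _; rewrite leq_exp2l //; lia.
pose I k s' := [/\ env g s', regs s' 19 = k, regs s' 21 = (2 ^ (e - k))%N, frame34 e s s' &
  forall i, (i < N)%N -> appr_complex (N ^ 7 * 16 ^ k)%N%:R (4 ^ k)%N%:R (fwd T e k z i)
     (arr N s' 3 i) (arr N s' 4 i)].
rewrite /fwd_prog.
apply: (@runs_weaken _ _ _ (2 + (e * (4 + (2 ^ e.-1 * (static_cost fwd_body + 10) + 8) + 4 + 4) + 6)) _ (I e)); first last.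
- move=> s' _ [es' _ _ fr h]; split=> // i iN; have [h1 h2] := h i iN.
  by split; [apply: appr_le h1|apply: appr_le h2]; rewrite ler_nat ?size7_pow16_le ?pow4_le.
- have := size_ge e_ge; rewrite -N2; move: (2 ^ e.-1)%N (static_cost fwd_body) => n K n16.
  by rewrite addnC -addnA leq_add // leq_mul2l; apply/orP; right; nia.
apply: runs_seq.
have -> : 2%N = static_cost (21 <- Reg 5) by [].
apply: wp_runs; rewrite /wp.
apply: (@runs_for w e _ I) => //.
- exact: (w_gt0 e_ge w_ge).
- split=> //; first by do 2 apply: env_setr => //.
    by rewrite subn0 /= /update /= es.
  move=> i iN; have [h1 h2] := z0 i iN; rewrite muln1.
  by split; [apply: appr_le h1|apply: appr_le h2]; rewrite ?ler0n.
- by move=> k s' _ [es' rm _ _ _]; split=> //=; rewrite es'.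
move=> k s' ke [es' rk r21 fr h].
have ke' : (e - k.+1 < e)%N by lia.
apply: runs_seq.
have -> : 4%N = static_cost (21 <- Reg 21 [/] Const 2) by [].
apply: wp_runs; rewrite /wp.
have -> : eval w s' (Reg 21 [/] Const 2) = (2 ^ (e - k.+1))%N.
  rewrite /= r21 modn_small; last by rewrite -{1}(expn1 2) ltn_exp2l //; lia.
  by rewrite (_ : e - k = (e - k.+1).+1)%N ?expnS ?mulKn //; lia.
set s1 := setr s' 21 _.
have es1 : env g s1 by apply: env_setr.
pose P i x y := appr_complex (N ^ 7 * 16 ^ k)%N%:R (4 ^ k)%N%:R (fwd T e k z i) x y.
pose Q i x y := appr_complex (N ^ 7 * 16 ^ k.+1)%N%:R (4 ^ k.+1)%N%:R (fwd T e k.+1 z i) x y.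
apply: (runs_weaken (@pair_loop w e g e_ge w_ge gN fwd_body (static_cost fwd_body) _ P Q s1 ke' es1 erefl h _)) => //; last first.
  move=> s'' nr [es2 r21' fr' hQ].
  have r19 : regs s'' 19 = k by rewrite nr.
  split=> //; split=> //; first exact: env_setr.
  by move=> a i a16 a3 a4; rewrite -[LHS]/(arr N s'' a i) fr' // -[LHS]/(arr N s' a i) fr.
move=> s2 m mN es2 r20 r21' fr2 i j iE jE iN jN Pi Pj.
have tw2 : has_twiddles s2.
  apply: (has_twiddles_frame _ tw) => a l a16 a3 a4.
  by rewrite fr2 // -[LHS]/(arr N s' a l) fr.
have d7 : delta <= D%:R by rewrite ler_nat leq_exp2l //; have := size_ge e_ge; lia.
have M7 := pow4_le (ltnW ke); have E7 := size7_pow16_le (ltnW ke).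
have N16 := size_ge e_ge.
have big : (D%:R + delta) * (D%:R * (4 ^ k)%N%:R + (N ^ 7 * 16 ^ k)%N%:R) <= (D * HD)%N%:R :> R.
  rewrite -[X in X + delta]mulr1; apply: (@range_bound 1).
  - by rewrite muln1 leq_exp2l //; lia.
  - apply: leq_trans E7 _; rewrite -[(N ^ 11)%N]muln1; apply: leq_mul; last by rewrite expn_gt0.
    by rewrite leq_exp2l //; lia.
  - by rewrite mul1n; apply: leq_trans M7 _; rewrite leq_exp2l //; lia.
apply: (runs_weaken (fwd_body_spec ke' mN es2 r20 r21' tw2 iE jE iN jN Pi Pj d7 big)) => // s3 _.
have EE : 5 * (N ^ 7 * 16 ^ k)%N%:R + 2 * (4 ^ k)%N%:R * delta + 2 <= (N ^ 7 * 16 ^ k.+1)%N%:R :> R.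
  rewrite -!natrM -!natrD ler_nat (expnS 16 k).
  have le416 : (4 ^ k <= 16 ^ k)%N by case: (k) => // n; rewrite leq_exp2r.
  by apply: fwd_budget; rewrite ?expn_gt0.
have MM : 3 * (4 ^ k)%N%:R <= (4 ^ k.+1)%N%:R :> R.
  by rewrite -natrM ler_nat (expnS 4 k) leq_mul2r orbT.
move=> [es3 q20 q21 [[Qi1 Qi2] [Qj1 Qj2]] [fr3 out]]; split=> //; split; split.
- exact: appr_le Qi1.
- exact: appr_le Qi2.
- exact: appr_le Qj1.
- exact: appr_le Qj2.
Qed.

Lemma size13_pow16_le k : (k <= e)%N -> (N ^ 13 * 16 ^ k <= N ^ 17)%N.
Proof.
move=> ke; rewrite (expnD N 13 4) leq_mul2l; apply/orP; right.
by rewrite (_ : 16 = 2 ^ 4)%N // -!expnM mulnC leq_exp2l // leq_mul2r ke orbT.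
Qed.

(** The same growth rates, 4 for magnitudes and 16 for errors, now start from the squared values.
    Over [e] stages they contribute [4 ^ e = N ^ 2] and [16 ^ e = N ^ 4]. *)
Lemma bwd_prog_spec s y : env g s -> has_twiddles s ->
  (forall i, (i < N)%N -> appr_complex (8 * N ^ 13)%N%:R (2 * N ^ 4)%N%:R (y i) (arr N s 3 i) (arr N s 4 i)) ->
  runs w bwd_prog s (e * (N * (static_cost bwd_body + 30)) + 20) (fun s' =>
    [/\ env g s', frame34 e s s' & forall i, (i < N)%N ->
       appr_complex (8 * N ^ 17)%N%:R (2 * N ^ 6)%N%:R (bwd Tc e y i) (arr N s' 3 i) (arr N s' 4 i)]).
Proof.
move=> es tw z0.
have N2 : (2 ^ e.-1 * 2 = N)%N by rewrite -expnSr prednK //; lia.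
have eW : (e < 2 ^ w)%N.
  by apply: leq_trans (ltn_expl e (isT : 1 < 2)%N) _; rewrite leq_exp2l //; lia.
have W2 : (2 < 2 ^ w)%N by rewrite -{1}(expn1 2) ltn_exp2l //; lia.
pose I k s' := [/\ env g s', regs s' 19 = k, regs s' 21 = (2 ^ k)%N, frame34 e s s' &
  forall i, (i < N)%N -> appr_complex (8 * (N ^ 13 * 16 ^ k))%N%:R (2 * (N ^ 4 * 4 ^ k))%N%:R (bwd Tc k y i)
     (arr N s' 3 i) (arr N s' 4 i)].
rewrite /bwd_prog.
apply: (@runs_weaken _ _ _ (2 + (e * ((2 ^ e.-1 * (static_cost bwd_body + 10) + 8) + 4 + 4 + 4) + 6)) _ (I e)); first last.
- move=> s' _ [es' _ _ fr h]; split=> // i iN; have [h1 h2] := h i iN.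
  have N6 : (2 * (N ^ 4 * 4 ^ e) <= 2 * N ^ 6)%N.
    by rewrite (expnD N 4 2) !leq_mul2l pow4_le // !orbT.
  have N17 : (8 * (N ^ 13 * 16 ^ e) <= 8 * N ^ 17)%N by rewrite leq_mul2l size13_pow16_le.
  by split; [apply: appr_le h1|apply: appr_le h2]; rewrite ler_nat.
- have := size_ge e_ge; rewrite -N2; move: (2 ^ e.-1)%N (static_cost bwd_body) => n K n16.
  by rewrite addnC -addnA leq_add // leq_mul2l; apply/orP; right; nia.
apply: runs_seq.
have -> : 2%N = static_cost (21 <- Const 1) by [].
apply: wp_runs; rewrite /wp.
apply: (@runs_for w e _ I) => //.
- exact: (w_gt0 e_ge w_ge).
- split=> //; first by do 2 apply: env_setr => //.
    by rewrite expn0 /= /update /= modn_small //; apply: ltn_trans W2.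
  by move=> i iN; rewrite !muln1; apply: z0.
- by move=> k s' _ [es' rm _ _ _]; split=> //=; rewrite es'.
move=> k s' ke [es' rk r21 fr h].
apply: runs_seq.
pose P i a b := appr_complex (8 * (N ^ 13 * 16 ^ k))%N%:R (2 * (N ^ 4 * 4 ^ k))%N%:R (bwd Tc k y i) a b.
pose Q i a b := appr_complex (8 * (N ^ 13 * 16 ^ k.+1))%N%:R (2 * (N ^ 4 * 4 ^ k.+1))%N%:R (bwd Tc k.+1 y i) a b.
apply: (runs_weaken (@pair_loop w e g e_ge w_ge gN bwd_body (static_cost bwd_body) _ P Q s' ke es' r21 h _)) => //; last first.
  move=> s'' nr [es2 r21' fr' hQ].
  have r19 : regs s'' 19 = k by rewrite nr.
  have -> : 4%N = static_cost (21 <- Reg 21 [*] Const 2) by [].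
  apply: wp_runs; rewrite /wp.
  have -> : eval w s'' (Reg 21 [*] Const 2) = (2 ^ k.+1)%N.
    rewrite /= r21' (modn_small W2) -expnSr modn_small // ltn_exp2l //; lia.
  split=> //; split=> //; first by do 2 apply: env_setr => //.
  by move=> a i a16 a3 a4; rewrite -[LHS]/(arr N s'' a i) fr' // fr.
move=> s2 m mN es2 r20 r21' fr2 i j iE jE iN jN Pi Pj.
have tw2 : has_twiddles s2.
  by apply: (has_twiddles_frame _ tw) => a l a16 a3 a4; rewrite fr2 // fr.
have d7 : delta <= D%:R by rewrite ler_nat leq_exp2l //; have := size_ge e_ge; lia.
have M7 := pow4_le (ltnW ke); have E7 := size13_pow16_le (ltnW ke).
have N16 := size_ge e_ge.
have big : (D%:R + delta) * (D%:R * (2 * (2 * (N ^ 4 * 4 ^ k))%N%:R) + 2 * (8 * (N ^ 13 * 16 ^ k))%N%:R) <= (D * HD)%N%:R :> R.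
  rewrite -[X in X + delta]mulr1 -!(natrM _ 2); apply: (@range_bound 1).
  - by rewrite muln1 leq_exp2l //; lia.
  - rewrite mulnA; apply: (@leq_trans (N * N ^ 17)%N); first exact: leq_mul.
    rewrite -expnS -[(N ^ 18)%N]muln1; apply: leq_mul; last by rewrite !muln_gt0 !expn_gt0.
    by rewrite leq_exp2l //; lia.
  - rewrite mul1n mulnA (expnS N 6); apply: leq_mul; first by apply: leq_trans N16.
    by rewrite (expnD N 4 2) leq_mul2l M7 orbT.
apply: (runs_weaken (bwd_body_spec ke mN es2 r20 r21' tw2 iE jE iN jN Pi Pj d7 big)) => // s3 _.
have EE : 8 * (8 * (N ^ 13 * 16 ^ k))%N%:R + 4 * (2 * (N ^ 4 * 4 ^ k))%N%:R * delta + 2 <= (8 * (N ^ 13 * 16 ^ k.+1))%N%:R :> R.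
  rewrite -!natrM -!natrD ler_nat (expnS 16 k).
  have le416 : (4 ^ k <= 16 ^ k)%N by case: (k) => // n; rewrite leq_exp2r.
  apply: leq_trans (@bwd_budget (N ^ 13) (16 ^ k) (4 ^ k) _ _ le416); rewrite ?expn_gt0 //.
  rewrite leq_add2r leq_add2l -mulnA leq_mul2l -mulnA leq_mul2l mulnAC [leqRHS]mulnC leq_mul2r.
  by rewrite -expnD leq_exp2l ?orbT //; lia.
have MM : 4 * (2 * (N ^ 4 * 4 ^ k))%N%:R <= (2 * (N ^ 4 * 4 ^ k.+1))%N%:R :> R.
  by rewrite -natrM ler_nat (expnS 4 k) mulnCA leq_mul2l mulnCA leqnn orbT.
move=> [es3 q20 q21 [[Qi1 Qi2] [Qj1 Qj2]] [fr3 out]]; split=> //; split; split.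
- exact: appr_le Qi1.
- exact: appr_le Qi2.
- exact: appr_le Qj1.
- exact: appr_le Qj2.
Qed.

End Stages.

(** * Table of roots of unity *)

Definition table_body : cmd :=
  31 <- rd 5 (Reg 20) ;;
  32 <- rd 6 (Reg 20) ;;
  33 <- Reg 24 [+] Reg 20 ;;
  wrA 5 (Reg 33) (fixE (Reg 31) (Reg 22) [-] fixE (Reg 32) (Reg 23)) ;;
  wrA 6 (Reg 33) (fixE (Reg 31) (Reg 23) [+] fixE (Reg 32) (Reg 22)).

Definition isqrt_body : cmd :=
  27 <- Reg 27 [/] Const 2 ;;
  If (Reg 25 [<] (Reg 26 [+] Reg 27) [*] (Reg 26 [+] Reg 27))
    Skip (26 <- Reg 26 [+] Reg 27).

(** The root to be found is at most the scale [2 ^ (20 * e)], hence has at most [20 * e + 1]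
    bits. *)
Definition isqrt_bits : expr := Const 20 [*] Reg 6 [+] Const 1.

Definition isqrt_loop : cmd := For 21 isqrt_bits isqrt_body.

Definition root_init : cmd :=
  25 <- Reg 7 [*] (Reg 7 [+] Reg 22) [/] Const 2 ;;
  26 <- Const 0 ;;
  27 <- Reg 7 [*] Const 2.

Definition root_final : cmd :=
  23 <- (Reg 23 [*] Reg 7) [/] (Const 2 [*] Reg 26) ;;
  22 <- Reg 26 ;;
  24 <- Reg 24 [*] Const 2.

Definition roots_init : cmd :=
  wrA 5 (Const 0) (Reg 7) ;;
  wrA 6 (Const 0) (Const 0) ;;
  22 <- Const 0 ;;
  23 <- Reg 7 ;;
  24 <- Const 1.

Definition roots_prog : cmd :=
  roots_init ;;
  For 19 (Reg 6)
    (For 20 (Reg 24) table_body ;; root_init ;; isqrt_loop ;; root_final).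

Section RootsProg.
Variables (R : rcfType) (w e : nat) (g : nat -> nat).
Local Notation N := (2 ^ e)%N.
Local Notation D := (N ^ 20)%N.
Local Notation HD := (N ^ 28)%N.
Hypotheses (e_ge : (4 <= e)%N) (w_ge : (64 * e <= w)%N).

Local Notation T := (twiddle R).

Lemma scaleE : D = (2 ^ (20 * e).-1).*2.
Proof. by rewrite -expnM -mul2n -expnS prednK 1?mulnC // muln_gt0 (leq_trans _ e_ge). Qed.

Lemma scale_sqr_lt : (4 * (D * D) < 2 ^ w)%N.
Proof.
apply: leq_ltn_trans (_ : N ^ 41 < _)%N; last exact: (size_pow_lt e_ge w_ge).
rewrite -expnD (expnS N 40) leq_mul2r; apply/orP; right.
by apply: leq_trans (size_ge e_ge).
Qed.

Lemma bits_lt : (20 * e + 1 < 2 ^ w)%N.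
Proof. by apply: leq_ltn_trans (ltn_expl w (isT : 1 < 2)%N); lia. Qed.

Hypotheses (gN : g 5%N = N) (ge : g 6%N = e) (gD : g 7%N = D) (gH : g 8%N = (D * HD)%N).

Lemma isqrt_spec s Y : env g s -> regs s 25 = Y -> regs s 26 = 0 -> regs s 27 = (D * 2)%N ->
  (Y <= D * D)%N ->
  runs w isqrt_loop s ((20 * e + 1) * (static_cost isqrt_body + 20) + 20) (fun s' =>
    [/\ env g s', (regs s' 26 * regs s' 26 <= Y < (regs s' 26).+1 * (regs s' 26).+1)%N &
      memory s' = memory s]).
Proof.
move=> es rY r0 rP YD.
have Dp : D = (2 ^ (20 * e))%N by rewrite -expnM mulnC.
have D2 := scale_sqr_lt.
have W2 : (20 < 2 ^ w)%N.
  by apply: leq_ltn_trans bits_lt; rewrite -[20]muln1 (leq_trans (_ : _ <= 20 * e)%N) ?leq_addr // leq_mul2l (leq_trans _ e_ge).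
(* Register 27 is the width of the interval, starting at register 26, that contains the root. The
   bound [D * 2] on its upper end keeps the squares below [2 ^ w]. *)
pose I j s' := [/\ env g s', regs s' 21 = j, regs s' 25 = Y,
  [/\ regs s' 27 = (2 ^ (20 * e + 1 - j))%N, (regs s' 26 + regs s' 27 <= D * 2)%N,
     (regs s' 26 * regs s' 26 <= Y)%N &
     (Y < (regs s' 26 + regs s' 27) * (regs s' 26 + regs s' 27))%N] & memory s' = memory s].
apply: (@runs_weaken _ _ _ ((20 * e + 1) * (static_cost isqrt_body + 4 + (cost isqrt_bits).+3) + (cost isqrt_bits + 5)) _ (I (20 * e + 1)%N)); first last.
- move=> s' _ [es' _ _ [r27 _ lo hi] mm]; split=> //.
  by rewrite lo /=; move: hi; rewrite r27 subnn expn0 addn1.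
- by move: (static_cost _) => K /=; apply: leq_add => //; rewrite leq_mul2l -addnA leq_add2l orbT.
apply: (@runs_for w _ _ I) => //.
- exact: (w_gt0 e_ge w_ge).
- exact: bits_lt.
- split=> //; first exact: env_setr.
  rewrite /= /update /= r0 rP subn0 add0n; split=> //.
    by rewrite Dp -expnSr addn1.
  apply: leq_ltn_trans YD _; have : (0 < D)%N by rewrite !expn_gt0.
  by move: D => d; nia.
- move=> j s' _ [es' r21 _ _ _]; split=> //=.
  rewrite es' // ge (@modn_small 20) // (@modn_small 1); last exact: ltn_trans W2.
  rewrite (@modn_small (20 * e)) ?modn_small //; first exact: bits_lt.
  by apply: leq_ltn_trans bits_lt; exact: leq_addr.
move=> j s' jb [es' r21 r25 [r27 bd lo hi] mm].
apply: wp_runs; rewrite /isqrt_body.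
have pE : (2 ^ (20 * e + 1 - j) = 2 * 2 ^ (20 * e + 1 - j.+1))%N.
  by rewrite -expnS; congr (2 ^ _)%N; lia.
set p := (2 ^ (20 * e + 1 - j.+1))%N in pE.
apply: (@wp_assign w p).
  by rewrite /= r27 pE modn_small ?mulKn //; apply: ltn_trans W2.
set s1 := setr _ _ _.
have es1 : env g s1 by apply: env_setr.
have bd' : (regs s' 26 + p <= D * 2)%N by apply: leq_trans bd; rewrite r27 pE; lia.
have sE : eval w s1 (Reg 26 [+] Reg 27) = (regs s' 26 + p)%N.
  rewrite /= /update /= modn_small //; apply: leq_ltn_trans bd' (leq_ltn_trans _ D2).
  have : (0 < D)%N by rewrite !expn_gt0.
  by move: D => d; nia.
set q := (regs s' 26 + p)%N in bd' sE.
have qq : (q * q < 2 ^ w)%N.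
  by apply: leq_ltn_trans D2; apply: leq_trans (leq_mul bd' bd') _; rewrite mulnACA mulnC.
have cE : eval w s1 (Reg 25 [<] (Reg 26 [+] Reg 27) [*] (Reg 26 [+] Reg 27)) = (Y < q * q)%N.
  rewrite -[LHS]/((nat_of_bool (regs s' 25 < (eval w s1 (Reg 26 [+] Reg 27) * eval w s1 (Reg 26 [+] Reg 27)) %% 2 ^ w)%N) %% 2 ^ w)%N.
  by rewrite sE (modn_small qq) r25 modn_small //; apply: leq_ltn_trans (leq_b1 _) (ltn_trans _ W2).
change (if eval w s1 (Reg 25 [<] (Reg 26 [+] Reg 27) [*] (Reg 26 [+] Reg 27)) != 0 then
  regs s1 21 = j /\ I j.+1 (setr s1 21 j.+1) else
  regs s1 21 = j /\ I j.+1 (setr (setr s1 26 (eval w s1 (Reg 26 [+] Reg 27))) 21 j.+1)).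
rewrite cE sE; case: (ltnP Y (q * q)) => /= Yq.
  split=> //; split=> //; first by do 2 apply: env_setr => //.
  rewrite /= /update /= -/p -/q; split=> //.
split=> //; first by do 2 apply: env_setr => //.
rewrite /= /update /= -/p; split=> //; first by apply: leq_trans bd; rewrite r27 pE /q; lia.
by move: hi; rewrite r27 pE /q mul2n -addnn addnA.
Qed.

Local Open Scope ring_scope.

Definition table_upto (n : nat) (E : R) (s : state) : Prop :=
  forall r, (r < n)%N -> appr_complex w e E 1 (T r) (arr N s 5 r) (arr N s 6 r).

Definition frame56 (s s' : state) : Prop :=
  forall a i, (a < 16)%N -> a != 5 -> a != 6 -> arr N s' a i = arr N s a i.

Lemma pow16_le j : (j <= e)%N -> (16 ^ j <= N ^ 4)%N.
Proof.
by move=> je; rewrite (_ : 16 = 2 ^ 4)%N // -!expnM mulnC leq_exp2l // leq_mul2r je orbT.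
Qed.

Lemma pow8_le j : (j <= e)%N -> (8 ^ j <= N ^ 3)%N.
Proof.
by move=> je; rewrite (_ : 8 = 2 ^ 3)%N // -!expnM mulnC leq_exp2l // leq_mul2r je orbT.
Qed.

Lemma table_budget a b : (0 < a)%N -> (0 < b)%N -> (2 + 4 * a + 2 * (a * b) <= a * (8 * b))%N.
Proof. by move=> a0 b0; nia. Qed.

(** A new entry is an old one times the root of level [j], with error at most
    [2 + 4 * 16 ^ j + 2 * (N ^ 4 * 8 ^ j)]. Since [16 ^ j <= N ^ 4], growth by a factor 8 covers
    it. *)
Lemma table_spec s j C S : (j < e)%N -> env g s ->
  regs s 22 = C -> regs s 23 = S -> regs s 24 = (2 ^ j)%N ->
  appr w D (16 ^ j)%N%:R 1 C (root_re R j) ->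
  appr w D (16 ^ j)%N%:R 1 S (root_im R j) ->
  table_upto (2 ^ j) (N ^ 4 * 8 ^ j)%N%:R s ->
  runs w (For 20 (Reg 24) table_body) s (2 ^ j * (static_cost table_body + 8) + 6) (fun s' =>
    [/\ env g s', frame56 s s' & table_upto (2 ^ j.+1) (N ^ 4 * 8 ^ j.+1)%N%:R s']).
Proof.
move=> je es r22 r23 r24 aC aS tab.
have jN : (2 ^ j.+1 <= N)%N by rewrite leq_exp2l.
have jj : (2 ^ j + 2 ^ j = 2 ^ j.+1)%N by rewrite addnn -mul2n -expnS.
have NW : (N < 2 ^ w)%N by have := size_pow_lt e_ge w_ge (_ : 1 < 64)%N; rewrite expn1; apply.
have aok l : (l < N)%N -> (16 * (N + l) + 16 < 2 ^ w)%N.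
  by move=> lN; apply: (addr_ok e_ge w_ge); rewrite mul2n -addnn ltn_addr.
have jW : (2 ^ j < 2 ^ w)%N.
  by apply: leq_ltn_trans NW; apply: leq_trans jN; rewrite -jj leq_addr.
pose I m s' := [/\ env g s', [/\ regs s' 20 = m, regs s' 22 = C, regs s' 23 = S & regs s' 24 = (2 ^ j)%N],
  frame56 s s', table_upto (2 ^ j) (N ^ 4 * 8 ^ j)%N%:R s' &
  forall r, (r < m)%N -> appr_complex w e (N ^ 4 * 8 ^ j.+1)%N%:R 1 (T (2 ^ j + r)%N)
    (arr N s' 5 (2 ^ j + r)) (arr N s' 6 (2 ^ j + r))].
have le8 : (N ^ 4 * 8 ^ j)%N%:R <= (N ^ 4 * 8 ^ j.+1)%N%:R :> R.
  by rewrite ler_nat (expnS 8 j) leq_mul2l leq_pmull ?orbT.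
apply: (@runs_weaken _ _ _ (2 ^ j * (static_cost table_body + 4 + 4) + 6) _ (I (2 ^ j)%N)); first last.
- move=> s' _ [es' _ fr tab0 tab1]; split=> // r rj.
  case: (ltnP r (2 ^ j)) => r2.
    by have [t1 t2] := tab0 r r2; split; [apply: appr_le t1|apply: appr_le t2].
  by rewrite -(subnKC r2); apply: tab1; rewrite -(ltn_add2l (2 ^ j)) subnKC // jj.
- by rewrite -addnA.
apply: (@runs_for w (2 ^ j) _ I) => //.
- exact: (w_gt0 e_ge w_ge).
- by split=> //; apply: env_setr.
- by move=> m s' _ [es' [rm _ _ r] _ _ _].
move=> m s' mj [es' [rm h22 h23 h24] fr tab0 tab1].
have mN : (m < N)%N by apply: leq_trans mj _; apply: leq_trans jN; rewrite -jj leq_addr.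
have jmN : (2 ^ j + m < N)%N by apply: leq_trans jN; rewrite -jj ltn_add2l.
have s5 : regs s' 5 = N by rewrite es'.
apply: wp_runs; rewrite /table_body.
apply: (wp_assign (v := arr N s' 5 m)); first by apply: (@eval_rdAc w N _ _ _ m) => //; exact: aok.
apply: (wp_assign (v := arr N s' 6 m)); first by apply: (@eval_rdAc w N _ _ _ m) => //; exact: aok.
apply: (wp_assign (v := (2 ^ j + m)%N)).
  by rewrite /= /update /= rm h24 modn_small //; exact: ltn_trans NW.
set s1 := setr _ 33 _.
have es1 : env g s1 by do 3 apply: env_setr => //.
have h31 : eval w s1 (Reg 31) = arr N s' 5 m by [].
have h32 : eval w s1 (Reg 32) = arr N s' 6 m by [].
have h22' : eval w s1 (Reg 22) = C by [].
have h23' : eval w s1 (Reg 23) = S by [].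
have [xr xrE] : exists x, x = ((fixmul w D (D * HD) (arr N s' 5 m) C +
  (2 ^ w - fixmul w D (D * HD) (arr N s' 6 m) S)) %% 2 ^ w)%N by eexists.
have [xi xiE] : exists x, x = ((fixmul w D (D * HD) (arr N s' 5 m) S +
  fixmul w D (D * HD) (arr N s' 6 m) C) %% 2 ^ w)%N by eexists.
apply: (@wp_write w N xr (2 ^ j + m)) => //; try exact: aok.
  by rewrite xrE evalB (eval_fix w gD gH _ _ es1) (eval_fix w gD gH _ _ es1) h31 h32 h22' h23'.
set s2 := seta _ _ _ _ _.
have es2 : env g s2 by [].
apply: (@wp_write_last w N xi (2 ^ j + m)) => //; try exact: aok.
  by rewrite xiE evalD (eval_fix w gD gH _ _ es2) (eval_fix w gD gH _ _ es2) -h31 -h32 -h22' -h23'.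
have [tr ti] := tab0 m mj.
have N1 : (1 < N)%N := leq_trans (isT : 1 < 16)%N (size_ge e_ge).
have tD : (N ^ 4 * 8 ^ j <= D * 1)%N.
  apply: leq_trans (leq_mul (leqnn _) (pow8_le (ltnW je))) _.
  by rewrite -expnD muln1 leq_exp2l.
have tD' : (N ^ 4 * 8 ^ j)%N%:R <= D%:R * 1 :> R by rewrite mulr1 ler_nat -[D]muln1.
have big : (D%:R * 1 + (N ^ 4 * 8 ^ j)%N%:R) * (D%:R * 1 + (16 ^ j)%N%:R) <= (D * HD)%N%:R :> R.
  apply: (@range_bound R e e_ge 1 1) => //; last by rewrite mul1n expn_gt0 expn_gt0.
  by apply: leq_trans (pow16_le (ltnW je)) _; rewrite muln1 leq_exp2l.
have EE : 2 + 4 * (16 ^ j)%N%:R + 2 * (N ^ 4 * 8 ^ j)%N%:R <= (N ^ 4 * 8 ^ j.+1)%N%:R :> R.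
  rewrite -!natrM -!natrD ler_nat (expnS 8 j).
  apply: leq_trans (@table_budget (N ^ 4) (8 ^ j) _ _); rewrite ?expn_gt0 ?(ltnW N1) //.
  by rewrite leq_add2r leq_add2l leq_mul2l pow16_le // ltnW.
have [b1 b2] := twiddle_bound R (2 ^ j + m).
have tE := twiddle_top R mj.
have xrA : appr_complex w e (N ^ 4 * 8 ^ j.+1)%N%:R 1 (T (2 ^ j + m)%N) xr xi.
  (* The multiplication rule only yields magnitude 2. The bound is reset to 1 from the exact value,
     which lies on the unit circle; otherwise it would double every round. *)
  split; apply: (appr_norm _ (M := 2)) => //; rewrite tE.
    rewrite xrE complex_ReM; apply: appr_le (apprB (appr_fix e_ge w_ge tr aC tD' big) (appr_fix e_ge w_ge ti aS tD' big)); lra.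
  rewrite xiE complex_ImM; apply: appr_le (apprD (appr_fix e_ge w_ge tr aS tD' big) (appr_fix e_ge w_ge ti aC tD' big)); lra.
pose s3 := seta N s2 6 (2 ^ j + m) xi.
have s3E a i : (a < 16)%N -> arr N s3 a i = if (a == 6) && (i == 2 ^ j + m)%N then xi else
    if (a == 5) && (i == 2 ^ j + m)%N then xr else arr N s' a i.
  by move=> a16; rewrite /s3 arr_seta // /s2 arr_seta.
split=> //; split=> //.
- by do 4 apply: env_setr => //.
- move=> a i a16 a5 a6; rewrite -[LHS]/(arr N s3 a i) s3E // (negbTE a5) (negbTE a6) /=; exact: fr.
- move=> r rj; rewrite -[arr N (setr _ _ _) 5 r]/(arr N s3 5 r) -[arr N (setr _ _ _) 6 r]/(arr N s3 6 r).
  rewrite !s3E //=; case: eqP => [rE|_]; last exact: tab0.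
  by move: rj; rewrite rE ltnNge leq_addr.
move=> r; rewrite ltnS leq_eqVlt => rm'.
rewrite -[arr N (setr _ _ _) 5 _]/(arr N s3 5 (2 ^ j + r)) -[arr N (setr _ _ _) 6 _]/(arr N s3 6 (2 ^ j + r)).
rewrite !s3E //= eqn_add2l; case: (eqVneq r m) rm' => [->|_] //= rm'.
exact: tab1.
Qed.

Definition root_ok (j C S : nat) : Prop :=
  [/\ (C <= D)%N, (S <= D)%N, `|C%:R - D%:R * root_re R j| <= (16 ^ j)%N%:R &
      `|S%:R - D%:R * root_im R j| <= (16 ^ j)%N%:R].

Lemma root_ok_appr j C S : root_ok j C S ->
  appr w D (16 ^ j)%N%:R 1 C (root_re R j) /\ appr w D (16 ^ j)%N%:R 1 S (root_im R j).
Proof.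
move=> [CD SD hC hS].
have DW : (D < 2 ^ w)%N by apply: (size_pow_lt e_ge w_ge).
have /andP[c0 c1] := root_re_bound R j; have /andP[s0 s1] := root_im_bound R j.
split; [exists C%:Z|exists S%:Z]; split=> //; rewrite ?enc_nat ?ger0_norm //.
  exact: leq_ltn_trans DW.
exact: leq_ltn_trans DW.
Qed.

Lemma root_ok0 : root_ok 0 0 D.
Proof. by split=> //=; rewrite ?mulr0 ?mulr1 subrr normr0 ler0n. Qed.

(** The step errors [E + 3] and [3 * E + 7] are both at most [16 * E], as [E = 16 ^ j] is at least
    1. *)
Lemma root_okS j C S C' : root_ok j C S ->
  (C' * C' <= D * (D + C) %/ 2 < C'.+1 * C'.+1)%N ->
  root_ok j.+1 C' (S * D %/ (2 * C'))%N.
Proof.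
move=> [CD SD hC hS] sq.
have d0 : (0 < 2 ^ (20 * e).-1)%N by rewrite expn_gt0.
have D0 : (0 < D)%N by rewrite !expn_gt0.
have CD' := CD; have sq' := sq; have hC' := hC; rewrite !scaleE in CD' sq' hC'.
have /andP[lo hi] := isqrt_bound d0 CD' sq'.
have hC2 := root_step_re d0 CD' sq' hC'; rewrite -scaleE in hC2 hi.
have DC : (D <= 2 * C')%N by rewrite scaleE -mul2n leq_mul2l lo.
have hS2 := root_step_im D0 DC erefl hC2 hS.
have E1 : 1 <= (16 ^ j)%N%:R :> R by rewrite ler1n expn_gt0.
have ES : (16 ^ j.+1)%N%:R = 16 * (16 ^ j)%N%:R :> R by rewrite expnS natrM.
have gC : `|C'%:R - D%:R * root_re R j.+1| <= (16 ^ j.+1)%N%:R.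
  by apply: le_trans hC2 _; rewrite ES; move: E1 => *; lra.
have gS : `|(S * D %/ (2 * C'))%N%:R - D%:R * root_im R j.+1| <= (16 ^ j.+1)%N%:R.
  by apply: le_trans hS2 _; rewrite ES; move: E1 => *; lra.
split=> //; apply: leq_trans (leq_div2l _ D0 DC) _.
by apply: leq_trans (leq_div2r D (leq_mul SD (leqnn D))) _; rewrite mulnK.
Qed.

Definition roots_cost : nat :=
  static_cost roots_init + static_cost table_body + static_cost root_init +
  static_cost isqrt_body * 21 + static_cost root_final + 600.

(** The [e] square roots take time of order [e ^ 2], which [e <= n] absorbs into [n * e]. *)
Lemma roots_budget K0 K1 K2 K3 K4 n : (16 <= n)%N -> (e <= n)%N ->
  (K0 + (e * ((n * (K1 + 8) + 6) + (K2 + (((20 * e + 1) * (K3 + 20) + 20) + K4)) + 4 + 4) + 6)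
   <= (K0 + K1 + K2 + K3 * 21 + K4 + 600) * (n * e))%N.
Proof.
move=> n16 en.
have e0 : (0 < e)%N by apply: leq_trans e_ge.
have h : ((20 * e + 1) * (K3 + 20) <= n * (K3 * 21 + 420))%N.
  apply: (@leq_trans ((21 * n) * (K3 + 20))%N); last by rewrite mulnAC [(21 * _)%N]mulnC; lia.
  by apply: leq_mul => //; lia.
apply: (@leq_trans (n * e * K0 + (e * (n * (K1 + 8) + n + (n * K2 + ((n * (K3 * 21 + 420) + n * 2) + n * K4)) + n) + n * e * 6))%N).
  apply: leq_add; first by rewrite leq_pmull // muln_gt0 e0 (leq_trans _ n16).
  apply: leq_add; last by rewrite leq_pmull // muln_gt0 e0 (leq_trans _ n16).
  rewrite leq_mul2l; apply/orP; right.
  have k2 : (K2 <= n * K2)%N by rewrite leq_pmull // (leq_trans _ n16).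
  have k4 : (K4 <= n * K4)%N by rewrite leq_pmull // (leq_trans _ n16).
  by lia.
have -> : (n * e * K0 + (e * (n * (K1 + 8) + n + (n * K2 + ((n * (K3 * 21 + 420) + n * 2) + n * K4)) + n) + n * e * 6) =
  (K0 + K1 + K2 + K3 * 21 + K4 + 438) * (n * e))%N by ring.
by rewrite leq_mul2r leq_add2l orbT.
Qed.

Lemma roots_spec s : env g s ->
  runs w roots_prog s (roots_cost * (N * e))%N (fun s' =>
    [/\ env g s', frame56 s s' & has_twiddles R w e s']).
Proof.
move=> es.
have N16 := size_ge e_ge.
have N1 : (1 < N)%N := leq_trans (isT : 1 < 16)%N N16.
have eW : (e < 2 ^ w)%N.
  by apply: leq_ltn_trans bits_lt; rewrite (leq_trans _ (leq_addr _ _)) // leq_pmull.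
have DW : (D < 2 ^ w)%N by apply: (size_pow_lt e_ge w_ge).
have D0 : (0 < D)%N by rewrite !expn_gt0.
have aok l : (l < N)%N -> (16 * (N + l) + 16 < 2 ^ w)%N.
  by move=> lN; apply: (addr_ok e_ge w_ge); rewrite mul2n -addnn ltn_addr.
pose I j s' := exists C S, [/\ env g s', frame56 s s', root_ok j C S,
  [/\ regs s' 19 = j, regs s' 22 = C, regs s' 23 = S & regs s' 24 = (2 ^ j)%N] &
  table_upto (2 ^ j) (N ^ 4 * 8 ^ j)%N%:R s'].
apply: (@runs_weaken _ _ _ (static_cost roots_init + (e * ((N * (static_cost table_body + 8) + 6) + (static_cost root_init +
  (((20 * e + 1) * (static_cost isqrt_body + 20) + 20) + static_cost root_final)) + 4 + 4) + 6))%N _ (I e)); first last.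
- move=> s' _ [C [S [es' fr _ _ tab]]]; split=> // r rN; have [t1 t2] := tab r rN.
  (* This is the origin of the accuracy [N ^ 7] of the table: [8 ^ e = N ^ 3]. *)
  have le7 : (N ^ 4 * 8 ^ e)%N%:R <= (N ^ 7)%N%:R :> R.
    by rewrite ler_nat (expnD N 4 3) leq_mul2l pow8_le ?orbT.
  by split; [apply: appr_le t1|apply: appr_le t2].
- apply: roots_budget => //; exact/ltnW/ltn_expl.
rewrite /roots_prog; apply: runs_seq; apply: wp_runs; rewrite /roots_init.
have s5 : regs s 5 = N by rewrite es.
have W1 : (1 < 2 ^ w)%N by rewrite -{1}(expn0 2) ltn_exp2l // (w_gt0 e_ge w_ge).
apply: (@wp_write w N D 0) => //; first by apply: aok; rewrite expn_gt0.
- by rewrite /= mod0n.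
- by rewrite -gD -es.
apply: (@wp_write w N 0 0) => //; first by apply: aok; rewrite expn_gt0.
- by rewrite /= mod0n.
- by rewrite /= mod0n.
apply: (@wp_assign w 0); first by rewrite /= mod0n.
apply: (@wp_assign w D); first by rewrite -gD -es.
rewrite /wp (_ : eval _ _ (Const 1) = 1%N); last by rewrite /= modn_small.
set s1 := setr _ 24 _.
have s1E a i : (a < 16)%N -> arr N s1 a i = if (a == 6) && (i == 0)%N then 0%N else
    if (a == 5) && (i == 0)%N then D else arr N s a i.
  move=> a16; rewrite -[LHS]/(arr N (seta N (seta N s 5 0 D) 6 0 0) a i).
  by rewrite !arr_seta.
apply: (@runs_for w e _ I) => //.
- exact: (w_gt0 e_ge w_ge).
- exists 0%N, D; split=> //.
  + by do 4 apply: env_setr => //.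
  + move=> a i a16 a5 a6; rewrite -[LHS]/(arr N s1 a i) s1E // (negbTE a5) (negbTE a6) //.
  + exact: root_ok0.
  + move=> r; rewrite expn0 ltnS leqn0 => /eqP ->.
    rewrite -[arr N (setr _ _ _) 5 _]/(arr N s1 5 0) -[arr N (setr _ _ _) 6 _]/(arr N s1 6 0).
    rewrite !s1E //= twiddle0.
    split.
      apply: (@appr_le R w D 0 `|1|) (@appr_nat R w D D 1 _ _); rewrite ?normr1 ?ler0n ?mulr1 //.
    by apply: (@appr_le R w D 0 `|0|) (@appr_nat R w D 0 0 _ _); rewrite ?normr0 ?ler0n ?ler01 ?mulr0 ?expn_gt0.
- by move=> j s' _ [C [S [es' _ _ [rj _ _ _] _]]]; split=> //=; rewrite es'.
move=> j s' je [C [S [es' fr ok [r19 r22 r23 r24] tab]]].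
have [aC aS] := root_ok_appr ok.
apply: runs_seq.
apply: (runs_weaken (table_spec je es' r22 r23 r24 aC aS tab)).
  by rewrite leq_add2r leq_mul2r leq_exp2l // ltnW ?orbT.
move=> s2 nr [es2 fr2 tab2].
have q19 : regs s2 19 = j by rewrite nr.
have q22 : regs s2 22 = C by rewrite nr.
have q23 : regs s2 23 = S by rewrite nr.
have q24 : regs s2 24 = (2 ^ j)%N by rewrite nr.
have [CD SD _ _] := ok.
apply: runs_seq; apply: wp_runs; rewrite /root_init.
have W2 : (2 < 2 ^ w)%N by apply: leq_ltn_trans DW; rewrite -(expn1 2) scaleE -mul2n expn1 leq_pmulr // expn_gt0.
have DCW : (D * (D + C) < 2 ^ w)%N.
  by apply: leq_ltn_trans (scale_sqr_lt); move: CD; move: (D) => d; clear; nia.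
apply: (@wp_assign w (D * (D + C) %/ 2)%N).
  rewrite /= es2 // gD q22 [((D + C) %% _)%N]modn_small; last first.
    by apply: leq_ltn_trans DCW; rewrite leq_pmull.
  by rewrite (modn_small DCW) modn_small.
apply: (@wp_assign w 0); first by rewrite /= mod0n.
rewrite /wp.
set s3 := setr (setr s2 25 _) 26 0.
have es3 : env g s3 by do 2 apply: env_setr => //.
have -> : eval w s3 (Reg 7 [*] Const 2) = (D * 2)%N.
  rewrite /= /update /= es2 // gD (modn_small W2) modn_small //.
  by apply: leq_ltn_trans (scale_sqr_lt); move: D0; move: (D) => d; clear; nia.
have es4 : env g (setr s3 27 (D * 2)) by apply: env_setr.
apply: runs_seq.
have YD : (D * (D + C) %/ 2 <= D * D)%N.
  by apply: leq_trans (leq_div2r 2 (_ : _ <= D * D * 2)%N) _; [rewrite -mulnA leq_mul2l muln2 -addnn leq_add2l CD orbT|rewrite mulnK].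
apply: (runs_weaken (isqrt_spec es4 erefl erefl erefl YD)) => // s5' nr5 [es5 sq mm].
have p19 : regs s5' 19 = j by rewrite nr5.
have p23 : regs s5' 23 = S by rewrite nr5.
have p24 : regs s5' 24 = (2 ^ j)%N by rewrite nr5.
have [C' r26] : exists C', regs s5' 26 = C' by eexists.
rewrite r26 in sq.
have ok' := root_okS ok sq; have [C'D _ _ _] := ok'.
apply: wp_runs; rewrite /root_final.
apply: (@wp_assign w (S * D %/ (2 * C'))%N).
  rewrite /= (es5 7%N isT) gD p23 r26 (modn_small W2) [((S * D) %% _)%N]modn_small ?[((2 * C') %% _)%N]modn_small //.
    by apply: leq_ltn_trans (scale_sqr_lt); move: C'D D0; move: (D) => d; clear; nia.
  by apply: leq_ltn_trans (scale_sqr_lt); move: SD; move: (D) => d; clear; nia.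
apply: (@wp_assign w C'); first by rewrite /= /update /= r26.
rewrite /wp.
have jw : (j.+1 < w)%N by clear -je e_ge w_ge; lia.
have -> : eval w (setr (setr s5' 23 (S * D %/ (2 * C'))%N) 22 C') (Reg 24 [*] Const 2) = (2 ^ j.+1)%N.
  by rewrite /= /update /= p24 (modn_small W2) -expnSr modn_small // ltn_exp2l.
split=> //; exists C', (S * D %/ (2 * C'))%N.
have mA a i : arr N s5' a i = arr N s2 a i by rewrite /arr mm.
split=> //.
- by do 4 apply: env_setr => //.
- move=> a i a16 a5 a6; rewrite -[LHS]/(arr N s5' a i) mA fr2 //; exact: fr.
move=> r rj; rewrite -[arr N (setr _ _ _) 5 r]/(arr N s5' 5 r) -[arr N (setr _ _ _) 6 r]/(arr N s5' 6 r).
rewrite !mA; exact: tab2.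
Qed.

End RootsProg.

(** * Convolution *)

Definition load_body : cmd :=
  wrA 3 (Reg 20) (rd 0 (Reg 20) [*] Reg 7) ;;
  wrA 4 (Reg 20) (rdA (Reg 17) (Reg 20) [*] Reg 7).

Definition load_prog : cmd := For 20 (Reg 5) load_body.

Definition store_body : cmd :=
  wrA 0 (Reg 20) ((Reg 20 [<] Reg 18) [*]
    (Reg 8 [+] Reg 9 [<] rd 4 (Reg 20 [+] Reg 16) [+] Reg 8)).

Definition store_prog : cmd := For 20 (Reg 5) store_body.

(* The sequences in the arrays 0 and [Reg 17] are the real and imaginary parts
   of the transformed sequence: squaring [A + i B] leaves [2 A B] in the
   imaginary part. *)
Definition conv_prog : cmd :=
  load_prog ;; fwd_prog ;; square_prog ;; bwd_prog ;; store_prog.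

Definition cyclic_sum (n : nat) (A B : nat -> bool) (k : nat) : bool :=
  [exists i : 'I_n, [exists j : 'I_n, [&& A i, B j & (i + j) %% n == k]]].

Section ImConv.
Variable R : rcfType.
Local Open Scope ring_scope.

Lemma Im_sum I (r : seq I) (p : pred I) (f : I -> R[i]) :
  Im (\sum_(i <- r | p i) f i) = \sum_(i <- r | p i) Im (f i).
Proof. by apply: (big_morph _ (@complex_ImD R)). Qed.

Definition pair_seq (A B : nat -> bool) (i : nat) : R[i] :=
  Complex (A i)%:R (B i)%:R.

(** The imaginary part is a natural number, counting pairs in both orders, so it is either 0 or at
    least 1. *)
Lemma Im_cconv n (A B : nat -> bool) k :
  Im (cconv n (pair_seq A B) k) =
  \sum_(i < n) \sum_(j < n | ((i + j) %% n)%N == k) ((A i && B j) + (B i && A j))%N%:R.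
Proof.
rewrite /cconv Im_sum; apply: eq_bigr => i _; rewrite Im_sum; apply: eq_bigr => j _.
by rewrite complex_ImM /= natrD -!natrM !mulnb.
Qed.

Lemma cyclic_sumN n A B k : ~~ cyclic_sum n A B k ->
  Im (cconv n (pair_seq A B) k) = 0.
Proof.
move=> h; rewrite Im_cconv big1 // => i _; rewrite big1 // => j ij.
have hij (a b : 'I_n) : ((a + b) %% n)%N == k -> A a && B b = false.
  move=> ab; apply/negP => /andP[Aa Bb]; case/negP: h.
  by apply/existsP; exists a; apply/existsP; exists b; rewrite Aa Bb.
by rewrite hij // [B i && _]andbC hij // addnC.
Qed.

Lemma cyclic_sumP n A B k : cyclic_sum n A B k ->
  1 <= Im (cconv n (pair_seq A B) k).
Proof.
move=> /existsP [i /existsP [j /and3P [Ai Bj ij]]].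
rewrite Im_cconv (bigD1 i) //= (bigD1 j) //= Ai Bj /= natrD -addrA -addrA lerDl.
apply: addr_ge0; first exact: ler0n.
by apply: addr_ge0; do ?[apply: sumr_ge0 => ? _]; exact: ler0n.
Qed.

Lemma Im_mulrn (x : R[i]) n : Im (x *+ n) = Im x *+ n.
Proof. by elim: n => // n IH; rewrite !mulrS complex_ImD IH. Qed.

End ImConv.

(** The possible values of [d * z] are at most 0 or at least [2 * G], and the error is below [G].
    Both sides of the test are shifted by [H] because the machine compares unsigned words. *)
Lemma threshold_aux (R : rcfType) (w n d H G err M x : nat) (z : R) : (0 < d)%N ->
  (2 * H < 2 ^ w)%N -> (n * d = 2 * G)%N -> (err < G)%N -> (G < H)%N ->
  (d * M + err <= H)%N -> appr w d err%:R M%:R x z ->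
  [/\ z <= 0 -> ~~ ((H + G) %% 2 ^ w < (x + H) %% 2 ^ w)%N &
      n%:R <= z -> ((H + G) %% 2 ^ w < (x + H) %% 2 ^ w)%N]%R.
Proof.
move=> d0 Hw nG errG GH bound [X [-> Xz zM]].
have XH : (`|X| <= H%:Z)%R.
  rewrite -(ler_int R) intr_norm.
  apply: (@le_trans _ _ (d * M + err)%N%:R%R); last by rewrite -pmulrn ler_nat.
  rewrite natrD natrM -[X%:~R%R](subrK (d%:R * z)%R) addrC.
  apply: le_trans (ler_normD _ _) _; apply: lerD => //.
  by rewrite normrM ger0_norm ?ler0n // ler_wpM2l ?ler0n.
have -> : ((enc w X + H) %% 2 ^ w = `|(X + H%:Z)%R|)%N.
  rewrite -{1}(@enc_nat w H); last by lia.
  by rewrite encD -{1}(@gez0_abs (X + H%:Z)%R) ?enc_nat //; move: XH; rewrite ler_norml; lia.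
rewrite (@modn_small (H + _)); last by lia.
have -> : (H + G < `|(X + H%:Z)%R|)%N = (G%:Z < X)%R by move: XH; rewrite ler_norml; lia.
rewrite -(ltr_int R); move: Xz; rewrite ler_norml => /andP[x1 x2].
have errG' : (err%:R < G%:R :> R)%R by rewrite ltr_nat.
have nG' : (n%:R * d%:R = 2 * G%:R :> R)%R by rewrite -!natrM nG.
have d0' : (0 < d%:R :> R)%R by rewrite ltr0n.
rewrite -[(G%:Z)%:~R%R]/(G%:R : R)%R; split=> zz; last by nra.
by rewrite -leNgt; nra.
Qed.

Section Conv.
Variables (R : rcfType) (w e : nat) (g : nat -> nat).
Local Notation N := (2 ^ e)%N.
Local Notation D := (N ^ 20)%N.
Local Notation HD := (N ^ 28)%N.
Hypotheses (e_ge : (4 <= e)%N) (w_ge : (64 * e <= w)%N).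
Hypotheses (gN : g 5%N = N) (ge : g 6%N = e) (gD : g 7%N = D) (gH : g 8%N = (D * HD)%N)
  (gG : g 9%N = (2 ^ e.-1 * D)%N).

Local Notation T := (twiddle R).
Local Notation Tc := (fun r => conjc (twiddle R r)).

Lemma load_spec s y (A B : nat -> bool) : env g s -> regs s 17 = y ->
  (y < 16)%N -> y != 3 -> y != 4 ->
  (forall i, (i < N)%N -> arr N s 0 i = A i) ->
  (forall i, (i < N)%N -> arr N s y i = B i) ->
  runs w load_prog s (N * (static_cost load_body + 8) + 6) (fun s' =>
    [/\ env g s', frame34 e s s' & forall i, (i < N)%N ->
       appr_complex w e 0%R 1%R (pair_seq R A B i) (arr N s' 3 i) (arr N s' 4 i)]).
Proof.
move=> es ry y16 y3 y4 hA hB.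
have aok l : (l < N)%N -> (16 * (N + l) + 16 < 2 ^ w)%N.
  by move=> lN; apply: (addr_ok e_ge w_ge); lia.
have NW : (N < 2 ^ w)%N by have := size_pow_lt e_ge w_ge (_ : 1 < 64)%N; rewrite expn1; apply.
have DW : (D < 2 ^ w)%N by apply: (size_pow_lt e_ge w_ge).
have bD (b : bool) : (b * D < 2 ^ w)%N by case: b; rewrite ?mul1n ?mul0n // expn_gt0.
have apb (b : bool) : appr w D 0%R 1%R (b * D)%N (b%:R : R)%R.
  apply: (@appr_le R w D 0%R `|b%:R|%R); [exact: lexx|by case: b; rewrite ?normr1 ?normr0 ?ler01|].
  by apply: appr_nat; rewrite ?bD // natrM mulrC.
pose I m s' := [/\ env g s', regs s' 20 = m, regs s' 17 = y, frame34 e s s' & forall i, (i < m)%N ->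
  appr_complex w e 0%R 1%R (pair_seq R A B i) (arr N s' 3 i) (arr N s' 4 i)].
apply: (@runs_weaken _ _ _ (N * (static_cost load_body + 4 + 4) + 6) _ (I N)); first last.
- by move=> s' _ [es' _ _ fr h].
- by rewrite -addnA.
apply: (@runs_for w N _ I) => //.
- exact: (w_gt0 e_ge w_ge).
- by split=> //; apply: env_setr.
- by move=> m s' _ [es' rm _ _ _]; split=> //=; rewrite es'.
move=> m s' mN [es' rm ry' fr h].
apply: wp_runs; rewrite /load_body.
have s5 : regs s' 5 = N by rewrite es'.
apply: (@wp_write w N (A m * D)%N m) => //; try exact: aok.
  change ((eval w s' (rd 0 (Reg 20)) * regs s' 7) %% 2 ^ w = A m * D)%N.
  by rewrite (@eval_rdAc w N _ _ _ m) ?aok // fr // hA // es' // gD modn_small.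
set s1 := seta _ _ _ _ _.
have s15 : regs s1 5 = N by [].
apply: (@wp_write_last w N (B m * D)%N m) => //; try exact: aok.
  change ((eval w s1 (rdA (Reg 17) (Reg 20)) * regs s' 7) %% 2 ^ w = B m * D)%N.
  rewrite (@eval_rdA w N _ _ _ m y) ?aok // arr_seta // (negbTE y3) /= fr // hB //.
  by rewrite es' // gD modn_small.
split=> //; split=> //; first exact: env_setr.
  move=> a i a16 /negbTE a3 /negbTE a4.
  rewrite -[LHS]/(arr N (seta N s1 4 m (B m * D)%N) a i) !arr_seta // a3 a4.
  by apply: fr; rewrite ?a3 ?a4.
move=> i; rewrite ltnS leq_eqVlt => im.
rewrite -[arr N (setr _ _ _) 3 i]/(arr N (seta N s1 4 m (B m * D)%N) 3 i).
rewrite -[arr N (setr _ _ _) 4 i]/(arr N (seta N s1 4 m (B m * D)%N) 4 i).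
rewrite !arr_seta //=; case: (eqVneq i m) im => [->|_] //= im.
exact: h.
Qed.

Local Open Scope ring_scope.

Lemma threshold (x : nat) (z : R) : appr w D (8 * N ^ 17)%N%:R (2 * N ^ 6)%N%:R x z ->
  [/\ z <= 0 -> ~~ ((D * HD + 2 ^ e.-1 * D) %% 2 ^ w < (x + D * HD) %% 2 ^ w)%N &
      N%:R <= z -> ((D * HD + 2 ^ e.-1 * D) %% 2 ^ w < (x + D * HD) %% 2 ^ w)%N].
Proof.
have N16 := size_ge e_ge.
have N2 : (2 ^ e.-1 * 2 = N)%N by rewrite -expnSr prednK //; lia.
have k3 n : (0 < n)%N -> (16 <= N ^ n)%N.
  by move=> n0; apply: leq_trans N16 _; rewrite -{1}(expn1 N) leq_exp2l //; lia.
apply: threshold_aux.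
- by rewrite !expn_gt0.
- exact: bias_lt e_ge w_ge.
- by rewrite -{1}N2; ring.
- rewrite (expnD N 3 17); apply: (@leq_trans (8 * (2 * N ^ 17))%N).
    by rewrite ltn_mul2l /= mul2n -addnn -{1}(addn0 (N ^ 17)%N) ltn_add2l !expn_gt0.
  apply: leq_mul; first by rewrite -N2 in N16; lia.
  by rewrite leq_mul2r; apply/orP; right; apply: leq_trans (k3 3 isT).
- rewrite mulnC ltn_mul2l !expn_gt0 /=; apply: (@leq_trans (N ^ 1)%N); last by rewrite leq_exp2l //; lia.
  by rewrite expn1 -N2; move: (2 ^ e.-1)%N (expn_gt0 2 e.-1) => n /=; lia.
- rewrite -expnD; apply: (@leq_trans (N ^ 27 + N ^ 27)%N).
    apply: leq_add.
      rewrite mulnCA -expnD (expnS N 26) leq_mul2r; apply/orP; right.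
      by apply: leq_trans N16.
    by rewrite (expnD N 10 17) leq_mul2r; apply/orP; right; apply: leq_trans (k3 10 isT).
  rewrite (expnD N 21 27) addnn -mul2n leq_mul2r; apply/orP; right.
  by apply: leq_trans (k3 21 isT).
Qed.

(** Positions from [len] on are forced to 0 by the first factor of the product, whatever the shifted
    read returns there; below [len] the shifted index stays within the array. *)
Lemma store_spec s shift len (z : nat -> R) (C : nat -> bool) : env g s ->
  regs s 16 = shift -> regs s 18 = len -> (len + shift <= N)%N -> (shift <= N)%N ->
  (forall i, (i < N)%N ->
     appr w D (8 * N ^ 17)%N%:R (2 * N ^ 6)%N%:R (arr N s 4 i) (z i)) ->
  (forall i, (i < N)%N -> if C i then N%:R <= z i else z i <= 0) ->
  runs w store_prog s (N * (static_cost store_body + 8) + 6) (fun s' =>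
    [/\ env g s',
        forall a i, (a < 16)%N -> a != 0 -> arr N s' a i = arr N s a i &
        forall i, (i < N)%N -> arr N s' 0 i = (i < len)%N && C (i + shift)%N]).
Proof.
move=> es rs rl ls sN hz hC.
have aok l : (l < 2 * N)%N -> (16 * (N + l) + 16 < 2 ^ w)%N by move=> lN; apply: (addr_ok e_ge w_ge).
have N1w : (2 * N < 2 ^ w)%N by rewrite -expnS ltn_exp2l //; lia.
have W1 : (1 < 2 ^ w)%N by rewrite -{1}(expn0 2) ltn_exp2l // (w_gt0 e_ge w_ge).
have NW : (N < 2 ^ w)%N by apply: leq_ltn_trans N1w; rewrite mul2n -addnn leq_addr.
pose I m s' := [/\ env g s', [/\ regs s' 20 = m, regs s' 16 = shift & regs s' 18 = len],
  forall a i, (a < 16)%N -> a != 0 -> arr N s' a i = arr N s a i & forall i, (i < m)%N ->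
  arr N s' 0 i = (i < len)%N && C (i + shift)%N].
apply: (@runs_weaken _ _ _ (N * (static_cost store_body + 4 + 4) + 6) _ (I N)); first last.
- by move=> s' _ [es' _ fr h].
- by rewrite -addnA.
apply: (@runs_for w N _ I) => //.
- exact: (w_gt0 e_ge w_ge).
- by split=> //; apply: env_setr.
- by move=> m s' _ [es' [rm _ _] _ _]; split=> //=; rewrite es'.
move=> m s' mN [es' [rm rs' rl'] fr h].
have s5 : regs s' 5 = N by rewrite es'.
apply: wp_runs; rewrite /store_body.
have mlt : (m < 2 * N)%N by apply: leq_trans mN _; rewrite mul2n -addnn leq_addr.
have mslt : (m + shift < 2 * N)%N by rewrite mul2n -addnn -addSn leq_add.
apply: (@wp_write_last w N ((m < len)%N && C (m + shift)%N) m) => //; try exact: aok.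
  set x := eval w s' (rd 4 (Reg 20 [+] Reg 16)).
  have xE : x = arr N s 4 (m + shift)%N.
    rewrite /x (@eval_rdAc w N _ _ _ (m + shift)%N) ?aok ?fr //.
    by rewrite /= rm rs' modn_small //; apply: ltn_trans N1w.
  have -> : eval w s' ((Reg 20 [<] Reg 18) [*] (Reg 8 [+] Reg 9 [<] rd 4 (Reg 20 [+] Reg 16) [+] Reg 8)) =
    ((((regs s' 20 < regs s' 18)%N : nat) %% 2 ^ w) * (((regs s' 8 + regs s' 9) %% 2 ^ w < (x + regs s' 8) %% 2 ^ w)%N %% 2 ^ w) %% 2 ^ w)%N by [].
  rewrite rm rl' !es' // gH gG.
  have b1 (b : bool) : (b %% 2 ^ w)%N = b by rewrite modn_small //; case: b => //; exact: ltnW.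
  rewrite !b1 mulnb b1; case: (ltnP m len) => //= ml; congr nat_of_bool.
  have msN : (m + shift < N)%N by apply: leq_trans ls; rewrite -addSn leq_add2r.
  have := hC _ msN; have := threshold (hz _ msN); rewrite -xE => -[t0 t1].
  by case: (C _) => [/t1|/t0/negbTE].
split=> //; split=> //; first exact: env_setr.
  move=> a i a16 /negbTE a0.
  rewrite -[LHS]/(arr N (seta N s' 0 m ((m < len)%N && C (m + shift)%N)) a i) arr_seta // a0.
  by apply: fr; rewrite ?a0.
move=> i; rewrite ltnS leq_eqVlt => im.
rewrite -[LHS]/(arr N (seta N s' 0 m ((m < len)%N && C (m + shift)%N)) 0 i).
rewrite arr_seta //=; case: (eqVneq i m) im => [->|_] //= im.
exact: h.
Qed.

Definition conv_cost : nat :=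
  static_cost load_body + static_cost fwd_body + static_cost square_body +
  static_cost bwd_body + static_cost store_body + 200.

Lemma conv_spec s y shift len (A B : nat -> bool) : env g s -> has_twiddles R w e s ->
  regs s 16 = shift -> regs s 17 = y -> regs s 18 = len ->
  (y < 16)%N -> y != 3 -> y != 4 -> (len + shift <= N)%N -> (shift <= N)%N ->
  (forall i, (i < N)%N -> arr N s 0 i = A i) ->
  (forall i, (i < N)%N -> arr N s y i = B i) ->
  runs w conv_prog s (conv_cost * (N * e))%N (fun s' =>
    [/\ env g s',
        forall a i, (a < 16)%N -> a \notin [:: 0; 3; 4] -> arr N s' a i = arr N s a i &
        forall i, (i < N)%N ->
          arr N s' 0 i = (i < len)%N && cyclic_sum N A B (i + shift)]).
Proof.
move=> es tw rs ry rl y16 y3 y4 ls sN hA hB.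
have e0 : (0 < e)%N by apply: leq_trans e_ge.
rewrite /conv_prog.
apply: (@runs_weaken _ _ _ ((N * (static_cost load_body + 8) + 6) +
  ((e * (N * (static_cost fwd_body + 30)) + 20) +
  ((N * (static_cost square_body + 8) + 6) +
  ((e * (N * (static_cost bwd_body + 30)) + 20) +
  (N * (static_cost store_body + 8) + 6)))))%N _ (fun s' =>
    [/\ env g s',
        forall a i, (a < 16)%N -> a \notin [:: 0; 3; 4] -> arr N s' a i = arr N s a i &
        forall i, (i < N)%N ->
          arr N s' 0 i = (i < len)%N && cyclic_sum N A B (i + shift)])); first last.
- by [].
- rewrite /conv_cost; move: (static_cost load_body) (static_cost fwd_body) (static_cost square_body)
    (static_cost bwd_body) (static_cost store_body) (N) (size_ge e_ge) e e0.
  by move=> a b c d f n n16 k k0; clear - n16 k0; nia.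
apply: runs_seq; apply: (runs_weaken (load_spec es ry y16 y3 y4 hA hB)) => // s1 nr1 [es1 fr1 h1].
apply: runs_seq.
have tw1 := has_twiddles_frame fr1 tw.
apply: (runs_weaken (fwd_prog_spec e_ge w_ge gN ge gD gH es1 tw1 h1)) => // s2 nr2 [es2 fr2 h2].
apply: runs_seq.
have tw2 := has_twiddles_frame fr2 tw1.
have N16 := size_ge e_ge.
have N1 : (1 < N)%N := leq_trans (isT : 1 < 16)%N N16.
have k3 n : (0 < n)%N -> (16 <= N ^ n)%N.
  by move=> n0; apply: leq_trans N16 _; rewrite -{1}(expn1 N) leq_exp2l.
have EM : (N ^ 11)%N%:R <= D%:R * (N ^ 2)%N%:R :> R.
  by rewrite -natrM -expnD ler_nat leq_exp2l.
have big : (D%:R * (N ^ 2)%N%:R + (N ^ 11)%N%:R) * (D%:R * (N ^ 2)%N%:R + (N ^ 11)%N%:R) <= (D * HD)%N%:R :> R.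
  have h : (N ^ 11 <= D * N ^ 2)%N by rewrite -expnD leq_exp2l.
  by apply: range_bound => //; rewrite -expnD leq_exp2l.
apply: (runs_weaken (square_spec e_ge w_ge gN ge gD gH es2 h2 EM big)) => // s3 nr3 [es3 fr3 h3].
apply: runs_seq.
have tw3 := has_twiddles_frame fr3 tw2.
pose sq i := fwd T e e (pair_seq R A B) i * fwd T e e (pair_seq R A B) i.
have h3' i : (i < N)%N -> appr_complex w e (8 * N ^ 13)%N%:R (2 * N ^ 4)%N%:R (sq i) (arr N s3 3 i) (arr N s3 4 i).
  have le1 : 6 * ((N ^ 2)%N%:R * (N ^ 11)%N%:R) + 2 <= (8 * N ^ 13)%N%:R :> R.
    rewrite -!natrM -natrD ler_nat -expnD (_ : 2 + 11 = 13)%N //.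
    by move: (N ^ 13)%N (k3 13 isT) => n n16; clear - n16; lia.
  have le2 : 2 * ((N ^ 2)%N%:R * (N ^ 2)%N%:R) <= (2 * N ^ 4)%N%:R :> R.
    by rewrite -!natrM ler_nat -expnD.
  by move=> /h3 [q1 q2]; split; [apply: appr_le q1|apply: appr_le q2].
apply: (runs_weaken (bwd_prog_spec e_ge w_ge gN ge gD gH es3 tw3 h3')) => // s4 nr4 [es4 fr4 h4].
have nr r : r \notin assigned conv_prog -> regs s4 r = regs s r.
  rewrite -[assigned conv_prog]/(assigned load_prog ++ (assigned fwd_prog ++
    (assigned square_prog ++ (assigned bwd_prog ++ assigned store_prog)))).
  rewrite mem_cat negb_or => /andP[n1]; rewrite mem_cat negb_or => /andP[n2].
  rewrite mem_cat negb_or => /andP[n3]; rewrite mem_cat negb_or => /andP[n4 _].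
  by rewrite nr4 // nr3 // nr2 // nr1.
have frA a i : (a < 16)%N -> a \notin [:: 0; 3; 4] -> arr N s4 a i = arr N s a i.
  rewrite !inE !negb_or => a16 /and3P [a0 a3 a4].
  by rewrite fr4 // fr3 // fr2 // fr1.
pose zz i := Im (bwd Tc e sq i).
have h4' i : (i < N)%N -> appr w D (8 * N ^ 17)%N%:R (2 * N ^ 6)%N%:R (arr N s4 4 i) (zz i).
  by move=> /h4 [_].
(* The missing division by [N] turns a count of at least 1 into a value of at least [N]. *)
have hC i : (i < N)%N -> if cyclic_sum N A B i then N%:R <= zz i else zz i <= 0.
  move=> iN; rewrite /zz /sq.
  have ii2 : 'i%C * 'i%C = -1 :> R[i].
    by apply/eqP; rewrite eq_complex /=; apply/andP; split; apply/eqP; ring.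
  rewrite (@fft_conv _ 'i%C T Tc ii2 (twiddle0 R) (@twiddle_even R) (@twiddle_odd R) (@twiddle_conj R)) //.
  rewrite Im_mulrn; case: ifP => [/(@cyclic_sumP R) c1|/negbT /(@cyclic_sumN R) ->]; last by rewrite mul0rn.
  by rewrite ler_wMn2r.
have rs4 : regs s4 16 = shift by rewrite nr.
have rl4 : regs s4 18 = len by rewrite nr.
apply: (runs_weaken (store_spec es4 rs4 rl4 ls sN h4' hC)) => // s5 _ [es5 fr5 h5].
split=> // a i a16 an; rewrite fr5 ?frA //.
by move: an; rewrite !inE negb_or => /andP[].
Qed.

End Conv.

(** * Search for the number of coins *)

Definition clear_body : cmd := wrA 0 (Reg 20) (Const 0).

Definition window_init : cmd :=
  wrA 0 (Const 2 [*] Reg 2) (Const 1) ;;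
  41 <- Reg 5 [*] Reg 5.

Definition even_step : cmd :=
  41 <- Reg 41 [/] Const 2 ;;
  16 <- Reg 2 [+] (Reg 3 [/] Reg 41) [%] Const 2 ;;
  17 <- Const 0 ;;
  18 <- Const 5 [*] Reg 2 [+] Const 1.

Definition odd_step : cmd :=
  16 <- Reg 2 ;;
  17 <- Const 1 [+] (Reg 40 [/] Reg 41) [%] Const 2 ;;
  18 <- Const 4 [*] Reg 2 [+] Const 1.

Definition level_body : cmd := even_step ;; conv_prog ;; odd_step ;; conv_prog.

(* Decides whether the target is a sum of [Reg 40] elements of [0 :: V]. *)
Definition decide_prog : cmd :=
  For 20 (Reg 5) clear_body ;;
  window_init ;;
  For 42 (Const 2 [*] Reg 6) level_body.

Definition search_step : cmd :=
  44 <- Reg 44 [/] Const 2 ;;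
  40 <- Reg 43 [+] Reg 44.

Definition search_update : cmd :=
  If (rd 0 (Const 2 [*] Reg 2)) Skip (43 <- Reg 40).

Definition search_init : cmd :=
  43 <- Const 0 ;;
  44 <- Reg 5 [*] Reg 5.

Definition search_final : cmd :=
  If (Bin OpEq (Reg 43 [+] Const 1) (Reg 5 [*] Reg 5)) Skip
    (0 <- Const 1 ;; 1 <- Reg 43 [+] Const 1 [+] Reg 4).

(* Finds, bit by bit, the largest number of coins below [N ^ 2] that does not
   suffice. *)
Definition search_prog : cmd :=
  search_init ;;
  For 45 (Const 2 [*] Reg 6) (search_step ;; decide_prog ;; search_update) ;;
  search_final.

(** The supports are short enough that no sum wraps around modulo [n]. *)
Lemma cyclic_sumE n (A B : nat -> bool) a b k : a + b < n -> k < n ->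
  (forall i, A i -> i <= a) -> (forall i, B i -> i <= b) ->
  cyclic_sum n A B k <-> exists i j, [/\ A i, B j & i + j = k].
Proof.
move=> abn kn Aa Bb; split.
  move=> /existsP [i /existsP [j /and3P [Ai Bj /eqP ijk]]]; exists i, j; split=> //.
  by move: ijk; rewrite modn_small //; apply: leq_ltn_trans abn; rewrite leq_add ?Aa ?Bb.
move=> [i [j [Ai Bj ijk]]]; have := Aa _ Ai; have := Bb _ Bj => jb ia.
have iN : i < n by apply: leq_ltn_trans kn; rewrite -ijk leq_addr.
have jN : j < n by apply: leq_ltn_trans kn; rewrite -ijk leq_addl.
apply/existsP; exists (Ordinal iN); apply/existsP; exists (Ordinal jN).
by rewrite /= Ai Bj ijk modn_small ?eqxx.
Qed.

Section Decide.
Variables (R : rcfType) (w e : nat) (g : nat -> nat) (V : seq nat) (u t : nat).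
Local Notation N := (2 ^ e).
Local Notation D := (N ^ 20).
Local Notation HD := (N ^ 28).
Hypotheses (e_ge : 4 <= e) (w_ge : 64 * e <= w).

Lemma size_sqrE : N * N = 2 ^ (2 * e).
Proof. by rewrite mul2n -addnn expnD. Qed.

Lemma size_sqr_lt16 : 16 * N * N < 2 ^ w. Proof. exact: (size_sqr_lt e_ge w_ge). Qed.

Lemma small_lt k : k <= N -> k < 2 ^ w.
Proof. by move=> kN; have := size_sqr_lt16; have := size_ge e_ge; move: (N) kN => n; nia. Qed.

Lemma two_e_lt : 2 * e < 2 ^ w.
Proof. by apply: leq_ltn_trans (ltn_expl w (isT : 1 < 2)); lia. Qed.

Lemma cst_lt k : k <= 16 -> k < 2 ^ w.
Proof. by move=> kN; apply: small_lt; apply: leq_trans (size_ge e_ge). Qed.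

Hypotheses (u_gt0 : 0 < u) (uN : 8 * u < N) (V_le : {in V, forall x, x <= u}) (tN : t < N * N).

Lemma ord_bounds (o j : nat) : o <= 1 -> j <= 5 * u ->
  [/\ 5 * u + 1 <= N, 5 * u + 1 + (u + o) <= N, u + o <= N, j + (u + o) < N & j + u < N].
Proof. by move=> o1 j5; split; lia. Qed.

Lemma u_bounds : [/\ 4 * u + 4 * u < N, 5 * u + u < N, 4 * u + 1 + u <= N, u <= N &
  [/\ 5 * u <= N, 4 * u <= N, 4 * u + 1 <= N & 2 * u < N]].
Proof. by split; [lia..|split; lia]. Qed.

Hypotheses (gN : g 5 = N) (ge : g 6 = e) (gD : g 7 = D) (gH : g 8 = (D * HD))
  (gG : g 9 = (2 ^ e.-1 * D)) (gu : g 2 = u) (gt : g 3 = t).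

Definition tables (s : state) : Prop :=
  [/\ env g s, has_twiddles R w e s,
    (forall i, i < N -> arr N s 1 i = (i == 0)) &
    (forall i, i < N -> arr N s 2 i = (i \in 0 :: V))].

Lemma tables_frame s s' : env g s' ->
  (forall a i, a < 16 -> a \notin [:: 0; 3; 4] -> arr N s' a i = arr N s a i) ->
  tables s -> tables s'.
Proof.
move=> es' fr [es tw h1 h2]; split=> //.
- by move=> r rN; rewrite !fr //; apply: tw.
- by move=> i iN; rewrite fr // h1.
- by move=> i iN; rewrite fr // h2.
Qed.

Definition window_at (s : state) (k t : nat) : Prop :=
  exists A : nat -> bool, [/\ forall i, i < N -> arr N s 0 i = A i,
    forall i, A i -> i <= 4 * u & window V u k t A].

(** Halving [kk %/ p] and [t %/ p] gives the arguments of the level already computed. The two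
    convolutions produce [B] and [C] of [window_step]: their shifts [u + odd (t %/ p)] and [u]
    recentre the sums, and their lengths cut them to the window. The parity of [kk %/ p] selects
    array 1 or 2 as the second operand. *)
Lemma level_spec s kk p : tables s -> regs s 40 = kk -> regs s 41 = 2 * p -> 0 < p ->
  window_at s (kk %/ (2 * p)) (t %/ (2 * p)) ->
  runs w level_body s (static_cost even_step + (conv_cost * (N * e) +
      (static_cost odd_step + conv_cost * (N * e)))) (fun s' =>
    [/\ tables s', regs s' 41 = p & window_at s' (kk %/ p) (t %/ p)]).
Proof.
move=> tb r40 r41 p0 [A [hA A_le win]]; have [es tw h1 h2] := tb.
have k2 : (kk %/ p)./2 = kk %/ (2 * p) by rewrite -divn2 -divnMA mulnC.
have t2 : (t %/ p)./2 = t %/ (2 * p) by rewrite -divn2 -divnMA mulnC.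
rewrite -k2 -t2 in win.
have c2 := @cst_lt 2 isT; have c5 := @cst_lt 5 isT; have c1 := @cst_lt 1 isT; have c4 := @cst_lt 4 isT.
have [b44 b51 b41 bu [b5 b4 b4' _]] := u_bounds.
have oddle : odd (t %/ p) <= 1 by case: (odd _).
have [ub ls1 ss1 _ _] := ord_bounds oddle (leq0n _).
rewrite /level_body; apply: runs_seq; apply: wp_runs; rewrite /even_step.
apply: (@wp_assign w p); first by rewrite /= r41 modn_small ?mulKn.
apply: (@wp_assign w (u + odd (t %/ p))).
  rewrite /= /update /= !es // gu gt (modn_small c2) modn2 modn_small //.
  exact: small_lt.
apply: (@wp_assign w 0); first by rewrite /= mod0n.
rewrite /wp; set s1 := setr _ 17 0.
have es1 : env g s1 by do 3 apply: env_setr => //.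
have -> : eval w s1 (Const 5 [*] Reg 2 [+] Const 1) = 5 * u + 1.
  rewrite /= /update /= es // gu (modn_small c5) (modn_small c1).
  by rewrite ![(_ %% 2 ^ w)%N]modn_small //; apply: small_lt.
set s2 := setr s1 18 _.
have es2 : env g s2 by apply: env_setr.
apply: runs_seq.
apply: (runs_weaken (conv_spec e_ge w_ge gN ge gD gH gG es2 tw erefl erefl erefl isT isT isT ls1 ss1 hA hA)) => //.
move=> s3 nr3 [es3 fr3 B_E].
have tb3 : tables s3 by apply: tables_frame tb.
have r340 : regs s3 40 = kk by rewrite nr3.
have r341 : regs s3 41 = p by rewrite nr3.
pose B i := (i < 5 * u + 1) && cyclic_sum N A A (i + (u + odd (t %/ p))).
have B_le i : B i -> i <= 5 * u by move=> /andP[]; rewrite addn1 ltnS.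
have BP j : B j <-> j <= 5 * u /\ exists j1 j2, [/\ A j1, A j2 & j1 + j2 = j + u + odd (t %/ p)].
  rewrite /B addn1 ltnS -addnA; split=> [/andP[jl h]|[jl h]].
    have [_ _ _ jN _] := ord_bounds oddle jl.
    by split=> //; have [h3 _] := cyclic_sumE b44 jN A_le A_le; exact: h3.
  have [_ _ _ jN _] := ord_bounds oddle jl.
  by rewrite jl; have [_ h3] := cyclic_sumE b44 jN A_le A_le; exact: h3.
have odd2 : odd (kk %/ p) <= 1 by case: (odd _).
apply: runs_seq; apply: wp_runs; rewrite /odd_step.
apply: (@wp_assign w u); first by rewrite -gu -es3.
apply: (@wp_assign w (1 + odd (kk %/ p))).
  rewrite /= /update /= r340 r341 (modn_small c2) (modn_small c1) modn2 modn_small //.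
  by apply: cst_lt; case: (odd _).
rewrite /wp; set s4 := setr _ 17 _.
have es4 : env g s4 by do 2 apply: env_setr => //.
have -> : eval w s4 (Const 4 [*] Reg 2 [+] Const 1) = 4 * u + 1.
  rewrite /= /update /= es3 // gu (modn_small c4) (modn_small c1).
  by rewrite ![(_ %% 2 ^ w)%N]modn_small //; apply: small_lt.
set s5 := setr s4 18 _.
have es5 : env g s5 by apply: env_setr.
pose Y i := i \in (if odd (kk %/ p) then 0 :: V else [:: 0]).
have Y_le i : Y i -> i <= u.
  rewrite /Y; case: (odd _); first exact: (mem_le V_le).
  by rewrite inE => /eqP->.
have YE i : i < N -> arr N s5 (1 + odd (kk %/ p)) i = Y i.
  have [_ _ q1 q2] := tb3; rewrite /Y => iN.
  rewrite -[LHS]/(arr N s3 (1 + odd (kk %/ p)) i).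
  by case: (odd _) => /=; rewrite ?q1 ?q2 // inE.
have [_ tw3 _ _] := tb3.
have y16 : 1 + odd (kk %/ p) < 16 by case: (odd _).
have y3 : 1 + odd (kk %/ p) != 3 by case: (odd _).
have y4 : 1 + odd (kk %/ p) != 4 by case: (odd _).
have BA i : i < N -> arr N s5 0 i = B i by move=> iN; rewrite -[LHS]/(arr N s3 0 i) B_E.
apply: (runs_weaken (conv_spec e_ge w_ge gN ge gD gH gG es5 tw3 erefl erefl erefl y16 y3 y4 b41 bu BA YE)) => //.
move=> s6 nr6 [es6 fr6 C_E].
split.
- by apply: tables_frame tb3.
- by rewrite nr6.
pose C i := (i < 4 * u + 1) && cyclic_sum N B Y (i + u).
have CP j : C j <-> j <= 4 * u /\ exists j1 j2, [/\ B j1, Y j2 & j1 + j2 = j + u].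
  have jN : j <= 4 * u -> j + u < N.
    move=> jl; have [|_ _ _ _ //] := @ord_bounds 0 j isT.
    by apply: leq_trans jl _; rewrite leq_mul2r orbT.
  rewrite /C addn1 ltnS; split=> [/andP[jl h]|[jl h]].
    by split=> //; have [h3 _] := cyclic_sumE b51 (jN jl) B_le Y_le; exact: h3.
  by rewrite jl; have [_ h3] := cyclic_sumE b51 (jN jl) B_le Y_le; exact: h3.
exists C; split=> //.
  by move=> i /CP [].
exact: (window_step V_le u_gt0 win BP CP).
Qed.

Definition decide_cost : nat :=
  static_cost clear_body + static_cost window_init + 2 * static_cost even_step +
  2 * static_cost odd_step + 4 * conv_cost + 100.

Lemma decide_budget a b c d f n : 16 <= n ->
  n * (a + 8) + 6 + (b + (2 * e * (c + (f * (n * e) + (d + f * (n * e))) + 4 + 6) + 8)) <=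
  (a + b + 2 * c + 2 * d + 4 * f + 100) * (n * e * e).
Proof.
move=> n16; have e0 : 0 < e by apply: leq_trans e_ge.
have n0 : 0 < n by apply: leq_trans n16.
have k1 : n <= n * e * e by rewrite -mulnA leq_pmulr // muln_gt0 e0.
have k2 : e <= n * e * e by rewrite leq_pmull // muln_gt0 n0.
have k3 : n * e * e = e * (n * e) by rewrite mulnC.
have k4 : 0 < n * e * e by rewrite !muln_gt0 n0 e0.
set M := n * e * e in k1 k2 k3 k4 *.
apply: (@leq_trans (M * (a + 8) + M * 6 + (M * b + (2 * (M * c) + 4 * (f * M) + 2 * (M * d) + M * 20 + M * 8)))).
  apply: leq_add; first by apply: leq_add; [rewrite leq_mul2r k1 orbT|rewrite leq_pmull].
  apply: leq_add; first by rewrite leq_pmull.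
  apply: leq_add; last by rewrite leq_pmull.
  have m1 : e * c <= M * c by rewrite leq_mul2r k2 orbT.
  have m2 : e * d <= M * d by rewrite leq_mul2r k2 orbT.
  have -> : 2 * e * (c + (f * (n * e) + (d + f * (n * e))) + 4 + 6) =
    2 * (e * c) + 4 * (f * M) + 2 * (e * d) + 20 * e by rewrite k3; lia.
  by lia.
rewrite (_ : _ + _ + _ = (a + b + 2 * c + 2 * d + 4 * f + 42) * M); last by lia.
by rewrite leq_mul2r leq_add2l orbT.
Qed.

Lemma decide_spec s kk : tables s -> regs s 40 = kk -> kk < N * N ->
  runs w decide_prog s (decide_cost * (N * e * e)) (fun s' =>
    tables s' /\ (arr N s' 0 (2 * u) != 0 <-> ksum V kk t)).
Proof.
move=> tb r40 kN; have [es tw h1 h2] := tb.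
have N16 := size_ge e_ge.
have NW : N < 2 ^ w by apply: small_lt.
have aok l : l < N -> 16 * (N + l) + 16 < 2 ^ w.
  by move=> lN; apply: (addr_ok e_ge w_ge); rewrite mul2n -addnn ltn_addr.
have c2 := @cst_lt 2 isT; have c1 := @cst_lt 1 isT.
have e2 := two_e_lt.
have eN : e <= N by exact/ltnW/ltn_expl.
apply: (@runs_weaken _ _ _ ((N * (static_cost clear_body + 4 + 4) + 6) + (static_cost window_init +
  (2 * e * ((static_cost even_step + (conv_cost * (N * e) +
      (static_cost odd_step + conv_cost * (N * e)))) + 4 + 6) + 8))) _ (fun s' =>
    tables s' /\ (arr N s' 0 (2 * u) != 0 <-> ksum V kk t))) => //; last first.
  by rewrite -[static_cost clear_body + 4 + 4]addnA; exact: decide_budget.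
pose I1 m s' := [/\ tables s', regs s' 20 = m, regs s' 40 = kk & forall i, i < m -> arr N s' 0 i = 0].
rewrite /decide_prog; apply: runs_seq.
apply: (@runs_weaken _ _ _ (N * (static_cost clear_body + 4 + 4) + 6) _ (I1 N)) => //.
  apply: (@runs_for w N _ I1) => //.
  - exact: (w_gt0 e_ge w_ge).
  - split=> //; split=> //; exact: env_setr.
  - by move=> m s' _ [[es' _ _ _] rm _ _]; split=> //=; rewrite es'.
  move=> m s' mN [tb' r20 r40' hz]; have [es' tw' h1' h2'] := tb'.
  have s5 : regs s' 5 = N by rewrite es'.
  apply: wp_runs; rewrite /clear_body.
  apply: (@wp_write_last w N 0 m) => //; first exact: aok.
    by rewrite /= mod0n.
  have fr : forall a i, a < 16 -> a \notin [:: 0; 3; 4] ->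
      arr N (setr (seta N s' 0 m 0) 20 m.+1) a i = arr N s' a i.
    move=> a i a16; rewrite !inE !negb_or => /andP[/negbTE a0 _].
    by rewrite -[LHS]/(arr N (seta N s' 0 m 0) a i) arr_seta // a0.
  split=> //; split=> //; first by apply: tables_frame tb' => //; exact: env_setr.
  move=> i; rewrite ltnS leq_eqVlt -[arr N (setr _ _ _) 0 i]/(arr N (seta N s' 0 m 0) 0 i).
  by rewrite arr_seta //=; case: (eqVneq i m) => //= _; exact: hz.
move=> s1 _ [tb1 _ r401 hz]; have [es1 tw1 h11 h21] := tb1.
have s15 : regs s1 5 = N by rewrite es1.
apply: runs_seq; apply: wp_runs; rewrite /window_init.
have [_ _ _ _ [_ _ _ u2N]] := u_bounds.
apply: (@wp_write w N 1 (2 * u)) => //; first exact: aok.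
- rewrite /= es1 // gu (modn_small c2) modn_small //; exact: ltn_trans NW.
- by rewrite /= modn_small.
rewrite /wp; set s2 := seta _ _ _ _ _.
have es2 : env g s2 by [].
have -> : eval w s2 (Reg 5 [*] Reg 5) = N * N.
  rewrite /= es1 // gN modn_small //; apply: leq_ltn_trans size_sqr_lt16.
  by rewrite -mulnA leq_pmull.
have tb2 : tables (setr s2 41 (N * N)).
  apply: tables_frame tb1; first exact: env_setr.
  move=> a i a16; rewrite !inE !negb_or => /andP[/negbTE a0 _].
  by rewrite -[LHS]/(arr N (seta N s1 0 (2 * u) 1) a i) arr_seta // a0.
(* After [j] levels the window belongs to the leading bits of [kk] and [t], those above position
   [2 * e - j]. *)
pose I j s' := [/\ tables s', regs s' 42 = j, regs s' 40 = kk, regs s' 41 = 2 ^ (2 * e - j) &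
  window_at s' (kk %/ 2 ^ (2 * e - j)) (t %/ 2 ^ (2 * e - j))].
apply: (@runs_weaken _ _ _ (2 * e * ((static_cost even_step + (conv_cost * (N * e) +
      (static_cost odd_step + conv_cost * (N * e)))) + 4 + 6) + 8) _ (I (2 * e))) => //; last first.
  move=> s' _ [tb' _ _ _ [A [hA _ win]]]; split=> //.
  rewrite subnn expn0 !divn1 in win; have [wk kw] := window_target win.
  by rewrite hA //; split=> [|/kw ->//]; case: (A _) wk => // wk _; exact: wk.
apply: (@runs_for w (2 * e) _ I) => //.
- exact: (w_gt0 e_ge w_ge).
- split=> //.
  + by have [a b c d] := tb2; split=> //; apply: env_setr.
  + by rewrite subn0 -size_sqrE.
  (* Both numbers are below [N * N = 2 ^ (2 * e)], so the top level is [k = t = 0], with only the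
     empty sum at index [2 * u]. *)
  rewrite subn0 -size_sqrE !divn_small //; exists (fun i => i == 2 * u); split.
  + move=> i iN; rewrite -[LHS]/(arr N (seta N s1 0 (2 * u) 1) 0 i) arr_seta //=.
    by case: eqP => // _; rewrite hz.
  + by move=> i /eqP ->; rewrite leq_mul2r orbT.
  have [w1 w2] := window0 V u; split; first by move=> j /eqP; exact: w1.
  by move=> x kx a b; apply/eqP; exact: w2.
- move=> j s' _ [[es' _ _ _] rj _ _ _]; split=> //=.
  by rewrite es' // ge (modn_small c2) modn_small.
move=> j s' je [tb' rj r40' r41 win].
have pE : 2 ^ (2 * e - j) = 2 * 2 ^ (2 * e - j.+1).
  by rewrite -expnS; congr (2 ^ _); lia.
rewrite pE in r41 win.
have p0 : 0 < 2 ^ (2 * e - j.+1) by rewrite expn_gt0.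
apply: (runs_weaken (level_spec tb' r40' r41 p0 win)) => // s3 nr [tb3 r413 win3].
have r42 : regs s3 42 = j by rewrite nr.
have r403 : regs s3 40 = kk by rewrite nr.
split=> //; split=> //.
by have [a b c d] := tb3; split=> //; apply: env_setr.
Qed.

Definition search_cost : nat :=
  static_cost search_init + 2 * static_cost search_step + 2 * decide_cost +
  2 * static_cost search_update + static_cost search_final + 100.

Lemma search_budget a b d c f n : 16 <= n ->
  a + (2 * e * (b + (d * (n * e * e) + c) + 4 + 6) + 8 + f) <=
  (a + 2 * b + 2 * d + 2 * c + f + 100) * (n * e * e * e).
Proof.
move=> n16; have e0 : 0 < e by apply: leq_trans e_ge.
have n0 : 0 < n by apply: leq_trans n16.
have k2 : e <= n * e * e * e by rewrite leq_pmull // !muln_gt0 n0 e0.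
have k3 : n * e * e * e = e * (n * e * e) by rewrite mulnC.
have k4 : 0 < n * e * e * e by rewrite !muln_gt0 n0 e0.
set M := n * e * e * e in k2 k3 k4 *.
apply: (@leq_trans (M * a + (2 * (M * b) + 2 * (d * M) + 2 * (M * c) + M * 20 + M * 8 + M * f))).
  apply: leq_add; first by rewrite leq_pmull.
  apply: leq_add; last by rewrite leq_pmull.
  apply: leq_add; last by rewrite leq_pmull.
  have m1 : e * b <= M * b by rewrite leq_mul2r k2 orbT.
  have m2 : e * c <= M * c by rewrite leq_mul2r k2 orbT.
  have -> : 2 * e * (b + (d * (n * e * e) + c) + 4 + 6) =
    2 * (e * b) + 2 * (d * M) + 2 * (e * c) + 20 * e by rewrite k3; lia.
  by lia.
rewrite (_ : _ + _ = (a + 2 * b + 2 * d + 2 * c + f + 28) * M); last by lia.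
by rewrite leq_mul2r leq_add2l orbT.
Qed.

Hypotheses (t_gt0 : 0 < t) (V_gt0 : {in V, forall x, 0 < x})
  (g0 : g 0 = 0) (gq : N * N + g 4 < 2 ^ w).

(** Sufficiency is monotone in the number of coins, so a largest insufficient count [l] makes
    [l + 1] the minimum. The search stays below [N * N], where a failure everywhere already excludes
    every representation. *)
Lemma search_spec s : tables s ->
  runs w search_prog s (search_cost * (N * e * e * e)) (fun s' =>
    if output s' is Some k then
      exists l, [/\ k = l + 1 + g 4, ksum V (l + 1) t & ~ ksum V l t]
    else forall l, ~ ksum V l t).
Proof.
move=> tb; have [es _ _ _] := tb.
have NW2 : N * N < 2 ^ w by apply: leq_ltn_trans gq; exact: leq_addr.
have N16 := size_ge e_ge.
have c2 := @cst_lt 2 isT; have c1 := @cst_lt 1 isT.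
have [_ _ _ _ [_ _ _ u2N]] := u_bounds.
(* The count [l] never suffices; the upper end suffices unless it is still the initial [N * N],
   which is never tested. *)
pose I j s' := exists2 l, [/\ tables s', regs s' 45 = j, regs s' 43 = l & regs s' 44 = 2 ^ (2 * e - j)] &
  [/\ l + 2 ^ (2 * e - j) <= N * N, ~ ksum V l t &
    l + 2 ^ (2 * e - j) = N * N \/ ksum V (l + 2 ^ (2 * e - j)) t].
rewrite /search_prog.
apply: (@runs_weaken _ _ _ (static_cost search_init + ((2 * e * (static_cost search_step +
   (decide_cost * (N * e * e) + static_cost search_update) + 4 + 6) + 8) + static_cost search_final)) _ (fun s' =>
    if output s' is Some k then
      exists l, [/\ k = l + 1 + g 4, ksum V (l + 1) t & ~ ksum V l t]
    else forall l, ~ ksum V l t)) => //; last first.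
  exact: search_budget.
apply: runs_seq; apply: wp_runs; rewrite /search_init.
apply: (@wp_assign w 0); first by rewrite /= mod0n.
rewrite /wp.
have -> : eval w (setr s 43 0) (Reg 5 [*] Reg 5) = N * N.
  by rewrite /= /update /= es // gN modn_small.
set s1 := setr _ 44 _.
apply: runs_seq.
apply: (@runs_weaken _ _ _ (2 * e * (static_cost search_step +
   (decide_cost * (N * e * e) + static_cost search_update) + 4 + 6) + 8) _ (I (2 * e))) => //.
  apply: (@runs_for w (2 * e) _ I) => //.
  - exact: (w_gt0 e_ge w_ge).
  - exact: two_e_lt.
  - exists 0; rewrite subn0 -size_sqrE; split=> //; try by left.
      by have [a b c d] := tb; split=> //; do 3 apply: env_setr => //.
    by move=> /ksum0 t0; move: t_gt0; rewrite t0.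
  - move=> j s' _ [l [[es' _ _ _] rj _ _] _]; split=> //=.
    by rewrite es' // ge (modn_small c2) modn_small // two_e_lt.
  move=> j s' je [l [tb' r45 r43 r44] [lN nl hl]].
  have [es' _ _ _] := tb'.
  have pE : 2 ^ (2 * e - j) = 2 * 2 ^ (2 * e - j.+1).
    by rewrite -expnS; congr (2 ^ _); lia.
  rewrite pE in r44 lN hl; set p := 2 ^ (2 * e - j.+1) in r44 lN hl *.
  have p0 : 0 < p by rewrite expn_gt0.
  have lpN : l + p < N * N.
    by apply: leq_trans lN; rewrite mul2n -addnn addnA -[X in X <= _]addn1 leq_add2l.
  apply: runs_seq; apply: wp_runs; rewrite /search_step.
  apply: (@wp_assign w p); first by rewrite /= r44 (modn_small c2) mulKn.
  rewrite /wp.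
  have -> : eval w (setr s' 44 p) (Reg 43 [+] Reg 44) = l + p.
    by rewrite /= /update /= r43 modn_small //; exact: ltn_trans NW2.
  set s2 := setr _ 40 _.
  have tb2 : tables s2.
    by have [a b c d] := tb'; split=> //; do 2 apply: env_setr => //.
  apply: runs_seq.
  apply: (runs_weaken (decide_spec tb2 erefl lpN)) => // s3 nr [tb3 dec].
  have [es3 _ _ _] := tb3.
  have q45 : regs s3 45 = j by rewrite nr.
  have q43 : regs s3 43 = l by rewrite nr.
  have q44 : regs s3 44 = p by rewrite nr.
  have q40 : regs s3 40 = l + p by rewrite nr.
  apply: wp_runs; rewrite /search_update /wp.
  have -> : eval w s3 (rd 0 (Const 2 [*] Reg 2)) = arr N s3 0 (2 * u).
    apply: (@eval_rdAc w N) => //; first by apply: (addr_ok e_ge w_ge); apply: ltn_trans u2N _; rewrite mul2n -addnn -{1}(addn0 N) ltn_add2l; apply: ltn_trans N16.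
      by rewrite es3.
    by rewrite /= es3 // gu (modn_small c2) modn_small //; apply: small_lt; exact: ltnW.
  case: (boolP (arr N s3 0 (2 * u) != 0)) => [/dec kl|h].
    split=> //; exists l; last by split=> //; [exact: ltnW|right].
    split=> //; by have [a b c d] := tb3; split=> //; apply: env_setr.
  split=> //; exists (l + p).
    split=> //; by have [a b c d] := tb3; split=> //; do 2 apply: env_setr => //.
  rewrite -/p -addnA addnn -mul2n; split=> // kl.
  by case/negP: h; apply/dec.
move=> s2 _ [l [tb2 _ r43 _]]; rewrite subnn expn0 => -[lN nl hl].
have [es2 _ _ _] := tb2.
have lW : l + 1 < 2 ^ w by apply: leq_ltn_trans NW2.
apply: wp_runs; rewrite /search_final /wp.
have -> : eval w s2 (Bin OpEq (Reg 43 [+] Const 1) (Reg 5 [*] Reg 5)) = (l + 1 == N * N).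
  rewrite /= (es2 5 isT) gN r43 (modn_small c1) (modn_small lW) (modn_small NW2).
  by rewrite modn_small //; apply: leq_ltn_trans (leq_b1 _) c1.
case: (eqVneq (l + 1) (N * N)) hl => [lE _|nE [lE|kl]] /=; last 2 first.
- by rewrite lE eqxx in nE.
- rewrite /output /= /update /= modn_small //=; exists l; split=> //.
  rewrite r43 (es2 4 isT) (modn_small lW) modn_small //.
  by apply: leq_ltn_trans gq; rewrite leq_add2r.
(* Here [l = N * N - 1] is at least [t]. Any representation could be made with at most [t] coins, so
   [l] would suffice. *)
rewrite /output (es2 0 isT) g0 /= => k /(ksum_self V_gt0) /(@ksum_mono _ _ l) kt.
by apply: nl; apply: kt; rewrite -ltnS -[l.+1]addn1 lE.
Qed.

End Decide.

(** * The algorithm *)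

Definition read_init : cmd :=
  50 <- Read (Const 0) ;;
  51 <- Read (Const 1) ;;
  2 <- Const 0.

Definition max_body : cmd :=
  53 <- Read (Reg 52 [+] Const 2) ;;
  If (Reg 2 [<] Reg 53) (2 <- Reg 53) Skip.

Definition size_init : cmd := 5 <- Const 1 ;; 6 <- Const 0.

Definition size_test : expr := Reg 5 [<] Const 8 [*] Reg 2 [+] Const 1.

Definition size_body : cmd := 5 <- Reg 5 [*] Const 2 ;; 6 <- Reg 6 [+] Const 1.

(** Repeated squaring gives the exponents 2, 4, 8 and 16; then [20 = 16 + 4] is the scale and
    [48 = 20 + 20 + 8] the bias. Index 0 is marked in both indicator arrays. *)
Definition scale_prog : cmd :=
  54 <- Reg 5 [*] Reg 5 ;;
  55 <- Reg 54 [*] Reg 54 ;;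
  56 <- Reg 55 [*] Reg 55 ;;
  57 <- Reg 56 [*] Reg 56 ;;
  7 <- Reg 57 [*] Reg 55 ;;
  8 <- Reg 7 [*] Reg 7 [*] Reg 56 ;;
  9 <- Reg 5 [/] Const 2 [*] Reg 7 ;;
  If (Reg 51 [<] Reg 2 [*] Reg 2) (4 <- Const 0)
     (4 <- (Reg 51 [-] Reg 2 [*] Reg 2) [/] Reg 2) ;;
  3 <- Reg 51 [-] Reg 4 [*] Reg 2 ;;
  wrA 1 (Const 0) (Const 1) ;;
  wrA 2 (Const 0) (Const 1).

Definition coin_body : cmd := wrA 2 (Read (Reg 52 [+] Const 2)) (Const 1).

Definition main_prog : cmd :=
  read_init ;; For 52 (Reg 50) max_body ;;
  size_init ;; While size_test size_body ;;
  scale_prog ;; For 52 (Reg 50) coin_body ;;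
  roots_prog ;; search_prog.

(** * Reading the input, choosing the parameters, and total cost *)

Section Preamble.
Variables (n : nat) (v : n.-tuple nat) (t w : nat).
Local Notation u := (max_coin v).
Hypotheses (n_gt0 : 0 < n) (v_uniq : uniq v) (v_gt0 : forall i : 'I_n, 0 < tnth v i)
  (t_gt0 : 0 < t) (w_ge : 256 * bit_length (maxn u t) <= w).

(** [2 ^ log_size] is the least power of two above [8 * u], the largest index sum in a convolution
    of two windows. *)
Definition log_size := (trunc_log 2 (8 * u)).+1.
Local Notation e := log_size.
Local Notation N := (2 ^ e).
Local Notation D := (N ^ 20).
Local Notation HD := (N ^ 28).

Lemma coin_le x : x \in (v : seq nat) -> x <= u.
Proof. by move=> /tnthP [i ->]; rewrite /max_coin (leq_bigmax i). Qed.

Lemma coin_gt0 x : x \in (v : seq nat) -> 0 < x.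
Proof. by move=> /tnthP [i ->]. Qed.

Lemma max_coin_mem : u \in (v : seq nat).
Proof.
have [i _ iE] : {i : 'I_n | true & u = tnth v i}.
  by apply: eq_bigmax_cond; rewrite card_ord.
by rewrite iE mem_tnth.
Qed.

Lemma max_coin_gt0 : 0 < u. Proof. exact: coin_gt0 max_coin_mem. Qed.

(** The coins are distinct elements of the interval from 1 to [u]. *)
Lemma ncoins_le_max : n <= u.
Proof.
rewrite -{1}(size_tuple v) -(size_iota 1 u); apply: uniq_leq_size => // x xv.
by rewrite mem_iota coin_gt0 //= add1n ltnS coin_le.
Qed.

Lemma max_nth : \max_(0 <= i < n) nth 0 v i = u.
Proof. by rewrite big_mkord; apply: eq_bigr => i _; rewrite (tnth_nth 0). Qed.

Lemma trunc_log_8max : trunc_log 2 (8 * u) = trunc_log 2 u + 3.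
Proof.
have u0 := max_coin_gt0; have b := @trunc_log_bounds 2 u isT u0.
have /andP[b1 b2] := b; apply: trunc_log_eq => //; apply/andP; split.
  by rewrite expnD mulnC leq_mul2l.
by rewrite -addSn expnD mulnC ltn_mul2r.
Qed.

Lemma log_sizeE : e = trunc_log 2 u + 4. Proof. by rewrite /log_size trunc_log_8max -addnS. Qed.

Lemma log_size_ge : 4 <= e. Proof. by rewrite log_sizeE leq_addl. Qed.

Lemma log_size_le : e <= 5 * log2 u.
Proof. by rewrite log_sizeE /log2; move: (trunc_log 2 u) => k; lia. Qed.

Lemma max_coin_lt_size : 8 * u < N. Proof. by apply: trunc_log_ltn. Qed.

Lemma size_le : N <= 16 * u.
Proof.
rewrite /log_size expnS (_ : 16 * u = 2 * (8 * u)); last by rewrite mulnA.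
by rewrite leq_mul2l trunc_logP // muln_gt0 max_coin_gt0.
Qed.

Lemma lt_bit_length x y : x <= y -> x < 2 ^ bit_length y.
Proof. by move=> xy; apply: leq_ltn_trans xy _; apply: trunc_log_ltn. Qed.

(** With [L] the logarithm of [u], [64 * (L + 4) <= 256 * (L + 1)]; this is where the factor 256
    comes from. *)
Lemma word_size_ge : 64 * e <= w.
Proof.
apply: leq_trans w_ge; rewrite log_sizeE /bit_length.
have : trunc_log 2 u <= trunc_log 2 (maxn u t) by apply: leq_trunc_log; exact: leq_maxl.
by move: (trunc_log 2 u) (trunc_log 2 _) => a b; lia.
Qed.

Lemma double_target_lt : 2 * t < 2 ^ w.
Proof.
have tl := lt_bit_length (leq_maxr u t).
apply: (@leq_trans (2 ^ (bit_length (maxn u t)).+1)); first by rewrite expnS ltn_mul2l.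
by rewrite leq_exp2l //; apply: leq_trans w_ge; rewrite /bit_length; lia.
Qed.

(** The largest number of coins [u] whose removal leaves at least [u * u], as [ksum_reduce]
    requires. *)
Definition quota := if t < u * u then 0 else (t - u * u) %/ u.
Definition rest := t - quota * u.

Lemma quota_le : quota * u <= t.
Proof.
rewrite /quota; case: (ltnP t (u * u)) => h; first by rewrite mul0n.
by apply: leq_trans (leq_trunc_div _ _) _; exact: leq_subr.
Qed.

Lemma rest_gt0 : 0 < rest.
Proof.
have u0 := max_coin_gt0; rewrite /rest /quota; case: (ltnP t (u * u)) => h; first by rewrite mul0n subn0.
rewrite subn_gt0; apply: leq_ltn_trans (leq_trunc_div _ _) _; have : 0 < u * u by rewrite muln_gt0 u0.
by lia.
Qed.

Lemma rest_lt : rest < N * N.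
Proof.
have u0 := max_coin_gt0.
have uu : u * u + u <= N * N.
  apply: leq_trans (_ : (8 * u) * (8 * u) <= _); last by apply: leq_mul; exact/ltnW/max_coin_lt_size.
  by move: (u) u0 => x; nia.
apply: leq_trans uu; rewrite /rest /quota; case: (ltnP t (u * u)) => h.
  by rewrite mul0n subn0 (leq_trans h) // leq_addr.
have := divn_eq (t - u * u) u; have := ltn_pmod (t - u * u) u0; lia.
Qed.

Lemma solution_rest k : ksum v k rest -> (forall l, l < k -> ~ ksum v l rest) ->
  is_solution v t (Some (k + quota)).
Proof.
have u0 := max_coin_gt0; have uv := max_coin_mem.
have tE : rest + quota * u = t by rewrite subnK // quota_le.
rewrite /rest /quota in tE *; case: (ltnP t (u * u)) tE => h tE kr kmin.
  rewrite mul0n subn0 in kr kmin; rewrite addn0; exact: ksum_solution.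
have rge : u * u <= t - (t - u * u) %/ u * u.
  by have := leq_trunc_div (t - u * u) u; lia.
have red l := ksum_reduce coin_le ((t - u * u) %/ u) l u0 uv rge; rewrite tE in red.
apply: ksum_solution.
  by apply/red; rewrite leq_addl addnK.
by move=> l lk /red [ql]; apply: kmin; rewrite ltn_subLR // addnC.
Qed.

Lemma no_solution_rest : (forall k, ~ ksum v k rest) -> is_solution v t None.
Proof.
have u0 := max_coin_gt0; have uv := max_coin_mem.
have tE : rest + quota * u = t by rewrite subnK // quota_le.
move=> h; apply: ksum_no_solution => k; rewrite /rest /quota in tE h *; case: (ltnP t (u * u)) tE h => ut tE h.
  by rewrite mul0n subn0 in h; exact: h.
have rge : u * u <= t - (t - u * u) %/ u * u.
  by have := leq_trunc_div (t - u * u) u; lia.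
by rewrite -tE; move=> /(ksum_reduce coin_le _ _ u0 uv rge) [_]; exact: h.
Qed.

Local Notation cells := (nth 0 [:: n, t & v]).

Lemma le_size_lt k : k <= N -> k < 2 ^ w.
Proof. exact: (small_lt log_size_ge word_size_ge). Qed.

Lemma cst_small k : k <= 16 -> k < 2 ^ w.
Proof. exact: (cst_lt log_size_ge word_size_ge). Qed.

Lemma max_coin_lt : u < N.
Proof. by apply: leq_ltn_trans max_coin_lt_size; rewrite leq_pmull. Qed.

Lemma ncoins_lt_size : n.+1 < N.
Proof.
have := max_coin_lt_size; have := ncoins_le_max; have := max_coin_gt0; move: (u) (N) => a b; lia.
Qed.

Lemma max_spec s : regs s 50 = n -> regs s 51 = t -> regs s 2 = 0 -> regs s 0 = 0 ->
  memory s = cells ->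
  runs w (For 52 (Reg 50) max_body) s (n * (static_cost max_body + 8) + 6) (fun s' =>
    [/\ regs s' 50 = n, regs s' 51 = t, regs s' 2 = u, regs s' 0 = 0 & memory s' = cells]).
Proof.
move=> r50 r51 r2 r0 mm.
have nN := ncoins_lt_size.
have c1 := @cst_small 1 isT; have c2 := @cst_small 2 isT.
pose I j s' := [/\ regs s' 52 = j, regs s' 2 = \max_(0 <= i < j) nth 0 v i &
  [/\ regs s' 50 = n, regs s' 51 = t, regs s' 0 = 0 & memory s' = cells]].
apply: (@runs_weaken _ _ _ (n * (static_cost max_body + 4 + 4) + 6) _ (I n)); first last.
- by move=> s' _ [_ r2' [? ? ? ?]]; split=> //; rewrite r2' max_nth.
- by rewrite -addnA.
apply: (@runs_for w n _ I) => //.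
- exact: (w_gt0 log_size_ge word_size_ge).
- by apply: le_size_lt; exact: (ltnW (ltnW nN)).
- by split=> //; rewrite big_geq.
- by move=> j s' _ [rj _ [rn _ _ _]].
move=> j s' jn [rj r2' [rn rt r0' mm']].
apply: wp_runs; rewrite /max_body.
apply: (@wp_assign w (nth 0 v j)).
  rewrite /= rj mm' (modn_small c2) modn_small ?addn2 //.
  by apply: le_size_lt; exact: leq_trans (ltnW nN).
set x := nth 0 v j; set m := \max_(0 <= i < j) nth 0 v i in r2'.
rewrite /wp; set s1 := setr _ _ _.
have -> : eval w s1 (Reg 2 [<] Reg 53) = (m < x).
  by rewrite /= /update /= r2' modn_small //; apply: leq_ltn_trans (leq_b1 _) c1.
have mS : \max_(0 <= i < j.+1) nth 0 v i = maxn m x by rewrite big_nat_recr.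
case: (ltnP m x) => mx /=; split=> //; split=> //; rewrite mS /=.
  by rewrite /update /=; apply/esym/maxn_idPr/ltnW.
by rewrite /update /= r2'; apply/esym/maxn_idPl.
Qed.

Lemma size_spec s : regs s 5 = 1 -> regs s 6 = 0 ->
  regs s 50 = n -> regs s 51 = t -> regs s 2 = u -> regs s 0 = 0 -> memory s = cells ->
  runs w (While size_test size_body) s (e * (static_cost size_body + 10) + 10) (fun s' =>
    [/\ regs s' 5 = N, regs s' 6 = e, regs s' 2 = u, memory s' = cells &
     [/\ regs s' 50 = n, regs s' 51 = t & regs s' 0 = 0]]).
Proof.
move=> r5 r6 r50 r51 r2 r0 mm.
have c1 := @cst_small 1 isT; have c2 := @cst_small 2 isT; have c8 := @cst_small 8 isT.
pose I j s' := [/\ regs s' 5 = 2 ^ j, regs s' 6 = j, regs s' 2 = u, memory s' = cells &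
     [/\ regs s' 50 = n, regs s' 51 = t & regs s' 0 = 0]].
have u8 : 8 * u + 1 < 2 ^ w by apply: le_size_lt; rewrite addn1; exact: max_coin_lt_size.
have testE s' j : regs s' 5 = 2 ^ j -> regs s' 2 = u -> eval w s' size_test = (2 ^ j <= 8 * u).
  move=> q5 q2; rewrite /= q5 q2 (modn_small c1) (modn_small c8).
  rewrite [((8 * u) %% _)%N]modn_small; last by apply: ltn_trans u8; rewrite addn1.
  by rewrite (modn_small u8) addn1 ltnS modn_small //; apply: leq_ltn_trans (leq_b1 _) c1.
have cE : cost size_test <= 9 by [].
apply: (runs_weaken (@runs_while w e (static_cost size_body) 9 I _ _ _ cE _ _ _)) => //.
- move=> j s' je [q5 q6 q2 mm' q]; rewrite (testE _ j) //.
  have -> : 2 ^ j <= 8 * u.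
    apply: leq_trans (_ : 2 ^ trunc_log 2 (8 * u) <= _); first by rewrite leq_exp2l.
    by rewrite trunc_logP // muln_gt0 max_coin_gt0.
  split=> //; apply: wp_runs; rewrite /size_body.
  have jN : 2 ^ j.+1 < 2 ^ w by apply: le_size_lt; rewrite leq_exp2l.
  apply: (@wp_assign w (2 ^ j.+1)); first by rewrite /= q5 (modn_small c2) -expnSr modn_small.
  rewrite /wp; set s1 := setr s' 5 _.
  have -> : eval w s1 (Reg 6 [+] Const 1) = j.+1.
    rewrite /= /update /= q6 (modn_small c1) addn1 modn_small //.
    by apply: le_size_lt; apply: leq_trans je _; exact/ltnW/ltn_expl.
  by split.
- move=> s' [q5 q6 q2 mm' q]; rewrite (testE _ e) //.
  by rewrite leqNgt max_coin_lt_size.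
Qed.

Definition scale_registers (s : state) : Prop :=
  [/\ regs s 5 = N, regs s 6 = e, regs s 7 = D, regs s 8 = D * HD & regs s 9 = 2 ^ e.-1 * D].

Lemma scale_spec s : regs s 5 = N -> regs s 6 = e -> regs s 2 = u -> memory s = cells ->
  regs s 50 = n -> regs s 51 = t -> regs s 0 = 0 ->
  runs w scale_prog s (static_cost scale_prog) (fun s' =>
    [/\ scale_registers s', [/\ regs s' 0 = 0, regs s' 2 = u, regs s' 3 = rest & regs s' 4 = quota],
     regs s' 50 = n, forall x, x < 16 * N -> memory s' x = cells x &
     forall i, (i < N -> arr N s' 1 i = (i == 0)) /\ (i < N -> arr N s' 2 i = (i == 0))]).
Proof.
move=> r5 r6 r2 mm r50 r51 r0.
have X k : k < 64 -> N ^ k < 2 ^ w by exact: (size_pow_lt log_size_ge word_size_ge).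
have c1 := @cst_small 1 isT; have c2 := @cst_small 2 isT.
have n2E : N ^ 2 = N * N by rewrite expnS expn1.
have t2 := double_target_lt; have tW : t < 2 ^ w by apply: leq_ltn_trans t2; rewrite leq_pmull.
have uW : u < 2 ^ w by apply: le_size_lt; exact/ltnW/max_coin_lt.
have uuW : u * u < 2 ^ w.
  by apply: leq_ltn_trans (X 2 isT); rewrite n2E; apply: leq_mul; exact/ltnW/max_coin_lt.
apply: wp_runs; rewrite /scale_prog.
apply: (@wp_assign w (N ^ 2)); first by rewrite /= /update /= r5 -n2E modn_small // X.
apply: (@wp_assign w (N ^ 4)); first by rewrite /= /update /= -expnD modn_small // X.
apply: (@wp_assign w (N ^ 8)); first by rewrite /= /update /= -expnD modn_small // X.
apply: (@wp_assign w (N ^ 16)); first by rewrite /= /update /= -expnD modn_small // X.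
apply: (@wp_assign w D); first by rewrite /= /update /= -expnD modn_small // X.
apply: (@wp_assign w (D * HD)).
  rewrite /= /update /= -!expnD [((N ^ (20 + 20)) %% _)%N]modn_small ?X // -expnD.
  by rewrite modn_small // X.
apply: (@wp_assign w (2 ^ e.-1 * D)).
  have half : N %/ 2 = 2 ^ e.-1 by rewrite /log_size expnS mulKn.
  rewrite /= /update /= r5 (modn_small c2) half modn_small //.
  apply: leq_ltn_trans (X 21 isT); rewrite (expnS N 20) leq_mul2r leq_exp2l //.
  by rewrite leq_pred orbT.
set s1 := setr _ 9 _.
change (wp w (If (Reg 51 [<] Reg 2 [*] Reg 2) (4 <- Const 0)
     (4 <- (Reg 51 [-] Reg 2 [*] Reg 2) [/] Reg 2)) (wp w (3 <- Reg 51 [-] Reg 4 [*] Reg 2 ;;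
  wrA 1 (Const 0) (Const 1) ;;
  wrA 2 (Const 0) (Const 1)) (fun s' =>
    [/\ scale_registers s', [/\ regs s' 0 = 0, regs s' 2 = u, regs s' 3 = rest & regs s' 4 = quota],
     regs s' 50 = n, forall x, x < 16 * N -> memory s' x = cells x &
     forall i, (i < N -> arr N s' 1 i = (i == 0)) /\ (i < N -> arr N s' 2 i = (i == 0))])) s1).
have h51 : regs s1 51 = t by [].
have h2 : regs s1 2 = u by [].
have step : wp w (3 <- Reg 51 [-] Reg 4 [*] Reg 2 ;;
  wrA 1 (Const 0) (Const 1) ;;
  wrA 2 (Const 0) (Const 1)) (fun s' =>
    [/\ scale_registers s', [/\ regs s' 0 = 0, regs s' 2 = u, regs s' 3 = rest & regs s' 4 = quota],
     regs s' 50 = n, forall x, x < 16 * N -> memory s' x = cells x &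
     forall i, (i < N -> arr N s' 1 i = (i == 0)) /\ (i < N -> arr N s' 2 i = (i == 0))]) (setr s1 4 (quota)).
  have ql : quota * u <= t by exact: quota_le.
  apply: (@wp_assign w (rest)).
    rewrite /= /update /= r51 r2 [((_ * _) %% _)%N]modn_small; last by apply: leq_ltn_trans tW.
    rewrite addnBA; last by apply: ltnW; apply: leq_ltn_trans tW.
    by rewrite addnC -addnBA // modnDl modn_small //; apply: leq_ltn_trans (leq_subr _ _) tW.
  have s5 : regs (setr (setr s1 4 (quota)) 3 (rest)) 5 = N by [].
  have a0 : 16 * (N + 0) + 16 < 2 ^ w.
    by apply: (addr_ok log_size_ge word_size_ge); rewrite muln_gt0 expn_gt0.
  apply: (@wp_write w N 1 0) => //.
  - by rewrite /= mod0n.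
  - by rewrite /= modn_small.
  apply: (@wp_write_last w N 1 0) => //.
  - by rewrite /= mod0n.
  - by rewrite /= modn_small.
  split=> //.
  - move=> x xN; rewrite /= /update /cell !ifN ?mm //; apply/eqP; lia.
  (* The arrays start beyond the input, in memory that is initially 0, so they need no clearing. *)
  have z a i : arr N (setr (setr s1 4 (quota)) 3 (rest)) a i = 0.
    rewrite /arr -[memory _]/(memory s) mm nth_default //= size_tuple /cell.
    have := ncoins_lt_size; lia.
  by move=> i; split=> iN; rewrite !arr_seta // z /=; case: (i == 0).
have qE : quota = if t < u * u then 0 else (t - u * u) %/ u by [].
apply: (@wp_if w (t < u * u)).
- rewrite /= /update /= r51 r2 (modn_small uuW) modn_small //.
  by apply: leq_ltn_trans (leq_b1 _) c1.
- by move=> tu; apply: wp_set step; rewrite qE tu /= mod0n.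
move=> tu; apply: wp_set step; rewrite qE (negbTE tu) /= /update /= r51 r2 (modn_small uuW).
rewrite addnBA; last exact: ltnW.
rewrite -leqNgt in tu.
by rewrite [t + _]addnC -addnBA // modnDl modn_small //; apply: leq_ltn_trans (leq_subr _ _) tW.
Qed.

Lemma coin_spec s : regs s 5 = N -> regs s 50 = n ->
  (forall x, x < 16 * N -> memory s x = cells x) ->
  (forall i, (i < N -> arr N s 1 i = (i == 0)) /\ (i < N -> arr N s 2 i = (i == 0))) ->
  runs w (For 52 (Reg 50) coin_body) s (n * (static_cost coin_body + 8) + 6) (fun s' =>
    [/\ env (regs s) s', forall i, i < N -> arr N s' 1 i = (i == 0) &
        forall i, i < N -> arr N s' 2 i = (i \in 0 :: v)]).
Proof.
move=> r5 r50 mm h12.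
have nN := ncoins_lt_size.
have c1 := @cst_small 1 isT; have c2 := @cst_small 2 isT.
pose I j s' := [/\ env (regs s) s', regs s' 52 = j /\ regs s' 50 = n,
  forall x, x < 16 * N -> memory s' x = cells x,
  forall i, i < N -> arr N s' 1 i = (i == 0) &
  forall i, i < N -> arr N s' 2 i = (i \in 0 :: take j v)].
apply: (@runs_weaken _ _ _ (n * (static_cost coin_body + 4 + 4) + 6) _ (I n)); first last.
- by move=> s' _ [es' _ _ h1 h2]; split=> // i iN; rewrite h2 // take_oversize // size_tuple.
- by rewrite -addnA.
apply: (@runs_for w n _ I) => //.
- exact: (w_gt0 log_size_ge word_size_ge).
- by apply: le_size_lt; exact: (ltnW (ltnW nN)).
- split=> //; first by apply: env_setr.
    by move=> i iN; rewrite -[LHS]/(arr N s 1 i); have [h _] := h12 i; exact: h.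
  move=> i iN; rewrite take0 inE -[LHS]/(arr N s 2 i); have [_ h] := h12 i; exact: h.
- by move=> j s' _ [_ [rj rn] _ _ _].
move=> j s' jn [es' [rj rn] mm' h1 h2].
have xv : nth 0 v j \in (v : seq nat) by rewrite mem_nth // size_tuple.
have xN : nth 0 v j < N by apply: leq_ltn_trans (coin_le xv) max_coin_lt.
apply: wp_runs; rewrite /coin_body.
apply: (@wp_write_last w N 1 (nth 0 v j)) => //.
- by apply: (addr_ok log_size_ge word_size_ge); rewrite mul2n -addnn ltn_addr.
- by rewrite es' // r5.
- rewrite /= rj (modn_small c2) modn_small ?addn2; last first.
    by apply: le_size_lt; apply: leq_trans (ltnW nN).
  rewrite mm' //; apply: leq_trans (_ : N <= _); last by rewrite leq_pmull.
  by apply: leq_ltn_trans _ nN; rewrite ltnS.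
- by rewrite /= modn_small.
have E a i : a < 16 -> arr N (setr (seta N s' 2 (nth 0 v j) 1) 52 j.+1) a i =
    if (a == 2) && (i == nth 0 v j) then 1 else arr N s' a i.
  by move=> a16; rewrite -[LHS]/(arr N (seta N s' 2 (nth 0 v j) 1) a i) arr_seta.
split=> //; split=> //.
- exact: env_setr.
- move=> x xlt; rewrite /= /update /cell ifN ?mm' //; apply/eqP; lia.
- by move=> i iN; rewrite E //= h1.
move=> i iN; rewrite E // h2 // (take_nth 0) ?size_tuple // -rcons_cons mem_rcons inE /=.
by case: eqP.
Qed.

Definition main_cost : nat :=
  static_cost read_init + static_cost max_body + static_cost size_init +
  static_cost size_body + static_cost scale_prog + static_cost coin_body +
  roots_cost + search_cost + 100.

Lemma main_budget a b c d f h r q : 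
  a + ((n * (b + 8) + 6) + (c + ((e * (d + 10) + 10) + (f + ((n * (h + 8) + 6) +
    (r * (N * e) + q * (N * e * e * e))))))) <=
  (a + b + c + d + f + h + r + q + 100) * (N * e * e * e).
Proof.
have e0 : 0 < e by [].
have N0 : 0 < N by rewrite expn_gt0.
have k1 : e <= N * e * e * e by rewrite leq_pmull // !muln_gt0 N0.
have k2 : n <= N * e * e * e.
  by apply: leq_trans (ltnW (ltnW ncoins_lt_size)) _; rewrite -!mulnA leq_pmulr // !muln_gt0.
have k3 : N * e <= N * e * e * e by rewrite -[leqRHS]mulnA leq_pmulr // muln_gt0.
have k4 : 0 < N * e * e * e by rewrite !muln_gt0 N0.
move: (N * e * e * e) k1 k2 k3 k4 => M; move: (N * e) => K k1 k2 k3 k4.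
have m1 : n * (b + 8) <= M * (b + 8) by rewrite leq_mul2r k2 orbT.
have m2 : n * (h + 8) <= M * (h + 8) by rewrite leq_mul2r k2 orbT.
have m3 : e * (d + 10) <= M * (d + 10) by rewrite leq_mul2r k1 orbT.
have m4 : r * K <= M * r by rewrite [leqRHS]mulnC leq_mul2l k3 orbT.
have m5 : a <= M * a by rewrite leq_pmull.
have m6 : c <= M * c by rewrite leq_pmull.
have m7 : f <= M * f by rewrite leq_pmull.
apply: (@leq_trans (M * a + ((M * (b + 8) + M * 6) + (M * c + ((M * (d + 10) + M * 10) + (M * f + ((M * (h + 8) + M * 6) +
    (M * r + q * M)))))))).
  by do ?apply: leq_add => //; rewrite leq_pmull.
rewrite (_ : M * a + _ = (a + b + c + d + f + h + r + q + 48) * M); last by lia.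
by rewrite leq_mul2r leq_add2l orbT.
Qed.

Lemma main_spec : runs w main_prog (input v t) (main_cost * (N * e * e * e))
  (fun s' => is_solution v t (output s')).
Proof.
have c0 : 0 < 2 ^ w by rewrite expn_gt0.
have c1 := @cst_small 1 isT.
have NN := size_pow_lt log_size_ge word_size_ge.
rewrite /main_prog.
apply: (@runs_weaken _ _ _ (static_cost read_init + ((n * (static_cost max_body + 8) + 6) +
  (static_cost size_init + ((e * (static_cost size_body + 10) + 10) + (static_cost scale_prog +
  ((n * (static_cost coin_body + 8) + 6) + (roots_cost * (N * e) +
   search_cost * (N * e * e * e)))))))) _ (fun s' => is_solution v t (output s'))) => //; last first.
  exact: main_budget.
apply: runs_seq; apply: wp_runs; rewrite /read_init.
apply: (@wp_assign w n); first by rewrite /= mod0n.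
apply: (@wp_assign w t); first by rewrite /= modn_small.
apply: wp_set; first by rewrite /= mod0n.
apply: runs_seq.
set s0 := setr _ 2 0.
apply: (runs_weaken (@max_spec s0 erefl erefl erefl erefl erefl)) => // s1 _ [r50 r51 r2 r0 mm].
apply: runs_seq; apply: wp_runs; rewrite /size_init.
apply: (@wp_assign w 1); first by rewrite /= modn_small.
apply: (@wp_set w 0); first by rewrite /= mod0n.
apply: runs_seq.
apply: (runs_weaken (@size_spec (setr (setr s1 5 1) 6 0) erefl erefl r50 r51 r2 r0 mm)) => //.
move=> s2 _ [q5 q6 q2 qm [q50 q51 q0]].
apply: runs_seq.
apply: (runs_weaken (scale_spec q5 q6 q2 qm q50 q51 q0)) => // s3 _.
move=> [[g5 g6 g7 g8 g9] [g0 g2 g3 g4] p50 pm p12].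
apply: runs_seq.
apply: (runs_weaken (coin_spec g5 p50 pm p12)) => // s4 _ [es4 h1 h2].
apply: runs_seq.
(* The program knows nothing of the field; [realalg] is a concrete real closed field in which its
   words are interpreted. *)
apply: (runs_weaken (@roots_spec realalg w e (regs s3) log_size_ge word_size_ge g5 g6 g7 g8 s4 es4)) => // s5 _ [es5 fr5 tw5].
have tb5 : tables realalg w e (regs s3) v s5.
  by split=> // i iN; rewrite fr5 // ?h1 ?h2.
(* The printed count is at most [N * N] plus the quota; each of the two is below half of [2 ^ w]. *)
have gq : N * N + regs s3 4 < 2 ^ w.
  have t2 := double_target_lt.
  have qt : regs s3 4 <= t.
    by rewrite g4; apply: leq_trans quota_le; rewrite leq_pmulr // max_coin_gt0.
  have n2 : N * N * 2 < 2 ^ w.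
    by apply: leq_ltn_trans (NN 3 isT); rewrite (expnS N 2) (expnS N 1) expn1 mulnC leq_mul2r (leq_trans _ (size_ge log_size_ge)) // orbT.
  lia.
have V0 : {in (v : seq nat), forall x, x <= u} by move=> x; exact: coin_le.
have V1 : {in (v : seq nat), forall x, 0 < x} by move=> x; exact: coin_gt0.
apply: (runs_weaken (@search_spec realalg w e (regs s3) v u rest log_size_ge word_size_ge max_coin_gt0 max_coin_lt_size V0 rest_lt
  g5 g6 g7 g8 g9 g2 g3 rest_gt0 V1 g0 gq s5 tb5)) => // s6 _.
case: (output s6) => [k [l [-> kl nl]]|nk]; last exact: no_solution_rest.
rewrite g4; apply: solution_rest => // l'; rewrite addn1 ltnS => ll kl'.
by apply: nl; apply: ksum_mono kl'.
Qed.

End Preamble.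

Theorem theorem3 :
  exists (P : cmd) (c C : nat),
    0 < c /\
    forall (n : nat) (v : n.-tuple nat) (t w : nat),
      0 < n -> uniq v -> (forall i : 'I_n, 0 < tnth v i) -> 0 < t ->
      c * bit_length (maxn (max_coin v) t) <= w ->
      exists (k : nat) (s : state),
        [/\ exec w P (input v t) k s,
            is_solution v t (output s)
          & k <= C * (max_coin v * log2 (max_coin v) ^ 3)].
Proof.
(* The factor [16 * 5 ^ 3] comes from [N <= 16 * u] and [e <= 5 * log2 u]; the latter uses that
   [log2] is at least 1. *)
exists main_prog, 256, (main_cost * (16 * 5 ^ 3)); split=> // n v t w n0 vu v0 t0 wge.
have [k [s [ex kle sol]]] := main_spec n0 vu v0 t0 wge.
exists k, s; split=> //; apply: leq_trans kle _.
rewrite -[leqRHS]mulnA leq_mul2l; apply/orP; right.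
rewrite -mulnA -mulnA mulnACA -expnMn.
apply: leq_mul; first exact: size_le n0 v0.
have ele := log_size_le n0 vu v0 t0 wge.
by rewrite expnS expnS expn1 !leq_mul.
Qed.
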